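(* Assume that $\{x_i\}_{i=1}^M,\{\beta_j\}_{j=1}^M$ are LLN appropriate sequences of random variables. Let $y_i=1-x_i$ and $$\mathbf F_1(z)=\sum_{i=0}^\infty\mathfrak c_iz^i,\qquad \mathbf F_2(z)=\sum_{i=0}^\infty\mathfrak g_iz^i,$$ where $\mathfrak c_i=\lim_{M\to\infty}\mathbb{E}[M^{-1}(y_1^i+\cdots+y_M^i)]$ and $\mathfrak g_i=\lim_{M\to\infty}\mathbb{E}[M^{-1}(\beta_1^i+\cdots+\beta_M^i)]$. Let $\gamma\in(0,1)$. Then, for $\lambda=(\lambda_1\ge\cdots\ge\lambda_N)$ distributed according to $\overline{\rho_{\beta,y}}$, for every $\nu\ge1$ and all non-negative integers $k_1,\dots,k_\nu$, $$\lim_{\substack{N,M\to\infty\\N/M\to\gamma}}\mathbb{E}\Big[\prod_{j=1}^\nu\Big(\frac1N\sum_{i=1}^N\Big(\frac{\lambda_i+N-i}{N}\Big)^{k_j}\Big)\Big]=\prod_{j=1}^\nu\mathfrak m_{k_j},$$ where $$\mathfrak m_k=\frac{1}{2\pi i(k+1)}\oint_{|z|=r}\frac1{z-1}\Big(\Big(\frac1\gamma-1\Big)\Big(\frac{1-z}{z}\mathbf F_2(z)-\frac{1-z}{z}\Big)+\frac{z-1}{z}\mathbf F_1\Big(\frac1z\Big)\Big)^{k+1}dz$$ and the contour is a positively oriented circle with $1-\delta<r<1$.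
   Context: Random weights. For each integer $M\ge 1$, $x_1,\dots,x_M,\beta_1,\dots,\beta_M$ are real random variables (their joint law may depend on $M$, independence is not assumed); $\beta_i$ is supported on $(0,1)$ and $x_i$ is supported on $(\delta,2-\delta)$ for a fixed $\delta\in(0,1)$. Put $w_i=\beta_i/(1-\beta_i)$. LLN appropriate. Sequences $\{u_i\}_{i=1}^M,\{v_j\}_{j=1}^M$ of random variables are LLN appropriate if: (i) the limits $a_k=\lim_{M}\mathbb{E}[M^{-1}\sum_{i=1}^M u_i^k]$ and $b_k=\lim_M\mathbb{E}[M^{-1}\sum_{i=1}^M v_i^k]$ exist for all integers $k\ge0$, and for all integers $r,l\ge0$, all $0<\gamma_1,\dots,\gamma_r,\varepsilon_1,\dots,\varepsilon_l\le1$ and all integers $k_1,\dots,k_r,m_1,\dots,m_l\ge0$, $$\lim_{M\to\infty}\mathbb{E}\Big[\prod_{i=1}^r\frac{1}{\lfloor\gamma_iM\rfloor}\sum_{j=1}^{\lfloor\gamma_iM\rfloor}u_j^{k_i}\prod_{i=1}^l\frac1{\lfloor\varepsilon_iM\rfloor}\sum_{j=1}^{\lfloor\varepsilon_iM\rfloor}v_j^{m_i}\Big]=\prod_{i=1}^ra_{k_i}\prod_{j=1}^lb_{m_j};$$ (ii) the power series $\sum_m a_mz^m$ and $\sum_m b_mz^m$ converge uniformly in a neighborhood of $0$. Schur measure. $\mathbb{GT}_N$ is the set of $\lambda=(\lambda_1\ge\cdots\ge\lambda_N)$, $\lambda_i\in\mathbb Z$; $s_\lambda(x_1,\dots,x_N)=\det(x_i^{\lambda_j+N-j})/\det(x_i^{N-j})$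 is the Schur function and $\lambda'$ the conjugate. For $1\le N<M$ and given weights, the Schur measure on $\mathbb{GT}_N$, supported on $\lambda$ with $M-N\ge\lambda_1\ge\cdots\ge\lambda_N\ge0$, is $$\rho_{\beta,y}[\lambda]=\prod_{i=1}^N\prod_{j=N+1}^M(1+w_jx_i)^{-1}s_\lambda(x_1,\dots,x_N)\,s_{\lambda'}(w_{N+1},\dots,w_M),$$ and $\overline{\rho_{\beta,y}}[\lambda]=\mathbb{E}[\rho_{\beta,y}[\lambda]]$ is its average over the random weights. *)

(* Defs.v *)
From HB Require Import structures.
From mathcomp Require Import all_boot all_order all_algebra.
From mathcomp Require Import complex.
(* Only the canonical structures: mpoly's notations clash with those of analysis. *)
From mathcomp Require Import(canonicals) mpoly.
From mathcomp Require Import all_classical all_reals all_analysis.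

Set Implicit Arguments.
Unset Strict Implicit.
Unset Printing Implicit Defensive.

Import Order.TTheory GRing.Theory Num.Theory.
Import numFieldNormedType.Exports.

Local Open Scope classical_set_scope.
Local Open Scope ring_scope.
Local Open Scope complex_scope.

Section Schur.

Definition staircase n (j : 'I_n) : nat := (n - j.+1)%N.

Lemma vandermonde_dvd (A : comNzRingType) n (a : 'I_n -> A) (mu : 'I_n -> nat) :
  exists p : A, p * \det (\matrix_(i < n, j < n) a i ^+ staircase j)
                = \det (\matrix_(i < n, j < n) a i ^+ mu j).
Proof.
pose Q : {poly A} := \prod_(i < n) ('X - (a i)%:P).
have Qmon : Q \is monic by exact: monic_prod_XsubC.
have szQ : size Q = n.+1.
  by rewrite /Q size_prod_XsubC /index_enum -enumT size_enum_ord.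
pose r j : {poly A} := Pdiv.Ring.rmodp 'X^(mu j) Q.
have szr j : (size (r j) <= n)%N.
  have : Q != 0 by rewrite -size_poly_eq0 szQ.
  by move=> /(Pdiv.CommonRing.ltn_rmodpN0 'X^(mu j)); rewrite szQ.
have rX j i : (r j).[a i] = a i ^+ mu j.
  have /(congr1 (horner^~ (a i))) /= := Pdiv.RingMonic.rdivp_eq Qmon 'X^(mu j).
  rewrite hornerXn hornerD hornerM => ->.
  suff -> : Q.[a i] = 0 by rewrite mulr0 add0r.
  by rewrite /Q horner_prod (bigD1 i) //= hornerXsubC subrr mul0r.
exists (\det (\matrix_(k < n, j < n) (r j)`_(staircase k))).
rewrite mulrC -det_mulmx; congr determinant.
apply/matrixP => i j; rewrite !mxE -[RHS]rX.
rewrite (horner_coef_wide _ (szr j)) [RHS](reindex_inj rev_ord_inj) /=.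
by apply: eq_bigr => k _; rewrite !mxE /staircase mulrC.
Qed.

Variables (R : comNzRingType) (n : nat).

Definition alternant (mu : 'I_n -> nat) : mpoly.mpoly n R :=
  \det (\matrix_(i < n, j < n) (mpoly.mpolyX R (mpoly.mnm1 i) ^+ mu j)).

(* The bialternant formula det(x_i^(lam_j+n-j)) / det(x_i^(n-j)), the quotient
   being taken in the polynomial ring, so that it may be evaluated at points
   with repeated coordinates; [schur_polyM] shows that the quotient exists. *)
Definition schur_poly (lam : 'I_n -> nat) : mpoly.mpoly n R :=
  xget 0 [set p | p * alternant (@staircase n)
                  = alternant (fun j => (lam j + staircase j)%N)].

Definition schur (lam : 'I_n -> nat) (x : 'I_n -> R) : R :=
  mpoly.meval x (schur_poly lam).

Lemma schur_polyM (lam : 'I_n -> nat) :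
  schur_poly lam * alternant (@staircase n)
  = alternant (fun j => (lam j + staircase j)%N).
Proof.
rewrite /schur_poly; case: xgetP => [p _ //|noP]; exfalso.
have [p pE] := vandermonde_dvd
  (fun i : 'I_n => mpoly.mpolyX R (mpoly.mnm1 i))
  (fun j => (lam j + staircase j)%N).
exact: noP p pE.
Qed.

End Schur.

Section SchurMeasure.
Variable R : realType.

(* Parts are indexed from 0, so the j-th part of the conjugate counts the parts
   of lam exceeding j. *)
Definition conj_part (N K : nat) (lam : 'I_N -> nat) : 'I_K -> nat :=
  fun j => #|[pred i : 'I_N | (j < lam i)%N]|.

(* Rows of weights are 0-indexed: x_(i+1) is [x i], and only i < M is used. *)
Definition schur_measure (N M : nat) (x beta : nat -> R) (lam : 'I_N -> nat)
    : R :=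
  let w j := beta j / (1 - beta j) in
  (\prod_(0 <= i < N) \prod_(N <= j < M) (1 + w j * x i)^-1)
  * schur lam (fun i => x i)
  * schur (conj_part (K := M - N) lam) (fun j => w (N + j)%N).

Definition avg_schur_measure d (T : measurableType d) (P : probability T R)
    (N M : nat) (x beta : nat -> T -> R) (lam : 'I_N -> nat) : R :=
  fine 'E_P[fun t => schur_measure M (x^~ t) (beta^~ t) lam]%E.

(* Expectation of f under the averaged measure, which is carried by the finitely
   many M - N >= lam_1 >= ... >= lam_N >= 0. *)
Definition avg_schur_expectation d (T : measurableType d) (P : probability T R)
    (N M : nat) (x beta : nat -> T -> R) (f : ('I_N -> nat) -> R) : R :=
  \sum_(lam : {ffun 'I_N -> 'I_(M - N).+1} |
        [forall i : 'I_N, forall j : 'I_N, (i <= j)%N ==> (lam j <= lam i)%N])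
    avg_schur_measure P M x beta (fun i => lam i) * f (fun i => lam i).

Definition particle_moment (N k : nat) (lam : 'I_N -> nat) : R :=
  N%:R^-1 * \sum_(i < N) ((lam i + (N - i.+1))%N%:R / N%:R) ^+ k.

End SchurMeasure.

(* R[i] with its numFieldType topology, i.e. the one of the modulus. *)
Definition Cplx (R : realType) : numFieldType := R[i].

Section ComplexAnalysis.
Variable R : realType.

Definition pseries_part (a : nat -> R) (n : nat) (z : Cplx R) : Cplx R :=
  \sum_(0 <= k < n) (a k)%:C * z ^+ k.

Definition pseries_sum (a : nat -> R) (z : Cplx R) : Cplx R :=
  limn (pseries_part a ^~ z).

Definition pseries_unif_cvg_near0 (a : nat -> R) : Prop :=
  exists U : set (Cplx R), nbhs 0 U /\
    exists f : Cplx R -> Cplx R, {uniform U, pseries_part a @ \oo --> f}.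

(* Positively oriented circle |z| = r, parametrized by z = r e^(it). *)
Definition circle_integral (r : R) (f : Cplx R -> Cplx R) : Cplx R :=
  let e (t : R) : Cplx R := r%:C * (cos t +i* sin t) in
  let g (t : R) : R[i] := f (e t) * ('i%C * e t) in
  (\int[lebesgue_measure]_(t in `[0, 2 * pi]) complex.Re (g t))
  +i* (\int[lebesgue_measure]_(t in `[0, 2 * pi]) complex.Im (g t)).

Definition limit_moment (gamma : R) (c g : nat -> R) (r : R) (k : nat)
    : Cplx R :=
  let F1 := pseries_sum c in
  let F2 := pseries_sum g in
  (2 * pi%:C * 'i%C * k.+1%:R)^-1 *
  circle_integral r (fun z =>
    (z - 1)^-1 *
    ((gamma^-1 - 1)%:C * ((1 - z) / z * F2 z - (1 - z) / z)
     + (z - 1) / z * F1 z^-1) ^+ k.+1).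

End ComplexAnalysis.

Section LLN.
Variable R : realType.

Definition power_mean (n k : nat) (u : nat -> R) : R :=
  n%:R^-1 * \sum_(0 <= j < n) u j ^+ k.

Variables (d : nat -> measure_display) (T : forall M, measurableType (d M)).
Variable P : forall M, probability (T M) R.

Definition moment (u : forall M, nat -> T M -> R) (k M : nat) : \bar R :=
  'E_(P M)[fun t => power_mean M k ((u M)^~ t)]%E.

Definition moment_lim (u : forall M, nat -> T M -> R) (k : nat) : R :=
  fine (limn (moment u k)).

(* Expectations live in \bar R, so a finite limit also says that they are
   eventually finite. *)
Definition LLN_appropriate (u v : forall M, nat -> {RV (P M) >-> R}) : Prop :=
  exists a b : nat -> R,
  [/\ forall k, moment u k M @[M --> \oo] --> (a k)%:E,
      forall k, moment v k M @[M --> \oo] --> (b k)%:E,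
      forall (r l : nat) (gam : 'I_r -> R) (eps : 'I_l -> R)
             (k : 'I_r -> nat) (m : 'I_l -> nat),
        (forall i, 0 < gam i <= 1) -> (forall i, 0 < eps i <= 1) ->
        'E_(P M)[fun t =>
           ((\prod_(i < r) power_mean (Num.truncn (gam i * M%:R)) (k i)
                             (fun j => u M j t))
          * (\prod_(i < l) power_mean (Num.truncn (eps i * M%:R)) (m i)
                             (fun j => v M j t)))%R]%E
          @[M --> \oo]
        --> (\prod_(i < r) a (k i) * \prod_(i < l) b (m i))%:E,
      pseries_unif_cvg_near0 a
    & pseries_unif_cvg_near0 b].

End LLN.

(* Main.v *)
Require Import Defs.
From HB Require Import structures.
From mathcomp Require Import all_boot all_order all_algebra all_fingroup.
From mathcomp Require Import complex.
From mathcomp Require Import(canonicals) mpoly.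
From mathcomp Require Import all_classical all_reals all_analysis.
From mathcomp Require Import measurable_realfun.
From mathcomp Require Import ring lra zify.

Set Implicit Arguments.
Unset Strict Implicit.
Unset Printing Implicit Defensive.

Import Order.TTheory GRing.Theory Num.Theory.
Import numFieldNormedType.Exports.

Local Open Scope classical_set_scope.
Local Open Scope ring_scope.
Local Open Scope complex_scope.

(** A draw from the averaged measure is a draw of the weights followed by a
    draw from the Schur measure with these weights.  The proof treats the two
    sources of randomness one after the other: for given weights the particle
    moments concentrate, with an error that is explicit and uniform in the
    weights, and the power means of the weights, which are all that the limit
    sees, converge in L^2.

    Concentration for given weights.  Let l_i = lam_i + N - i be the particles.
    By [dual_cauchy] the Schur probabilities are, up to normalization, the
    terms in the expansion of F(x_1)...F(x_N) det(x_i^(N-j)), where F(x) is the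
    product of the 1 + w_j x, in the alternants det(x_i^(l_j)).  Replacing x_i
    by q x_i and summing over i multiplies an alternant by the sum of the
    q^(l_j), so the expectation of that sum is a sum over i of explicit
    rational factors.  These are the residues at the points 1 - x_i of one
    rational function ([weight_residue]).  With q = 1 + h and a comparison of
    the powers of h, the expectation of the sum of the binomials C(l_i, k)
    becomes the mean over the circle |z| = r of z / (z - 1) e_(k+1)(a(z)),
    where e_m is the elementary symmetric function and a(z) the family of the
    numbers (1 - z) / (1 - z - x_i) and beta_j (1 - z) / (1 - beta_j z).  For
    many bounded numbers m! e_m is close to the m-th power of their sum, and a
    falling factorial is close to a power; hence the k-th moment is close in
    mean to (k+1)^-1 times the mean over the circle of z / (z - 1) times the
    (k+1)-st power of S(z) / N, where S(z) is the sum of the numbers a(z)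
    ([expect_binsum], [EY_limit]).  Two successive tilts x_i -> q x_i give the
    two-point function ([numer_qsum_pair_cmean]).  Its connected part is a
    double contour integral, bounded when h1 and h2 are of order 1/N, and
    Cauchy's estimates make the variance of a moment of order N^-2
    ([expect_cov]).  As the Schur measure is a probability measure, by
    [altdet_mul_staircase_ge0] and [dual_cauchy], second moments control
    products of moments ([product_moment_distinct]).  The residue formulas
    require distinct weights; the final estimate is continuous in the weights
    and therefore holds for all of them ([product_moment_estimate]).

    Convergence of the weights.  As |1 - x_i| < 1 - delta < |z| < 1 on the
    circle, the numbers a(z) expand in geometric series, and S(z) / N is a
    series whose coefficients are the power means of 1 - x_i, i <= N, and of
    beta_j, N < j <= M.  Its distance to the function raised to the power k+1
    in the formula for the limit is bounded by finitely many differences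
    between power means and their limits and a geometric tail
    ([poles_symbol_error]).  Applied to products of one and two factors, the
    law of large numbers gives L^2 convergence of the power means up to index
    floor(gamma M); as the weights are bounded, N may replace this index
    ([array_L1]).  The sum over N < j <= M is a difference of two such sums,
    whence the factor 1/gamma - 1 ([tail_L1]).  Averaging the estimate for
    given weights then gives the theorem. *)

(** * Generalized Vandermonde determinants *)

Section Alternant.

Definition altdet (A : comNzRingType) n (a : 'I_n -> A) (l : 'I_n -> nat) : A :=
  \det (\matrix_(i < n, j < n) a i ^+ l j).

Lemma det_sum_columns (A : comNzRingType) n B (c : 'I_n -> 'I_B -> A)
    (X : 'I_n -> 'I_B -> A) :
  \det (\matrix_(i, j) \sum_a c j a * X i a)
  = \sum_(f : {ffun 'I_n -> 'I_B})
      (\prod_j c j (f j)) * \det (\matrix_(i, j) X i (f j)).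
Proof.
rewrite -det_tr; rewrite /determinant.
under eq_bigr => s _.
  under eq_bigr => i _ do rewrite !mxE.
  rewrite bigA_distr_bigA /= mulr_sumr; over.
rewrite exchange_big /=; apply: eq_bigr => f _.
rewrite -[\sum_(s : 'S_n) _ in RHS]/(\det (\matrix_(i, j) X i (f j))) -det_tr.
rewrite /determinant mulr_sumr; apply: eq_bigr => s _.
rewrite mulrCA; congr (_ * _); rewrite -big_split /=; apply: eq_bigr => i _.
by rewrite !mxE.
Qed.

(** Subtracting suitable multiples of neighbouring columns kills the last row
    but for its last entry. *)
Lemma altdet_last (A : comNzRingType) n (a : 'I_n.+1 -> A) (l : 'I_n.+1 -> nat) :
  (forall i j : 'I_n.+1, (i <= j)%N -> (l j <= l i)%N) ->
  let t := a ord_max in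
  altdet a l = t ^+ l ord_max *
    \det (\matrix_(i < n, j < n)
      (a (widen_ord (leqnSn n) i) ^+ l (widen_ord (leqnSn n) j)
       - t ^+ (l (widen_ord (leqnSn n) j) - l (lift ord0 j))
         * a (widen_ord (leqnSn n) i) ^+ l (lift ord0 j))).
Proof.
move=> lmon t.
pose L : 'M[A]_n.+1 := \matrix_(k, j)
  ((k == j)%:R - (k == j.+1 :> nat)%:R * t ^+ (l j - l k)).
have detL : \det L = 1.
  rewrite det_trig; last first.
    apply/is_trig_mxP => i j ij; rewrite mxE.
    have -> : (i == j) = false by apply/eqP => E; rewrite E ltnn in ij.
    have -> : (i == j.+1 :> nat) = false by apply/eqP; lia.
    by rewrite mul0r subrr.
  apply: big1 => i _; rewrite mxE eqxx.
  by rewrite ltn_eqF // mul0r subr0.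
have AL : forall i (j : 'I_n.+1),
    ((\matrix_(i, j) a i ^+ l j) *m L) i j =
    a i ^+ l j - \sum_(k < n.+1 | k == j.+1 :> nat) t ^+ (l j - l k) * a i ^+ l k.
  move=> i j; rewrite mxE.
  under eq_bigr => k _ do rewrite !mxE mulrBr.
  rewrite sumrB; congr (_ - _).
    by rewrite (bigD1 j) //= eqxx mulr1 big1 ?addr0 // => k /negPf ->; rewrite mulr0.
  rewrite [RHS]big_mkcond; apply: eq_bigr => k _.
  by case: ifP => _; rewrite ?mul0r ?mul1r ?mulr0 // mulrC.
have ALw : forall i (j : 'I_n),
    ((\matrix_(i, j) a i ^+ l j) *m L) i (widen_ord (leqnSn n) j) =
    a i ^+ l (widen_ord (leqnSn n) j)
    - t ^+ (l (widen_ord (leqnSn n) j) - l (lift ord0 j)) * a i ^+ l (lift ord0 j).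
  move=> i j; rewrite AL; congr (_ - _).
  by rewrite (big_pred1 (lift ord0 j)).
rewrite -[LHS]mulr1 -detL -det_mulmx (expand_det_row _ ord_max).
rewrite big_ord_recr /= big1 ?add0r; last first.
  move=> j _; rewrite ALw -/t -exprD subnK ?subrr ?mul0r //.
  by apply: lmon; rewrite /= /bump; lia.
rewrite AL big_pred0 ?subr0; last by move=> k; rewrite /= ltn_eqF.
congr (_ * _).
rewrite /cofactor /= addnn -mul2n exprM sqrrN !expr1n mul1r.
congr determinant; apply/matrixP => i j.
have lw (m : 'I_n) : lift ord_max m = widen_ord (leqnSn n) m.
  by apply/val_inj; rewrite /= /bump; have := ltn_ord m; case: leqP => //; lia.
by rewrite [LHS]mxE [LHS]mxE [RHS]mxE !lw ALw.
Qed.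

Lemma det_row_scale (A : comNzRingType) n (d : 'I_n -> A) (X : 'I_n -> 'I_n -> A) :
  \det (\matrix_(i, j) (d i * X i j)) = (\prod_i d i) * \det (\matrix_(i, j) X i j).
Proof.
rewrite /determinant mulr_sumr; apply: eq_bigr => s _.
rewrite mulrCA; congr (_ * _); rewrite -big_split /=; apply: eq_bigr => i _.
by rewrite !mxE.
Qed.

Lemma det_col_scale (A : comNzRingType) n (d : 'I_n -> A) (X : 'I_n -> 'I_n -> A) :
  \det (\matrix_(i, j) (d j * X i j)) = (\prod_i d i) * \det (\matrix_(i, j) X i j).
Proof.
rewrite -det_tr (_ : _^T = \matrix_(i, j) (d i * X j i)); last first.
  by apply/matrixP => i j; rewrite !mxE.
rewrite det_row_scale -[in RHS]det_tr; congr (_ * \det _).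
by apply/matrixP => i j; rewrite !mxE.
Qed.

Lemma altdet_staircase_last (A : comNzRingType) n (a : 'I_n.+1 -> A) :
  altdet a (@staircase n.+1) =
  (\prod_(i < n) (a (widen_ord (leqnSn n) i) - a ord_max))
  * altdet (fun i => a (widen_ord (leqnSn n) i)) (@staircase n).
Proof.
rewrite altdet_last; last by move=> i j ij; rewrite /staircase; lia.
rewrite {1}/staircase /= subnn expr0 mul1r -det_row_scale; congr determinant.
apply/matrixP => i j; rewrite !mxE /staircase /= /bump /= add1n.
have -> : (n.+1 - j.+1 = (n - j.+1).+1)%N by have := ltn_ord j; lia.
have -> : (n.+1 - j.+2 = n - j.+1)%N by lia.
by rewrite subSnn expr1 exprS mulrBl.
Qed.

Lemma altdet_staircase (A : comNzRingType) n (a : 'I_n -> A) :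
  altdet a (@staircase n) = \prod_(i < n) \prod_(j < n | (i < j)%N) (a i - a j).
Proof.
elim: n a => [|n IH] a; first by rewrite /altdet det_mx00 big_ord0.
rewrite altdet_staircase_last IH big_ord_recr /= [X in _ = _ * X]big_pred0; last first.
  by move=> j; apply/negbTE; rewrite -leqNgt -ltnS.
rewrite mulr1 mulrC -big_split /=; apply: eq_bigr => i _.
by rewrite big_mkcond /= [RHS]big_mkcond /= big_ord_recr /= ltn_ord.
Qed.

(** Takes the difference of the two variables out of the entries left by
    [altdet_last]; what remains is a polynomial in s with coefficients that are
    nonnegative for t > 0. *)
Lemma geometric_interval (A : comNzRingType) (s t : A) p q B :
  (p <= q)%N -> (q <= B)%N ->
  s ^+ q - t ^+ (q - p) * s ^+ p =
  (s - t) * \sum_(b < B) ((p <= b < q)%N%:R * t ^+ (q - b.+1)) * s ^+ b.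
Proof.
move=> /subnK <-; elim: (q - p)%N => [_|m IH mB].
  rewrite add0n subnn mul1r subrr big1 ?mulr0 // => b _.
  have -> : (p <= b < p)%N = false by lia.
  by rewrite !mul0r.
rewrite addSn (_ : _ - _ = (s - t) * s ^+ (m + p)
  + t * (s ^+ (m + p) - t ^+ (m + p - p) * s ^+ p)); last first.
  rewrite subSn ?leq_addl // !addnK !exprS; ring.
rewrite IH ?(ltnW mB) // mulrCA -mulrDr; congr (_ * _).
rewrite mulr_sumr (bigD1 (Ordinal mB)) //= [in RHS](bigD1 (Ordinal mB)) //=.
rewrite ltnn andbF !mul0r mulr0 add0r leq_addl ltnSn subnn !mul1r.
congr (_ + _); apply: eq_bigr => b /eqP bm.
have {}bm : b <> (m + p)%N :> nat by move=> E; apply/bm/val_inj.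
have -> : (p <= b < (m + p).+1)%N = (p <= b < m + p)%N by lia.
have [bq|_] := boolP (p <= b < m + p)%N; last by rewrite !mul0r mulr0.
by rewrite subSn ?exprS; [ring|lia].
Qed.

End Alternant.

Section Positivity.
Variable R : realFieldType.

(** Branching: peeling off the last variable writes a generalized Vandermonde
    determinant as a sum, with nonnegative coefficients, of smaller ones.  The
    second factor removes the sign that depends on the order of the a i. *)
Lemma altdet_mul_staircase_ge0 n (a : 'I_n -> R) (l : 'I_n -> nat) :
  (forall i, 0 < a i) -> (forall i j : 'I_n, (i < j)%N -> (l j < l i)%N) ->
  0 <= altdet a l * altdet a (@staircase n).
Proof.
elim: n a l => [|n IH] a l a0 ldec.
  by rewrite /altdet !det_mx00 mulr1.
set w := widen_ord (leqnSn n); set t := a ord_max.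
have lw (i : 'I_n) : (l (lift ord0 i) < l (w i))%N.
  by apply: ldec; rewrite /= /bump add1n.
rewrite altdet_staircase_last altdet_last; last first.
  move=> i j; rewrite leq_eqVlt => /orP[/eqP/val_inj->//|/ldec/ltnW //].
rewrite -/t -/w; set B := (l ord0).+1.
pose c (j : 'I_n) (b : 'I_B) : R :=
  ((l (lift ord0 j) <= b < l (w j))%N)%:R * t ^+ (l (w j) - b.+1).
have lB (j : 'I_n.+1) : (l j < B)%N.
  rewrite /B ltnS; case: (posnP j) => [j0|jp]; last exact/ltnW/ldec.
  by rewrite (_ : j = ord0) //; apply/val_inj.
have E : \matrix_(i, j) (a (w i) ^+ l (w j)
    - t ^+ (l (w j) - l (lift ord0 j)) * a (w i) ^+ l (lift ord0 j))
  = \matrix_(i, j) ((a (w i) - t) * \sum_b c j b * a (w i) ^+ (val b)).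
  apply/matrixP => i j; rewrite !mxE.
  set p := l (lift ord0 j); have pq := lw j; rewrite -/p in pq.
  set q := l (w j) in pq *.
  by apply: geometric_interval; [exact: ltnW|exact/ltnW/lB].
rewrite E det_row_scale det_sum_columns.
set D := altdet (fun i => a (w i)) _; set P := \prod_i _; set S := \sum_f _.
have -> : t ^+ l ord_max * (P * S) * (P * D) = t ^+ l ord_max * P ^+ 2 * (S * D) by ring.
apply: mulr_ge0; first by rewrite mulr_ge0 ?sqr_ge0 ?exprn_ge0 ?ltW ?a0.
rewrite /S mulr_suml; apply: sumr_ge0 => f _; rewrite -mulrA.
have [cf|] := boolP [forall j, (l (lift ord0 j) <= f j < l (w j))%N]; last first.
  rewrite negb_forall => /existsP[j jn]; rewrite (bigD1 j) //= /c (negPf jn).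
  by rewrite !mul0r.
apply: mulr_ge0.
  by apply: prodr_ge0 => j _; rewrite mulr_ge0 ?ler0n ?exprn_ge0 ?ltW ?a0.
apply: IH => [i|i j ij]; first exact: a0.
have /andP[lei _] := forallP cf i; have /andP[_ gtj] := forallP cf j.
apply: (leq_trans gtj); apply: leq_trans lei.
have : (lift ord0 i <= w j)%N by rewrite /= /bump add1n.
by rewrite leq_eqVlt => /orP[/eqP/val_inj->//|/ldec/ltnW].
Qed.

End Positivity.

(** * The dual Cauchy identity *)

Section DecreasingInjections.

Definition decreasing_ffun n B (f : {ffun 'I_n -> 'I_B}) : bool :=
  [forall i : 'I_n, forall j : 'I_n, (i < j)%N ==> (f j < f i)%N].

Lemma decreasing_ffunP n B (f : {ffun 'I_n -> 'I_B}) :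
  reflect (forall i j : 'I_n, (i < j)%N -> (f j < f i)%N) (decreasing_ffun f).
Proof.
apply: (iffP forallP) => [H i j ij|H i].
  by have /forallP/(_ j)/implyP := H i; apply.
by apply/forallP => j; apply/implyP; exact: H.
Qed.

Variables (n B : nat).
Implicit Types f g : {ffun 'I_n -> 'I_B}.

(** The place of g i when the values of g are sorted in decreasing order. *)
Definition descent_rank g (i : 'I_n) : nat := #|[pred k : 'I_n | (g i < g k)%N]|.

Lemma descent_rank_lt g i : (descent_rank g i < n)%N.
Proof.
rewrite -[X in (_ < X)%N]card_ord -(cardC (pred1 i)) card1 add1n ltnS.
rewrite /descent_rank; apply: subset_leq_card; apply/fintype.subsetP => k; rewrite !inE => lt_ik.
by apply: contraTneq lt_ik => ->; rewrite ltnn.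
Qed.

Definition descent_ord g i : 'I_n := Ordinal (descent_rank_lt g i).

Lemma descent_rankS g i j : (g i < g j)%N -> (descent_rank g j < descent_rank g i)%N.
Proof.
move=> ij; apply: proper_card; apply/properP; split.
  by apply/fintype.subsetP => k; rewrite !inE; exact: ltn_trans.
by exists j; rewrite !inE ?ltnn.
Qed.

Lemma descent_ord_inj g : injective g -> injective (descent_ord g).
Proof.
move=> ginj i j [E]; apply: ginj; apply/val_inj => /=.
by case: (ltngtP (g i) (g j)) => // /descent_rankS; rewrite E ltnn.
Qed.

Lemma descent_ord_comp f (s : 'S_n) : decreasing_ffun f ->
  descent_ord [ffun i => f (s i)] =1 s.
Proof.
move=> /decreasing_ffunP fdec i; apply/val_inj; rewrite /= /descent_rank.
transitivity #|[pred k : 'I_n | (k < s i)%N]|.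
  rewrite -[RHS](fintype.card_image (perm_inj (s := s^-1)%g)); apply: eq_card => k.
  rewrite -[k in RHS](permK s) fintype.mem_image; last exact: perm_inj.
  rewrite !inE !ffunE.
  case: (ltngtP (s k) (s i)) => [/fdec -> //|/fdec|/val_inj ->]; last by rewrite ltnn.
  by move=> /ltnW; rewrite leqNgt => /negbTE.
have sin : (s i <= n)%N by exact: ltnW.
rewrite -[RHS]card_ord -(fintype.card_image (f := widen_ord sin)); last first.
  by move=> a b /(congr1 val) /= E; apply/val_inj.
apply: eq_card => k; rewrite !inE; apply/idP/idP => [ks|/fintype.imageP[m _ ->]]; last exact: (ltn_ord m).
  apply/fintype.imageP.
by exists (Ordinal ks) => //; apply/val_inj.
Qed.

(** Every injection is, in exactly one way, a decreasing map precomposed with a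
    permutation. *)
Lemma sum_injective (A : nmodType) (h : {ffun 'I_n -> 'I_B} -> A) :
  \sum_(g : {ffun 'I_n -> 'I_B} | injectiveb g) h g =
  \sum_(f : {ffun 'I_n -> 'I_B} | decreasing_ffun f) \sum_(s : 'S_n) h [ffun i => f (s i)].
Proof.
rewrite pair_big_dep /=; symmetry.
have inv_inj g : injectiveb g -> injective (descent_ord g).
  by move=> /injectiveP; exact: descent_ord_inj.
pose F g (i : 'I_n) : 'I_n := if injectiveb g then descent_ord g i else i.
have Finj g : injective (F g).
  by rewrite /F; case E: (injectiveb g); [exact: (inv_inj g E)|move=> i j].
pose G g : {ffun 'I_n -> 'I_B} * 'S_n :=
  ([ffun i => g ((perm (Finj g))^-1%g i)], perm (Finj g)).
have FE g : injectiveb g -> perm (Finj g) =1 descent_ord g.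
  by move=> gi i; rewrite permE /F gi.
rewrite (reindex_onto G (fun p => [ffun i => p.1 (p.2 i)])) /=; last first.
  move=> [f s] /= /andP[fdec _].
  have fsi : injectiveb [ffun i => f (s i)].
    apply/injectiveP => i j; rewrite !ffunE => E; apply: (perm_inj (s := s)).
    have /decreasing_ffunP fd := fdec.
    by apply/val_inj; case: (ltngtP (s i) (s j)) => // /fd; rewrite E ltnn.
  have E : perm (Finj [ffun i => f (s i)]) = s.
    by apply/permP => i; rewrite FE // descent_ord_comp.
  rewrite /G E; congr (_, _); apply/ffunP => i.
  by rewrite !ffunE permKV.
have GE g : [ffun i => (G g).1 ((G g).2 i)] = g.
  by apply/ffunP => i; rewrite !ffunE permK.
apply: eq_big => [g|g _]; last by rewrite GE.
rewrite GE eqxx andbT; apply/idP/idP => [|gi].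
  move=> /andP[/decreasing_ffunP fd _]; apply/injectiveP => i j E.
  rewrite -[ i ](permK (perm (Finj g))) -[j](permK (perm (Finj g))).
  congr (fun_of_perm _ _); set a := perm _ i; set b := perm _ j.
  have Eab : (G g).1 a = (G g).1 b by rewrite /= !ffunE !permK.
  by apply/val_inj; case: (ltngtP a b) => // /fd; rewrite Eab ltnn.
rewrite andbT; apply/decreasing_ffunP => i j ij; rewrite !ffunE.
set a := _ i; set b := _ j.
have Ea : descent_ord g a = i by rewrite -FE // permKV.
have Eb : descent_ord g b = j by rewrite -FE // permKV.
have := ij; rewrite -Ea -Eb /=.
case: (ltngtP (g b) (g a)) => // [/descent_rankS|]; first lia.
by move=> /val_inj/(injectiveP _ gi) ->; rewrite ltnn.
Qed.

End DecreasingInjections.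

Section DualCauchy.
Variables (N K : nat).
Local Notation part := {ffun 'I_N -> 'I_K.+1}.
Local Notation nparts lam := (fun i : 'I_N => nat_of_ord (fun_of_fin lam i)).
Implicit Types lam : part.

Definition is_part lam : bool :=
  [forall i : 'I_N, forall j : 'I_N, (i <= j)%N ==> (lam j <= lam i)%N].

Lemma is_partP lam :
  reflect (forall i j : 'I_N, (i <= j)%N -> (lam j <= lam i)%N) (is_part lam).
Proof.
apply: (iffP forallP) => [H i j ij|H i].
  by have /forallP/(_ j)/implyP := H i; apply.
by apply/forallP => j; apply/implyP; exact: H.
Qed.

Definition particle (lam : 'I_N -> nat) (i : 'I_N) : nat := (lam i + staircase i)%N.

Lemma particle_lt lam i : (particle (nparts lam) i < N + K)%N.
Proof. by rewrite /particle /staircase; have := ltn_ord (lam i); have := ltn_ord i; lia. Qed.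

Definition particle_ord lam i : 'I_(N + K) := Ordinal (particle_lt lam i).

Lemma particle_dec lam : is_part lam ->
  forall i j : 'I_N, (i < j)%N -> (particle (nparts lam) j < particle (nparts lam) i)%N.
Proof.
move=> /is_partP lamP i j ij; have := lamP i j (ltnW ij).
by rewrite /particle /staircase; have := ltn_ord j; lia.
Qed.

Lemma conj_part_leN (lam : 'I_N -> nat) (j : 'I_K) : (conj_part lam j <= N)%N.
Proof. by rewrite -[X in (_ <= X)%N]card_ord max_card. Qed.

(** The two counts of the boxes of a Young diagram, by rows and by columns. *)
Lemma conj_partP lam (i : 'I_N) (j : 'I_K) : is_part lam ->
  (i < conj_part (nparts lam) j)%N = (j < lam i)%N.
Proof.
move=> /is_partP lamP; apply/idP/idP => [|ji].
  apply: contraTT; rewrite -!leqNgt => ij.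
  rewrite /conj_part -[X in (_ <= X)%N]card_ord.
  rewrite -(fintype.card_image (f := widen_ord (ltnW (ltn_ord i)))); last first.
    by move=> a b /(congr1 val) /= E; apply/val_inj.
  apply: subset_leq_card; apply/fintype.subsetP => k; rewrite !inE => jk.
  apply/fintype.imageP.
  have ki : (k < i)%N by rewrite ltnNge; apply/negP => /lamP; lia.
  by exists (Ordinal ki) => //; apply/val_inj.
rewrite /conj_part -[X in (X <= _)%N]card_ord.
rewrite -(fintype.card_image (f := widen_ord (ltn_ord i))); last first.
  by move=> a b /(congr1 val) /= E; apply/val_inj.
apply: subset_leq_card; apply/fintype.subsetP => _ /fintype.imageP[k _ ->].
by rewrite inE (leq_trans ji) // lamP //= -ltnS.
Qed.

(** The positions in [0, N + K) that carry no particle, in increasing order: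
    each box of the diagram in a column j moves the j-th hole one step down. *)
Definition hole (lam : 'I_N -> nat) (j : 'I_K) : nat := (N + j - conj_part lam j)%N.

Lemma hole_lt lam j : (hole (nparts lam) j < N + K)%N.
Proof. by rewrite /hole; have := ltn_ord j; lia. Qed.

Definition hole_ord lam j : 'I_(N + K) := Ordinal (hole_lt lam j).

Lemma conj_part_mono (lam : 'I_N -> nat) (j j' : 'I_K) : (j <= j')%N ->
  (conj_part lam j' <= conj_part lam j)%N.
Proof.
move=> jj; apply: subset_leq_card; apply/fintype.subsetP => k; rewrite !inE.
exact: leq_ltn_trans.
Qed.

Lemma hole_inc (lam : 'I_N -> nat) (j j' : 'I_K) : (j < j')%N -> (hole lam j < hole lam j')%N.
Proof.
move=> jj; have := conj_part_mono lam (ltnW jj); rewrite /hole.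
by have := conj_part_leN lam j; lia.
Qed.

Lemma hole_lt_particle lam i j : is_part lam ->
  (hole (nparts lam) j < particle (nparts lam) i)%N = (j < lam i)%N.
Proof.
move=> lamP; rewrite -conj_partP //.
have := conj_partP i j lamP; have := conj_part_leN (nparts lam) j.
by rewrite /hole /particle /staircase; have := ltn_ord i; lia.
Qed.

Lemma particle_lt_hole lam i j : is_part lam ->
  (particle (nparts lam) i < hole (nparts lam) j)%N = ~~ (j < lam i)%N.
Proof.
move=> lamP; rewrite -conj_partP //.
have := conj_partP i j lamP; have := conj_part_leN (nparts lam) j.
by rewrite /hole /particle /staircase; have := ltn_ord i; lia.
Qed.

Definition interlace lam (c : 'I_(N + K)) : 'I_(N + K) :=
  match fintype.split c with inl i => particle_ord lam i | inr j => hole_ord lam j end.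

Lemma interlaceL lam i : interlace lam (lshift K i) = particle_ord lam i.
Proof. by rewrite /interlace (unsplitK (inl i)). Qed.

Lemma interlaceR lam j : interlace lam (rshift N j) = hole_ord lam j.
Proof. by rewrite /interlace (unsplitK (inr j)). Qed.

Lemma interlace_inj lam : is_part lam -> injective (interlace lam).
Proof.
move=> lamP c c'.
have H i j : particle_ord lam i <> hole_ord lam j.
  move=> /(congr1 val) /= E.
  have := hole_lt_particle i j lamP; have := particle_lt_hole i j lamP.
  by rewrite E ltnn; case: (j < lam i)%N.
have Hp i i' : particle_ord lam i = particle_ord lam i' -> i = i'.
  move=> /(congr1 val) /= E; apply/val_inj.
  by case: (ltngtP i i') => // /(particle_dec lamP); rewrite E ltnn.
have Hh j j' : hole_ord lam j = hole_ord lam j' -> j = j'.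
  move=> /(congr1 val) /= E; apply/val_inj.
  by case: (ltngtP j j') => // /(hole_inc (nparts lam)); rewrite E ltnn.
case: (split_ordP c) => i ->; case: (split_ordP c') => i' ->;
  rewrite ?interlaceL ?interlaceR.
- by move=> /Hp ->.
- by move=> /H.
- by move=> /esym/H.
- by move=> /Hh ->.
Qed.

(** Lists the particles and then the holes; its sign relates the minor on the
    hole columns to the full determinant. *)
Definition interlace_perm lam (lamP : is_part lam) : 'S_(N + K) := perm (interlace_inj lamP).

Lemma prod_ordered_pairs_split (A : comNzRingType) (F : 'I_(N + K) -> 'I_(N + K) -> A) :
  \prod_(a < N + K) \prod_(b < N + K | (a < b)%N) F a b =
  (\prod_(i < N) \prod_(j < N | (i < j)%N) F (lshift K i) (lshift K j))
  * (\prod_i \prod_j F (lshift K i) (rshift N j))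
  * (\prod_(i < K) \prod_(j < K | (i < j)%N) F (rshift N i) (rshift N j)).
Proof.
rewrite big_split_ord /= -big_split /=; congr (_ * _); apply: eq_bigr => i _.
  rewrite big_mkcond big_split_ord /= -big_mkcond; congr (_ * _).
  by apply: eq_bigr => j _; rewrite ltn_addr.
rewrite big_mkcond big_split_ord /= -[RHS]mul1r; congr (_ * _).
  by apply: big1 => j _; rewrite ltnNge ltnW // ltn_addr.
by rewrite [RHS]big_mkcond; apply: eq_bigr => j _; rewrite ltn_add2l.
Qed.

(** Compares the signs of the Vandermonde determinants of the points 0, 1, 2
    and so on before and after the permutation. *)
Lemma sign_perm_prod m (s : 'S_m) :
  (-1) ^+ s = \prod_(a < m) \prod_(b < m | (a < b)%N) Num.sg ((s b)%:Z - (s a)%:Z).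
Proof.
pose f : 'rV[int]_m := \row_a (a : nat)%:Z.
pose fs : 'rV[int]_m := \row_a (s a : nat)%:Z.
have E : \det (Vandermonde m fs) = (-1) ^+ s * \det (Vandermonde m f).
  have -> : Vandermonde m fs = col_perm s (Vandermonde m f).
    by apply/matrixP => i j; rewrite !mxE.
  by rewrite col_permE det_mulmx det_perm odd_permV mulrC.
have sgp : forall h : 'I_m -> 'I_m -> int,
    Num.sg (\prod_(a < m) \prod_(b < m | (a < b)%N) h a b)
    = \prod_(a < m) \prod_(b < m | (a < b)%N) Num.sg (h a b).
  move=> h; rewrite (big_morph _ (@sgrM _) (@sgr1 _)); apply: eq_bigr => a _.
  by rewrite (big_morph _ (@sgrM _) (@sgr1 _)).
have := congr1 Num.sg E; rewrite sgrM !det_Vandermonde !sgp => E2.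
transitivity (Num.sg ((-1) ^+ s : int) * \prod_(a < m) \prod_(b < m | (a < b)%N)
   Num.sg (f 0 b - f 0 a)).
  rewrite big1 ?mulr1; last first.
    move=> a _; apply: big1 => b ab; rewrite !mxE gtr0_sg // subr_gt0 ltz_nat //.
  by rewrite sgrX sgrN sgr1.
rewrite -E2; apply: eq_bigr => a _; apply: eq_bigr => b _.
by rewrite !mxE.
Qed.

Variable (A : fieldType).

(** The inversions are the pairs of particles, which are listed in decreasing
    order, and the pairs of a particle and a hole below it; the latter are the
    boxes of the diagram. *)
Lemma sign_interlace lam (lamP : is_part lam) :
  (-1) ^+ interlace_perm lamP =
  (\prod_(i < N) \prod_(j < N | (i < j)%N) (-1))
  * \prod_(j < K) (-1) ^+ conj_part (nparts lam) j :> A.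
Proof.
have -> : (-1) ^+ interlace_perm lamP = ((-1) ^+ interlace_perm lamP : int)%:~R :> A.
  by rewrite rmorphXn /= rmorphN1.
rewrite sign_perm_prod prod_ordered_pairs_split !rmorphM /=.
rewrite [X in _ * X]rmorph_prod [X in _ * X]big1 ?mulr1; last first.
  move=> j _; rewrite rmorph_prod big1 // => j' jj.
  rewrite !permE !interlaceR /= gtr0_sg // subr_gt0 ltz_nat.
  exact: hole_inc.
congr (_ * _).
  rewrite rmorph_prod; apply: eq_bigr => i _; rewrite rmorph_prod; apply: eq_bigr => j ij.
  by rewrite !permE !interlaceL ltr0_sg ?rmorphN1 // subr_lt0 ltz_nat /= particle_dec.
rewrite rmorph_prod; under eq_bigr => i _ do rewrite rmorph_prod.
rewrite exchange_big /=; apply: eq_bigr => j _.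
rewrite /conj_part -sum1_card [RHS](big_morph _ (exprD (-1)) (expr0 _)).
rewrite [RHS]big_mkcond; apply: eq_bigr => i _; rewrite !permE interlaceL interlaceR inE /=.
case: ifP => ji.
  by rewrite ltr0_sg ?rmorphN1 // subr_lt0 ltz_nat hole_lt_particle.
by rewrite gtr0_sg // subr_gt0 ltz_nat particle_lt_hole // ji.
Qed.

Variables (x : 'I_N -> A) (v : 'I_K -> A).

Let vrows : 'M[A]_(K, N + K) := \matrix_(k, c) v k ^+ c.

Let unit_rows (f : {ffun 'I_N -> 'I_(N + K)}) : 'M[A]_(N, N + K) :=
  \matrix_(i, c) (f i == c)%:R.

Let coef (f : {ffun 'I_N -> 'I_(N + K)}) : A := \det (col_mx (unit_rows f) vrows).

Lemma coef_noninj (f : {ffun 'I_N -> 'I_(N + K)}) : ~~ injectiveb f -> coef f = 0.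
Proof.
move=> /injectivePn[i [j ij fij]].
apply: (determinant_alternate (i1 := lshift K i) (i2 := lshift K j)).
  by rewrite (inj_eq (@lshift_inj _ _)).
by move=> c; rewrite !col_mxEu !mxE fij.
Qed.

Lemma coef_perm (f : {ffun 'I_N -> 'I_(N + K)}) (s : 'S_N) : coef [ffun i => f (s i)] = (-1) ^+ s * coef f.
Proof.
rewrite /coef.
have -> : unit_rows [ffun i => f (s i)] = row_perm s (unit_rows f).
  by apply/matrixP => i c; rewrite !mxE ffunE.
have -> : col_mx (row_perm s (unit_rows f)) vrows =
   block_mx (perm_mx s) 0 0 1%:M *m col_mx (unit_rows f) vrows.
  by rewrite mul_block_col !mul0mx addr0 add0r mul1mx row_permE.
by rewrite det_mulmx det_ublock det1 mulr1 det_perm.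
Qed.

Lemma coef_part lam (lamP : is_part lam) :
  coef [ffun i => particle_ord lam i] =
  (-1) ^+ interlace_perm lamP * altdet v (hole (nparts lam)).
Proof.
rewrite /coef; set D := col_mx _ _.
have E : col_perm (interlace_perm lamP) D =
    block_mx 1%:M 0 (\matrix_(k, i) v k ^+ (particle (nparts lam) i))
             (\matrix_(k, j) v k ^+ (hole (nparts lam) j)).
  apply/matrixP => a b; rewrite mxE permE /D.
  case: (split_ordP a) => i ->; case: (split_ordP b) => j ->.
  - rewrite block_mxEul col_mxEu !mxE ffunE -interlaceL.
    by rewrite (inj_eq (interlace_inj lamP)) (inj_eq (@lshift_inj _ _)).
  - rewrite block_mxEur col_mxEu !mxE ffunE -interlaceL.
    by rewrite (inj_eq (interlace_inj lamP)) eq_lrshift.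
  - by rewrite block_mxEdl col_mxEd !mxE interlaceL.
  - by rewrite block_mxEdr col_mxEd !mxE interlaceR.
have := congr1 determinant E.
rewrite det_lblock det1 mul1r col_permE det_mulmx det_perm odd_permV => {}E.
by rewrite /altdet -E mulrCA -expr2 -signr_odd sqrr_sign mulr1.
Qed.

(** Multilinearity in the first N rows only. *)
Lemma det_rows_expand :
  \det (col_mx (\matrix_(i, c) x i ^+ c) vrows) =
  \sum_(f : {ffun 'I_N -> 'I_(N + K)}) (\prod_i x i ^+ f i) * coef f.
Proof.
have split_prod (U : 'M[A]_(N, N + K)) (s : 'S_(N + K)) :
    \prod_a col_mx U vrows a (s a) =
    (\prod_i U i (s (lshift K i))) * \prod_k v k ^+ s (rshift N k).
  rewrite big_split_ord /=; congr (_ * _); apply: eq_bigr => i _.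
    by rewrite col_mxEu.
  by rewrite col_mxEd mxE.
rewrite /coef /determinant.
under [RHS]eq_bigr => f _ do rewrite mulr_sumr.
rewrite exchange_big /=; apply: eq_bigr => s _.
under [RHS]eq_bigr => f _ do rewrite split_prod mulrCA.
rewrite -mulr_sumr split_prod; congr (_ * _).
under [RHS]eq_bigr => f _ do rewrite mulrA.
rewrite -mulr_suml; congr (_ * _).
rewrite (bigD1 [ffun i => s (lshift K i)]) //= [X in _ + X]big1 ?addr0; last first.
  move=> f /eqP fs; suff [i fi] : exists i, f i != s (lshift K i).
    by rewrite [X in _ * X](bigD1 i) //= mxE (negPf fi) mul0r mulr0.
  apply/existsP; apply: contra_notT fs; rewrite negb_exists => /forallP fs.
  by apply/ffunP => i; rewrite ffunE; apply/eqP; have := fs i; rewrite negbK.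
rewrite [X in _ = _ * X]big1 ?mulr1; last by move=> i _; rewrite !mxE ffunE eqxx.
by apply: eq_bigr => i _; rewrite mxE ffunE.
Qed.

Lemma decreasing_is_part lam :
  decreasing_ffun [ffun i => particle_ord lam i] -> is_part lam.
Proof.
move=> /decreasing_ffunP fdec.
apply/is_partP => i j; rewrite leq_eqVlt => /orP[/eqP/val_inj -> //|ij].
have {ij} [m mE] : exists m, (j = i + m :> nat)%N by exists (j - i)%N; lia.
elim: m i mE => [|m IH] i mE.
  by rewrite (_ : j = i) //; apply/val_inj; rewrite /= mE addn0.
have iN : (i.+1 < N)%N by have := ltn_ord j; lia.
have := fdec i (Ordinal iN) (ltnSn i); have := IH (Ordinal iN).
by rewrite !ffunE /= /particle /staircase /=; lia.
Qed.

(** Injective column choices are permuted particle configurations, so the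
    expansion regroups into alternants. *)
Lemma det_rows_parts :
  \det (col_mx (\matrix_(i, c) x i ^+ c) vrows) =
  \sum_(lam : part | is_part lam)
     coef [ffun i => particle_ord lam i] * altdet x (particle (nparts lam)).
Proof.
rewrite det_rows_expand (bigID (fun f : {ffun 'I_N -> 'I_(N + K)} => injectiveb f)) /= [X in _ + X]big1 ?addr0; last first.
  by move=> f /coef_noninj ->; rewrite mulr0.
rewrite (sum_injective (fun f : {ffun 'I_N -> 'I_(N + K)} => (\prod_i x i ^+ f i) * coef f)).
pose low (f : {ffun 'I_N -> 'I_(N + K)}) : part :=
  [ffun i => inord (f i - staircase i)].
rewrite (reindex_onto (fun lam : part => [ffun i => particle_ord lam i]) low) /=; last first.
  move=> f /decreasing_ffunP fdec; apply/ffunP => i; apply/val_inj.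
  have lowf (j : 'I_N) : (staircase j <= f j)%N.
    have [m jm] := ubnP (N - j)%N; elim: m j jm => // m IH j jm.
    have [jN|] := ltnP j.+1 N; last by rewrite /staircase; lia.
    have /= := fdec j (Ordinal jN) (ltnSn j); have /= := IH (Ordinal jN).
    by rewrite /staircase /=; lia.
  have upf (j : 'I_N) : (f j + j < N + K)%N.
    case: j => j /=; elim: j => [|j IH] jN; first by rewrite addn0.
    have /= := fdec (Ordinal (ltnW jN)) (Ordinal jN) (ltnSn j).
    have := IH (ltnW jN); lia.
  rewrite !ffunE /= /particle ffunE inordK ?subnK //.
  by have := upf i; have := lowf i; rewrite /staircase; have := ltn_ord i; lia.
apply: eq_big => [lam|lam lamP].
  apply/idP/idP => [/andP[/decreasing_is_part //]|lamP].
  apply/andP; split.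
    by apply/decreasing_ffunP => i j ij; rewrite !ffunE /= particle_dec.
  apply/eqP/ffunP => i; apply/val_inj; rewrite !ffunE /= /particle addnK inordK //.
under eq_bigr => s _ do rewrite coef_perm mulrCA mulrA.
have {}lamP : is_part lam.
  by have /andP[/decreasing_is_part] := lamP.
rewrite -mulr_suml mulrC; congr (_ * _); rewrite /altdet /determinant.
apply: eq_bigr => s _; congr (_ * _); apply: eq_bigr => i _.
by rewrite !mxE !ffunE.
Qed.

Lemma det_rows_hole_expand :
  \det (col_mx (\matrix_(i, c) x i ^+ c) vrows) =
  (\prod_(i < N) \prod_(j < N | (i < j)%N) (-1)) *
  \sum_(lam : part | is_part lam)
     (\prod_(j < K) (-1) ^+ conj_part (nparts lam) j)
     * altdet v (hole (nparts lam)) * altdet x (particle (nparts lam)).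
Proof.
rewrite det_rows_parts mulr_sumr; apply: eq_bigr => lam lamP.
by rewrite coef_part sign_interlace !mulrA.
Qed.

Lemma det_rows_Vandermonde :
  \det (col_mx (\matrix_(i, c) x i ^+ c) vrows) =
  (\prod_(i < N) \prod_(j < N | (i < j)%N) (-1)) * altdet x (@staircase N)
  * (\prod_(i < N) \prod_(k < K) (v k - x i)) * altdet v (fun j => val j).
Proof.
pose t : 'rV[A]_(N + K) := row_mx (\row_i x i) (\row_k v k).
have tl i : t 0 (lshift K i) = x i by rewrite row_mxEl mxE.
have tr k : t 0 (rshift N k) = v k by rewrite row_mxEr mxE.
rewrite -det_tr (_ : _^T = Vandermonde (N + K) t); last first.
  apply/matrixP => c a; rewrite !mxE.
  by case: fintype.split => k; rewrite !mxE.
rewrite det_Vandermonde (prod_ordered_pairs_split (fun a b => t 0 b - t 0 a)).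
congr (_ * _ * _).
- rewrite altdet_staircase -big_split /=; apply: eq_bigr => i _.
  rewrite -big_split /=; apply: eq_bigr => j _.
  by rewrite !tl mulN1r opprB.
- by apply: eq_bigr => i _; apply: eq_bigr => k _; rewrite tl tr.
- rewrite /altdet -det_tr (_ : _^T = Vandermonde K (\row_k v k)).
    rewrite det_Vandermonde; apply: eq_bigr => i _; apply: eq_bigr => j _.
    by rewrite !tr !mxE.
  by apply/matrixP => i j; rewrite !mxE.
Qed.

End DualCauchy.

(** The Vandermonde determinant of the N + K points x_i and -1/w_k, expanded
    along its first N rows: a choice of N columns is a partition in the N x K
    box, and the complementary columns encode the conjugate partition. *)
Theorem dual_cauchy (A : fieldType) (N K : nat) (x : 'I_N -> A) (w : 'I_K -> A) :
  (forall k, w k != 0) ->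
  \sum_(lam : {ffun 'I_N -> 'I_K.+1} | is_part lam)
     altdet w (fun j => (conj_part (fun i => lam i) j + staircase j)%N)
     * altdet x (particle (fun i => lam i))
  = altdet w (@staircase K) * altdet x (@staircase N)
    * \prod_(i < N) \prod_(k < K) (1 + w k * x i).
Proof.
move=> w0; pose v k := - (w k)^-1.
pose sg : A := \prod_(i < N) \prod_(j < N | (i < j)%N) (-1).
have sg0 : sg != 0.
  by apply/prodf_neq0 => i _; apply/prodf_neq0 => j _; rewrite oppr_eq0 oner_eq0.
pose W : A := \prod_(k < K) (w k) ^+ (N + K).-1.
pose sK : A := \prod_(j < K) (-1) ^+ (N + j).
have sK0 : sK != 0 by apply/prodf_neq0 => k _; rewrite expf_neq0 ?oppr_eq0 ?oner_eq0.
have vdet (h : 'I_K -> nat) : (forall j, (h j <= (N + K).-1)%N) ->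
    W * altdet v h = (\prod_j (-1) ^+ h j) * altdet w (fun j => ((N + K).-1 - h j)%N).
  move=> hle; rewrite /altdet -det_row_scale -det_col_scale; congr determinant.
  apply/matrixP => k j; rewrite !mxE /v (exprNn (w k)^-1) mulrCA; congr (_ * _).
  by rewrite exprVn exprB ?unitfE.
have termE (lam : {ffun 'I_N -> 'I_K.+1}) : is_part lam ->
    W * ((\prod_(j < K) (-1) ^+ conj_part (fun i => lam i) j) * altdet v (hole (fun i => lam i)))
    = sK * altdet w (fun j => (conj_part (fun i => lam i) j + staircase j)%N).
  move=> lamP; rewrite mulrCA vdet; last by move=> j; have := hole_lt lam j; lia.
  rewrite mulrA -big_split /=; congr (_ * _); last first.
    rewrite /altdet; congr determinant; apply/matrixP => k j; rewrite !mxE.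
    congr (_ ^+ _); have := conj_part_leN (fun i => lam i) j.
    by rewrite /hole /staircase; have := ltn_ord j; lia.
  apply: eq_bigr => j _; rewrite -exprD; congr (_ ^+ _).
  by have := conj_part_leN (fun i => lam i) j; rewrite /hole; lia.
have vandE : W * ((\prod_(i < N) \prod_(k < K) (v k - x i)) * altdet v (fun j => val j))
    = sK * (altdet w (@staircase K) * \prod_(i < N) \prod_(k < K) (1 + w k * x i)).
  rewrite mulrCA vdet; last by move=> j; have := ltn_ord j; rewrite /=; lia.
  have -> : altdet w (fun j : 'I_K => ((N + K).-1 - val j)%N)
      = (\prod_(k < K) w k ^+ N) * altdet w (@staircase K).
    rewrite /altdet -det_row_scale; congr determinant; apply/matrixP => k j.
    rewrite !mxE -exprD /staircase; congr (_ ^+ _).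
    by have := ltn_ord j; rewrite /=; lia.
  have -> : sK = (\prod_(i < N) \prod_(k < K) (-1)) * \prod_(j < K) (-1) ^+ val j.
    rewrite exchange_big -big_split /=; apply: eq_bigr => k _.
    by rewrite prodr_const card_ord exprD.
  have E : (\prod_(i < N) \prod_(k < K) (v k - x i)) * (\prod_(k < K) w k ^+ N)
      = (\prod_(i < N) \prod_(k < K) (-1)) * \prod_(i < N) \prod_(k < K) (1 + w k * x i).
    have -> : \prod_(k < K) w k ^+ N = \prod_(i < N) \prod_(k < K) w k.
      rewrite exchange_big; apply: eq_bigr => k _.
      by rewrite prodr_const card_ord.
    rewrite -!big_split /=; apply: eq_bigr => i _; rewrite -!big_split /=.
    apply: eq_bigr => k _; rewrite /v mulrBl mulNr mulVf ?w0 //; ring.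
  by rewrite mulrCA [X in _ * X]mulrA E; ring.
apply: (mulfI sg0); apply: (mulfI sK0).
have := det_rows_hole_expand x v; rewrite det_rows_Vandermonde -/sg => /(congr1 (fun a => W * a)).
rewrite [LHS](_ : _ = sg * altdet x (@staircase N)
   * (W * ((\prod_(i < N) \prod_(k < K) (v k - x i)) * altdet v (fun j => val j)))); last by ring.
rewrite vandE => E.
rewrite [RHS](_ : _ = sg * altdet x (@staircase N) *
   (sK * (altdet w (@staircase K) * \prod_(i < N) \prod_(k < K) (1 + w k * x i)))); last by ring.
rewrite E [LHS]mulrCA [RHS]mulrCA; congr (_ * _).
rewrite !mulr_sumr; apply: eq_bigr => lam lamP.
by rewrite !mulrA -(termE _ lamP) !mulrA.
Qed.

(** Evaluation of the polynomial identity that defines the Schur polynomial; at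
    distinct points it is the bialternant formula. *)
Lemma schurM (A : comNzRingType) n (lam : 'I_n -> nat) (x : 'I_n -> A) :
  schur lam x * altdet x (@staircase n) = altdet x (particle lam).
Proof.
have E mu : mpoly.meval x (alternant A mu) = altdet x mu.
  rewrite /alternant -det_map_mx; congr determinant; apply/matrixP => i j.
  by rewrite !mxE rmorphXn /= mpoly.mevalXU.
by rewrite -[altdet x (particle lam)]E -schur_polyM rmorphM /= E.
Qed.

(** * Integrals over circles in the complex plane *)

Notation normc := (@ComplexField.Normc.normc _).

Section ComplexModulus.
Variable R : realType.
Implicit Types z u v : R[i].

Lemma normc_ge0 z : 0 <= normc z.
Proof. by case: z => a b; exact: sqrtr_ge0. Qed.

Lemma normcD u v : normc (u + v) <= normc u + normc v.
Proof. exact: le_normcD. Qed.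

Lemma normcM u v : normc (u * v) = normc u * normc v.
Proof. exact: ComplexField.Normc.normcM. Qed.

Lemma normcV u : normc u^-1 = (normc u)^-1.
Proof. exact: ComplexField.Normc.normcV. Qed.

Lemma normc_distC u v : normc (u - v) = normc (v - u).
Proof. by rewrite -normcN opprB. Qed.

Lemma normc_sub_le u v : normc (u - v) <= normc u + normc v.
Proof. by rewrite -[normc v]normcN; exact: normcD. Qed.

Lemma normcX u n : normc (u ^+ n) = normc u ^+ n.
Proof.
elim: n => [|n IH]; first by rewrite !expr0 ComplexField.Normc.normc1.
by rewrite !exprS normcM IH.
Qed.

Lemma normcR (a : R) : normc a%:C = `|a|.
Proof. by rewrite /= expr0n addr0 sqrtr_sqr. Qed.

Lemma normc_eq0 u : (normc u == 0) = (u == 0).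
Proof.
apply/eqP/eqP => [/ComplexField.Normc.eq0_normc //|->].
by rewrite -[0]/(0%:C) normcR normr0.
Qed.

Lemma normc_gt0 u : (0 < normc u) = (u != 0).
Proof. by rewrite lt_def normc_ge0 andbT normc_eq0. Qed.

Lemma normc_ge_sub u v : normc u - normc v <= normc (u - v).
Proof. by rewrite lerBlDr -{1}[u](subrK v) normcD. Qed.

Lemma normc_ge_subD u v : normc u - normc v <= normc (u + v).
Proof. by rewrite -[v]opprK normcN; exact: normc_ge_sub. Qed.

Lemma normc1 : normc (1 : R[i]) = 1.
Proof. exact: ComplexField.Normc.normc1. Qed.

Lemma normc0 : normc (0 : R[i]) = 0.
Proof. exact: ComplexField.Normc.normc0. Qed.

Lemma normc_sum (I : Type) (s : seq I) (P : pred I) (F : I -> R[i]) :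
  normc (\sum_(i <- s | P i) F i) <= \sum_(i <- s | P i) normc (F i).
Proof.
elim/big_rec2: _ => [|i a b _ ab]; first by rewrite -[0]/(0%:C) normcR normr0.
by apply: le_trans (normcD _ _) _; rewrite lerD2l.
Qed.

Lemma normc_prod (I : Type) (s : seq I) (P : pred I) (F : I -> R[i]) :
  normc (\prod_(i <- s | P i) F i) = \prod_(i <- s | P i) normc (F i).
Proof. exact: (big_morph _ normcM (ComplexField.Normc.normc1 R)). Qed.

Lemma Re_le_normc z : `|complex.Re z| <= normc z.
Proof.
by case: z => a b /=; rewrite -sqrtr_sqr ler_sqrt ?addr_ge0 ?sqr_ge0 // lerDl sqr_ge0.
Qed.

Lemma Im_le_normc z : `|complex.Im z| <= normc z.
Proof.
by case: z => a b /=; rewrite -sqrtr_sqr ler_sqrt ?addr_ge0 ?sqr_ge0 // lerDr sqr_ge0.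
Qed.

Lemma normc_le_Re_Im z : normc z <= `|complex.Re z| + `|complex.Im z|.
Proof.
rewrite {1}[z]complexE; apply: le_trans (normcD _ _) _; rewrite normcM !normcR.
by rewrite /= expr0n expr1n add0r sqrtr1 mul1r.
Qed.

End ComplexModulus.

Section CircleMean.
Variable R : realType.
Local Notation C := R[i].
Local Notation mu := (@lebesgue_measure R).
Local Notation circ := (`[0, 2 * pi]%classic : set R).
Implicit Types f g h : R -> C.

Lemma rcontD (F G : R -> R) : continuous F -> continuous G ->
  continuous (fun t => F t + G t).
Proof. by move=> cF cG t; apply: cvgD; [exact: cF|exact: cG]. Qed.

Lemma rcontB (F G : R -> R) : continuous F -> continuous G ->
  continuous (fun t => F t - G t).
Proof. by move=> cF cG t; apply: cvgB; [exact: cF|exact: cG]. Qed.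

Lemma rcontM (F G : R -> R) : continuous F -> continuous G ->
  continuous (fun t => F t * G t).
Proof. by move=> cF cG t; apply: cvgM; [exact: cF|exact: cG]. Qed.

Lemma rcontN (F : R -> R) : continuous F -> continuous (fun t => - F t).
Proof. by move=> cF t; apply: cvgN; exact: cF. Qed.

Lemma rcontV (F : R -> R) : (forall t, F t != 0) -> continuous F ->
  continuous (fun t => (F t)^-1).
Proof. by move=> F0 cF t; apply: cvgV; [exact: F0|exact: cF]. Qed.

(** Continuity is required of both components because [cint] integrates them
    separately. *)
Definition ccont h : Prop :=
  continuous (fun t : R => complex.Re (h t)) /\ continuous (fun t : R => complex.Im (h t)).

Lemma ccont_cst (c : C) : ccont (fun=> c).
Proof. by split => t; exact: cst_continuous. Qed.

Lemma ccontD f g : ccont f -> ccont g -> ccont (fun t => f t + g t).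
Proof.
move=> [fr fi] [gr gi]; split.
  rewrite (_ : (fun _ => _) = (fun t => complex.Re (f t) + complex.Re (g t))).
    exact: rcontD.
  by apply/funext => u; case: (f u) => ? ?; case: (g u).
rewrite (_ : (fun _ => _) = (fun t => complex.Im (f t) + complex.Im (g t))).
  exact: rcontD.
by apply/funext => u; case: (f u) => ? ?; case: (g u).
Qed.

Lemma ccontM f g : ccont f -> ccont g -> ccont (fun t => f t * g t).
Proof.
move=> [fr fi] [gr gi]; split.
  rewrite (_ : (fun _ => _) = (fun t => complex.Re (f t) * complex.Re (g t)
      - complex.Im (f t) * complex.Im (g t))).
    by apply: rcontB; exact: rcontM.
  by apply/funext => u; case: (f u) => ? ?; case: (g u).
rewrite (_ : (fun _ => _) = (fun t => complex.Re (f t) * complex.Im (g t)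
    + complex.Im (f t) * complex.Re (g t))).
  by apply: rcontD; exact: rcontM.
by apply/funext => u; case: (f u) => ? ?; case: (g u).
Qed.

Lemma ccontN f : ccont f -> ccont (fun t => - f t).
Proof.
move=> /(ccontM (ccont_cst (-1))); congr ccont.
by apply/funext => t; rewrite mulN1r.
Qed.

Lemma ccontB f g : ccont f -> ccont g -> ccont (fun t => f t - g t).
Proof. by move=> cf cg; exact/ccontD/ccontN. Qed.

Lemma ccontX f n : ccont f -> ccont (fun t => f t ^+ n).
Proof.
move=> cf; elim: n => [|n IH]; first exact: ccont_cst.
rewrite (_ : (fun _ => _) = (fun t => f t * f t ^+ n)); first exact: ccontM.
by apply/funext => t; rewrite exprS.
Qed.

Lemma ccont_sum (I : Type) (s : seq I) (P : pred I) (F : I -> R -> C) :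
  (forall i, P i -> ccont (F i)) -> ccont (fun t => \sum_(i <- s | P i) F i t).
Proof.
move=> cF; elim: s => [|i s IH].
  by under eq_fun do rewrite big_nil; exact: ccont_cst.
under eq_fun do rewrite big_cons.
by case Pi: (P i) => //; apply: ccontD => //; exact: cF.
Qed.

Lemma ccont_prod (I : Type) (s : seq I) (P : pred I) (F : I -> R -> C) :
  (forall i, P i -> ccont (F i)) -> ccont (fun t => \prod_(i <- s | P i) F i t).
Proof.
move=> cF; elim: s => [|i s IH].
  by under eq_fun do rewrite big_nil; exact: ccont_cst.
under eq_fun do rewrite big_cons.
by case Pi: (P i) => //; apply: ccontM => //; exact: cF.
Qed.

Lemma ccontV f : ccont f -> (forall t, f t != 0) -> ccont (fun t => (f t)^-1).
Proof.
move=> [fr fi] f0.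
pose n t := complex.Re (f t) ^+ 2 + complex.Im (f t) ^+ 2.
have n0 t : n t != 0.
  apply/eqP => /eqP; rewrite /n paddr_eq0 ?sqr_ge0 // !sqrf_eq0 => /andP[/eqP a /eqP b].
  have /eqP := f0 t; apply; rewrite [f t]complexE a b mulr0 addr0 //.
have nc : continuous n.
  rewrite /n; under eq_fun do rewrite !expr2.
  by apply: rcontD; exact: rcontM.
split.
  rewrite (_ : (fun _ => _) = (fun t => complex.Re (f t) * (n t)^-1)); last first.
    by apply/funext => u; rewrite /n; case: (f u).
  by apply: rcontM => //; exact: rcontV.
rewrite (_ : (fun _ => _) = (fun t => - complex.Im (f t) * (n t)^-1)); last first.
  by apply/funext => u; rewrite /n; case: (f u) => a b /=; rewrite mulNr.
by apply: rcontM; [exact: rcontN|exact: rcontV].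
Qed.

Lemma continuous_uniform_limit (F : R -> R) :
  (forall e, 0 < e -> exists2 G : R -> R, continuous G & forall t, `|F t - G t| <= e) ->
  continuous F.
Proof.
move=> H t; apply/cvgrPdist_le => e e0.
have e30 : 0 < e / 3 by rewrite divr_gt0.
have [G Gc FG] := H _ e30.
have /cvgrPdist_le/(_ _ e30) := Gc t.
apply: filterS => s Gs.
rewrite (_ : F t - F s = (F t - G t) + (G t - G s) + (G s - F s)); last by ring.
rewrite (_ : e = e / 3 + e / 3 + e / 3); last by field.
apply: le_trans (ler_normD _ _) _; apply: lerD; last by rewrite distrC.
by apply: le_trans (ler_normD _ _) _; apply: lerD.
Qed.

Lemma ccont_uniform_limit f :
  (forall e, 0 < e -> exists2 g, ccont g & forall t, normc (f t - g t) <= e) ->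
  ccont f.
Proof.
move=> H; split; apply: continuous_uniform_limit => e /H[g [gr gi] fg].
  exists (fun t => complex.Re (g t)) => // t; apply: le_trans (fg t).
  by rewrite -raddfB Re_le_normc.
exists (fun t => complex.Im (g t)) => // t; apply: le_trans (fg t).
by rewrite -raddfB Im_le_normc.
Qed.

Definition cint h : C :=
  (\int[mu]_(t in circ) complex.Re (h t)) +i* (\int[mu]_(t in circ) complex.Im (h t)).

Lemma pi2_gt0 : 0 < 2 * pi :> R.
Proof. by rewrite mulr_gt0 // pi_gt0. Qed.

Lemma measure_circ : fine (mu circ) = 2 * pi.
Proof.
have := @lebesgue_measure_itv R `[0, 2 * pi].
by rewrite /= lte_fin pi2_gt0 oppr0 adde0 => ->.
Qed.

Lemma continuous_integrable_circ (F : R -> R) : continuous F ->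
  mu.-integrable circ (EFin \o F).
Proof.
move=> Fc; apply: continuous_compact_integrable; first exact: segment_compact.
exact: continuous_subspaceT.
Qed.

Lemma ccont_integrable h : ccont h ->
  mu.-integrable circ (EFin \o (fun t => complex.Re (h t))) /\
  mu.-integrable circ (EFin \o (fun t => complex.Im (h t))).
Proof. by move=> [hr hi]; split; exact: continuous_integrable_circ. Qed.

Lemma cintD f g : ccont f -> ccont g -> cint (fun t => f t + g t) = cint f + cint g.
Proof.
move=> /ccont_integrable[fr fi] /ccont_integrable[gr gi]; rewrite /cint.
rewrite [RHS](_ : _ = (\int[mu]_(t in circ) complex.Re (f t)
    + \int[mu]_(t in circ) complex.Re (g t)) +i* (\int[mu]_(t in circ) complex.Im (f t)
    + \int[mu]_(t in circ) complex.Im (g t))) //.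
rewrite -!RintegralD //; congr (_ +i* _); apply: eq_Rintegral => t _;
  by case: (f t) => ? ?; case: (g t).
Qed.

Lemma cintZ (c : C) f : ccont f -> cint (fun t => c * f t) = c * cint f.
Proof.
move=> [cr ci]; have [fr fi] := ccont_integrable (conj cr ci).
case: c => a b; rewrite /cint.
rewrite [RHS](_ : _ = (a * (\int[mu]_(t in circ) complex.Re (f t))
    - b * \int[mu]_(t in circ) complex.Im (f t)) +i*
    (a * (\int[mu]_(t in circ) complex.Im (f t))
    + b * \int[mu]_(t in circ) complex.Re (f t))) //.
have intZ (k : R) F : continuous F -> mu.-integrable circ (EFin \o (fun t => k * F t)).
  move=> Fc; apply: continuous_integrable_circ; apply: rcontM => //.
  by move=> t; exact: cst_continuous.
have mc : measurable circ by exact: measurable_itv.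
rewrite -!RintegralZl // -RintegralB // -?RintegralD //; try exact: intZ.
congr (_ +i* _); apply: eq_Rintegral => t _; by case: (f t).
Qed.

Lemma cint_sum (I : Type) (s : seq I) (P : pred I) (F : I -> R -> C) :
  (forall i, P i -> ccont (F i)) ->
  cint (fun t => \sum_(i <- s | P i) F i t) = \sum_(i <- s | P i) cint (F i).
Proof.
move=> cF; elim: s => [|i s IH].
  rewrite big_nil; under eq_fun do rewrite big_nil.
  have := cintZ 0 (ccont_cst 0); rewrite [RHS]mul0r => E; rewrite -[RHS]E.
  by congr cint; apply/funext => t; rewrite mul0r.
under eq_fun do rewrite big_cons.
rewrite big_cons; case Pi: (P i); last exact: IH.
by rewrite cintD ?IH //; [exact: cF|exact: ccont_sum].
Qed.

Lemma cint_cst (c : C) : cint (fun=> c) = (2 * pi)%:C * c.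
Proof.
rewrite /cint !Rintegral_cst; try exact: measurable_itv.
rewrite measure_circ.
case: c => a b; rewrite [RHS](_ : _ = (2 * pi * a - 0 * b) +i* (2 * pi * b + 0 * a)) //.
by rewrite !mul0r subr0 addr0 /= ![_ * (2 * pi)]mulrC.
Qed.

(** The factor 2 comes from bounding the real and the imaginary part one by
    one; the estimates below are insensitive to constants. *)
Lemma cint_le h (B : R) : ccont h -> (forall t, normc (h t) <= B) ->
  normc (cint h) <= 2 * (2 * pi * B).
Proof.
move=> [hr hi] hB; have [ir ii] := ccont_integrable (conj hr hi).
have mc : measurable circ by exact: measurable_itv.
have bnd (F : R -> R) : continuous F -> (forall t, `|F t| <= B) ->
    `|\int[mu]_(t in circ) F t| <= 2 * pi * B.
  move=> Fc FB.
  have /le_trans -> // : `|\int[mu]_(t in circ) F t| <= \int[mu]_(t in circ) `|F t|.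
    by apply: le_normr_Rintegral; [exact: measurable_itv|exact: continuous_integrable_circ].
  rewrite [leRHS](_ : _ = \int[mu]_(t in circ) B).
    apply: le_Rintegral => //; apply: continuous_integrable_circ => t.
      by apply: continuous_comp; [exact: Fc|exact: norm_continuous].
    exact: cst_continuous.
  rewrite Rintegral_cst //.
  by rewrite measure_circ mulrC.
rewrite mulr2n mulrDl mul1r; apply: le_trans (normc_le_Re_Im _) _.
apply: lerD; apply: bnd => // t; apply: le_trans (hB t).
  exact: Re_le_normc.
exact: Im_le_normc.
Qed.

End CircleMean.

Section CircleMonomials.
Variable R : realType.
Local Notation C := R[i].
Local Notation mu := (@lebesgue_measure R).
Local Notation circ := (`[0, 2 * pi]%classic : set R).

Definition expi (t : R) : C := cos t +i* sin t.

Lemma expiX t n : expi t ^+ n = expi (n%:R * t).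
Proof.
elim: n => [|n IH]; first by rewrite expr0 mul0r /expi cos0 sin0.
rewrite exprS IH /expi -[RHS]/(_ +i* _) -natr1 mulrDl mul1r addrC cosD sinD.
by rewrite -[LHS]/(_ +i* _); congr (_ +i* _); rewrite addrC.
Qed.

Lemma expi_conj t : expi t * (cos t -i* sin t) = 1.
Proof.
rewrite /expi -[LHS]/(_ +i* _) mulrN opprK -!expr2 cos2Dsin2.
by rewrite mulrN [cos t * _]mulrC addNr.
Qed.

Lemma expiV t : (expi t)^-1 = cos t -i* sin t.
Proof.
have e0 : expi t != 0.
  by apply/eqP => e0; have /eqP := expi_conj t; rewrite e0 mul0r eq_sym oner_eq0.
by apply: (mulfI e0); rewrite mulfV // expi_conj.
Qed.

Lemma expi2pi : expi (2 * pi) = 1.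
Proof. by rewrite /expi mulrC mulr_natr cos2pi sin2pi. Qed.

Lemma ccont_expi : ccont expi.
Proof. by split => t; [exact: continuous_cos|exact: continuous_sin]. Qed.

Lemma FTC_circ (F f : R -> R) : continuous f -> (forall t : R, is_derive t 1 F (f t)) ->
  \int[mu]_(t in circ) f t = F (2 * pi) - F 0.
Proof.
move=> fc dF; rewrite /Rintegral (@continuous_FTC2 _ f F) //.
- exact: pi2_gt0.
- exact: continuous_subspaceT.
- have dd t : derivable F t 1 by have [] := dF t.
  have Fc : continuous F.
    by move=> t; apply: differentiable_continuous; apply/derivable1_diffP.
  split; first by move=> t _; exact: dd.
  + by apply: cvg_at_right_filter; exact: Fc.
  + by apply: cvg_at_left_filter; exact: Fc.
- by move=> t _; rewrite derive1E; have [_ ->] := dF t.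
Qed.

Lemma cint_expiX n : (0 < n)%N -> cint (fun t => expi t ^+ n) = 0.
Proof.
move=> n0; have nR : n%:R != 0 :> R by rewrite pnatr_eq0 -lt0n.
have [c1 s1] : cos (n%:R * (2 * pi)) = 1 :> R /\ sin (n%:R * (2 * pi)) = 0 :> R.
  by have := expiX (2 * pi) n; rewrite expi2pi expr1n => -[].
have lin (t : R) : is_derive t 1 (fun t => n%:R * t) n%:R.
  by apply: is_derive_eq; rewrite /GRing.scale /= mulr1.
have dsin (t : R) : is_derive t 1 (fun t => n%:R^-1 * sin (n%:R * t)) (cos (n%:R * t)).
  have H : is_derive t 1 (sin \o (fun t : R => n%:R * t)) (cos (n%:R * t) * n%:R).
    exact: is_derive1_comp.
  have -> : cos (n%:R * t) = n%:R^-1 *: (cos (n%:R * t) * n%:R : R^o).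
    by rewrite -[RHS]/(_ * _) mulrCA mulVf // mulr1.
  exact: is_deriveZ H.
have dcos (t : R) : is_derive t 1 (fun t => - n%:R^-1 * cos (n%:R * t)) (sin (n%:R * t)).
  have H : is_derive t 1 (cos \o (fun t : R => n%:R * t)) (- sin (n%:R * t) * n%:R).
    exact: is_derive1_comp.
  have -> : sin (n%:R * t) = - n%:R^-1 *: (- sin (n%:R * t) * n%:R : R^o).
    by rewrite -[RHS]/(_ * _) !mulNr mulrN opprK mulrCA mulVf // mulr1.
  exact: is_deriveZ H.
have csin : continuous (fun t : R => sin (n%:R * t)).
  by move=> t; apply: continuous_comp; [exact: mulrl_continuous|exact: continuous_sin].
have ccos : continuous (fun t : R => cos (n%:R * t)).
  by move=> t; apply: continuous_comp; [exact: mulrl_continuous|exact: continuous_cos].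
have Is := FTC_circ csin dcos.
have Ic := FTC_circ ccos dsin.
rewrite /cint; under eq_Rintegral do rewrite expiX /=.
under [X in _ +i* X]eq_Rintegral do rewrite expiX /=.
rewrite Is Ic !mulr0 c1 s1 cos0 sin0 !mulr0 !subrr //.
Qed.

Lemma cint_expiVX n : (0 < n)%N -> cint (fun t => expi t ^- n) = 0.
Proof.
move=> n0; have := cint_expiX n0; rewrite /cint => -[Ec Es].
have cc : ccont (fun t => expi t ^+ n) by apply: ccontX; exact: ccont_expi.
have E (t : R) : expi t ^- n = complex.Re (expi t ^+ n) -i* complex.Im (expi t ^+ n).
  by rewrite -exprVn expiV expiX -[_ -i* _]/(expi t)^*%C -rmorphXn /= expiX.
under eq_Rintegral do rewrite E /=.
under [X in _ +i* X]eq_Rintegral do rewrite E /= -mulN1r.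
rewrite Ec RintegralZl ?Es ?mulr0 //.
by case: (ccont_integrable cc).
Qed.

End CircleMonomials.

Section CircleFunctional.
Variables (R : realType) (r : R).
Hypothesis r0 : 0 < r.
Local Notation C := R[i].
Implicit Types (f g : C -> C) (z : C).

Definition cpt (s t : R) : C := s%:C * expi t.

Definition ccirc f : Prop := ccont (fun t => f (cpt r t)).

(** This is (2 pi i)^-1 times the contour integral of f z / z dz over |z| = r. *)
Definition cmean f : C := ((2 * pi)%:C)^-1 * cint (fun t => f (cpt r t)).

Lemma normc_cpt t : normc (cpt r t) = r.
Proof.
rewrite /cpt normcM normcR gtr0_norm // [X in _ * X](_ : _ = 1) ?mulr1 //.
by rewrite /expi /= cos2Dsin2 sqrtr1.
Qed.

Lemma circ_neq0 z : normc z = r -> z != 0.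
Proof. by move=> zr; rewrite -normc_gt0 zr. Qed.

Lemma pi2C_neq0 : ((2 * pi)%:C : C) != 0.
Proof. by rewrite -normc_gt0 normcR normr_gt0 gt_eqF // pi2_gt0. Qed.

Lemma eq_ccirc f g : (forall z, normc z = r -> f z = g z) -> ccirc f -> ccirc g.
Proof.
move=> fg; rewrite /ccirc; congr ccont; apply/funext => t.
by apply: fg; rewrite normc_cpt.
Qed.

Lemma eq_cmean f g : (forall z, normc z = r -> f z = g z) -> cmean f = cmean g.
Proof.
move=> fg; rewrite /cmean; congr (_ * cint _); apply/funext => t.
by apply: fg; rewrite normc_cpt.
Qed.

Lemma ccirc_cst (c : C) : ccirc (fun=> c).
Proof. exact: ccont_cst. Qed.

Lemma ccirc_id : ccirc id.
Proof. by apply: ccontM; [exact: ccont_cst|exact: ccont_expi]. Qed.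

Lemma ccircD f g : ccirc f -> ccirc g -> ccirc (fun z => f z + g z).
Proof. exact: ccontD. Qed.

Lemma ccircM f g : ccirc f -> ccirc g -> ccirc (fun z => f z * g z).
Proof. exact: ccontM. Qed.

Lemma ccircN f : ccirc f -> ccirc (fun z => - f z).
Proof. exact: ccontN. Qed.

Lemma ccircB f g : ccirc f -> ccirc g -> ccirc (fun z => f z - g z).
Proof. exact: ccontB. Qed.

Lemma ccircX f n : ccirc f -> ccirc (fun z => f z ^+ n).
Proof. exact: ccontX. Qed.

Lemma ccirc_sum (I : Type) (s : seq I) (P : pred I) (F : I -> C -> C) :
  (forall i, P i -> ccirc (F i)) -> ccirc (fun z => \sum_(i <- s | P i) F i z).
Proof. exact: ccont_sum. Qed.

Lemma ccirc_prod (I : Type) (s : seq I) (P : pred I) (F : I -> C -> C) :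
  (forall i, P i -> ccirc (F i)) -> ccirc (fun z => \prod_(i <- s | P i) F i z).
Proof. exact: ccont_prod. Qed.

Lemma ccircV f : (forall z, normc z = r -> f z != 0) -> ccirc f ->
  ccirc (fun z => (f z)^-1).
Proof. by move=> f0 cf; apply: ccontV => // t; apply: f0; rewrite normc_cpt. Qed.

Lemma ccirc_horner (p : {poly C}) : ccirc (horner p).
Proof.
apply: (@eq_ccirc (fun z => \sum_(i < size p) p`_i * z ^+ i)).
  by move=> z _; rewrite horner_coef.
apply: ccirc_sum => i _; apply: ccircM; first exact: ccirc_cst.
by apply: ccircX; exact: ccirc_id.
Qed.

Lemma ccirc_uniform_limit f :
  (forall e, 0 < e -> exists2 g, ccirc g &
     forall z, normc z = r -> normc (f z - g z) <= e) -> ccirc f.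
Proof.
move=> H; apply: ccont_uniform_limit => e /H[g cg fg].
by exists (fun t => g (cpt r t)) => // t; apply: fg; rewrite normc_cpt.
Qed.

Lemma cmeanD f g : ccirc f -> ccirc g -> cmean (fun z => f z + g z) = cmean f + cmean g.
Proof. by move=> cf cg; rewrite /cmean cintD // mulrDr. Qed.

Lemma cmeanZ (c : C) f : ccirc f -> cmean (fun z => c * f z) = c * cmean f.
Proof. by move=> cf; rewrite /cmean cintZ // mulrCA. Qed.

Lemma cmeanN f : ccirc f -> cmean (fun z => - f z) = - cmean f.
Proof.
move=> cf; rewrite -[RHS]mulN1r -cmeanZ //.
by apply: eq_cmean => z _; rewrite mulN1r.
Qed.

Lemma cmeanB f g : ccirc f -> ccirc g -> cmean (fun z => f z - g z) = cmean f - cmean g.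
Proof. by move=> cf cg; rewrite cmeanD ?cmeanN //; exact: ccircN. Qed.

Lemma cmean_sum (I : Type) (s : seq I) (P : pred I) (F : I -> C -> C) :
  (forall i, P i -> ccirc (F i)) ->
  cmean (fun z => \sum_(i <- s | P i) F i z) = \sum_(i <- s | P i) cmean (F i).
Proof. by move=> cF; rewrite /cmean cint_sum // mulr_sumr. Qed.

Lemma cmean_cst (c : C) : cmean (fun=> c) = c.
Proof. by rewrite /cmean cint_cst mulKf // pi2C_neq0. Qed.

Lemma cmean_le f (B : R) : ccirc f -> (forall z, normc z = r -> normc (f z) <= B) ->
  normc (cmean f) <= 2 * B.
Proof.
move=> cf fB; rewrite /cmean normcM normcV normcR gtr0_norm ?pi2_gt0 //.
rewrite ler_pdivrMl ?pi2_gt0 // [leRHS](_ : _ = 2 * (2 * pi * B)); last by ring.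
by apply: cint_le => // t; apply: fB; rewrite normc_cpt.
Qed.

Lemma cmeanX n : (0 < n)%N -> cmean (fun z => z ^+ n) = 0.
Proof.
move=> n0; rewrite /cmean; under eq_fun do rewrite /cpt exprMn.
by rewrite cintZ ?cint_expiX ?mulr0 //; apply: ccontX; exact: ccont_expi.
Qed.

Lemma expi_neq0 t : expi t != 0 :> C.
Proof. by have := circ_neq0 (normc_cpt t); rewrite /cpt mulf_eq0 negb_or => /andP[]. Qed.

Lemma cmeanVX n : (0 < n)%N -> cmean (fun z => z ^- n) = 0.
Proof.
move=> n0; rewrite /cmean; under eq_fun do rewrite /cpt exprMn invfM.
rewrite cintZ ?cint_expiVX ?mulr0 //; apply: ccontV => [|t].
  by apply: ccontX; exact: ccont_expi.
by rewrite expf_neq0 // expi_neq0.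
Qed.

Lemma cmean_mul_horner (p : {poly C}) : cmean (fun z => z * p.[z]) = 0.
Proof.
rewrite (@eq_cmean _ (fun z => \sum_(i < size p) p`_i * z ^+ i.+1)); last first.
  move=> z _; rewrite horner_coef mulr_sumr; apply: eq_bigr => i _.
  by rewrite exprS mulrCA.
rewrite cmean_sum => [|i _].
  apply: big1 => i _; rewrite cmeanZ ?cmeanX ?mulr0 //.
  by apply: ccircX; exact: ccirc_id.
by apply: ccircM; [exact: ccirc_cst|apply: ccircX; exact: ccirc_id].
Qed.

Lemma circ_sub_neq0 (y z : C) : normc y < r -> normc z = r -> z - y != 0.
Proof.
move=> yr zr; rewrite -normc_gt0; apply: lt_le_trans (normc_ge_sub _ _).
by rewrite zr subr_gt0.
Qed.

Lemma ccirc_cauchy y : normc y < r -> ccirc (fun z => z / (z - y)).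
Proof.
move=> yr; apply: ccircM; first exact: ccirc_id.
apply: ccircV; first by move=> z; exact: circ_sub_neq0.
by apply: ccircB; [exact: ccirc_id|exact: ccirc_cst].
Qed.

Lemma geometric_le0 (a B q : R) : 0 <= q < 1 -> (forall n : nat, a <= B * q ^+ n) -> a <= 0.
Proof.
move=> /andP[q0 q1] H; rewrite leNgt; apply/negP => a0.
have B0 : 0 < B by have := H 0%N; rewrite expr0 mulr1; exact: lt_le_trans.
have : B * q ^+ n @[n --> \oo] --> B * 0.
  by apply: cvgMr; apply: cvg_expr; rewrite ger0_norm.
rewrite mulr0 => /cvgrPdist_lt/(_ _ a0)[n _ /(_ n (leqnn n))] /=.
rewrite sub0r normrN ger0_norm ?mulr_ge0 ?exprn_ge0 // 1?ltW //.
by move=> /(le_lt_trans (H n)); rewrite ltxx.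
Qed.

(** In the expansion of z / (z - y) in powers of y / z only the constant term
    has a nonzero mean, and the remainder decays geometrically. *)
Lemma cmean_cauchy_kernel y : normc y < r -> cmean (fun z => z / (z - y)) = 1.
Proof.
move=> yr; have rn : r != 0 by rewrite gt_eqF.
apply/eqP; rewrite -subr_eq0 -normc_eq0 eq_le normc_ge0 andbT.
have q01 : 0 <= normc y / r < 1.
  by rewrite divr_ge0 ?normc_ge0 ?ltW //= ltr_pdivrMr // mul1r.
apply: (@geometric_le0 _ (2 * (r / (r - normc y))) _ q01) => n.
have geo m z : normc z = r ->
    z / (z - y) = \sum_(j < m) y ^+ j * z ^- j + (y / z) ^+ m * (z / (z - y)).
  move=> zr; have z0 := circ_neq0 zr; have zy := circ_sub_neq0 yr zr.
  elim: m => [|m IH]; first by rewrite big_ord0 add0r expr0 mul1r.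
  rewrite {1}IH big_ord_recr /= -addrA; congr (_ + _).
  rewrite exprS expr_div_n; move: (y ^+ m) (z ^+ m) (expf_neq0 m z0) => a b b0.
  by field; rewrite b0 z0 zy.
have cV j : ccirc (fun z => y ^+ j * z ^- j).
  apply: ccircM; first exact: ccirc_cst.
  apply: ccircV; first by move=> z /circ_neq0; exact: expf_neq0.
  by apply: ccircX; exact: ccirc_id.
have crem m : ccirc (fun z => (y / z) ^+ m * (z / (z - y))).
  apply: ccircM; last exact: ccirc_cauchy.
  apply: ccircX; apply: ccircM; first exact: ccirc_cst.
  by apply: ccircV; [exact: circ_neq0|exact: ccirc_id].
rewrite (eq_cmean (geo n.+1)) cmeanD //; last exact: ccirc_sum.
rewrite cmean_sum // big_ord_recl /= big1 ?addr0; last first.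
  move=> j _; rewrite cmeanZ ?cmeanVX ?mulr0 // /bump.
  apply: ccircV; first by move=> z /circ_neq0; exact: expf_neq0.
  by apply: ccircX; exact: ccirc_id.
rewrite (@eq_cmean _ (fun=> 1)); last by move=> z _; rewrite !expr0 invr1 mulr1.
rewrite cmean_cst addrC addKr.
apply: le_trans (cmean_le (crem _) (B := (r / (r - normc y)) * (normc y / r) ^+ n) _) _; last first.
  by rewrite mulrA.
move=> z zr; have [q0 q1] := andP q01.
rewrite normcM normcX !normcM !normcV zr mulrC; apply: ler_pM.
- by rewrite mulr_ge0 ?invr_ge0 ?normc_ge0 // ltW.
- exact: exprn_ge0.
- rewrite ler_pM2l // lef_pV2 ?posrE ?subr_gt0 //.
    by rewrite -zr; exact: normc_ge_sub.
  by rewrite normc_gt0 circ_sub_neq0.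
- by rewrite exprS ler_piMl ?exprn_ge0 // ltW.
Qed.

(** These functions play the part of the functions holomorphic on the disc: for
    uniform limits of polynomials on |z| <= r Cauchy's theorem follows from the
    vanishing of the means of z ^+ n, n > 0. *)
Definition holo (phi : C -> C) : Prop :=
  forall e : R, 0 < e -> exists p : {poly C},
    forall z, normc z <= r -> normc (phi z - p.[z]) <= e.

Lemma holo_ccirc phi : holo phi -> ccirc phi.
Proof.
move=> H; apply: ccirc_uniform_limit => e /H[p pe]; exists (horner p); first exact: ccirc_horner.
by move=> z zr; apply: pe; rewrite zr.
Qed.

Lemma le_eps_le0 (a K : R) : (forall e, 0 < e -> a <= K * e) -> a <= 0.
Proof.
move=> H; rewrite leNgt; apply/negP => a0.
have K0 : 0 < K by have := H 1 ltr01; rewrite mulr1; exact: lt_le_trans.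
have := H (a / (2 * K)); rewrite divr_gt0 ?mulr_gt0 // => /(_ isT).
rewrite (_ : K * _ = a / 2); last by field; rewrite gt_eqF.
lra.
Qed.

(** For a polynomial p, p.[z] - p.[y] is divisible by z - y and z times the
    quotient has mean 0; the general case follows by approximation. *)
Lemma cmean_cauchy phi y : holo phi -> normc y < r ->
  cmean (fun z => z / (z - y) * phi z) = phi y.
Proof.
move=> H yr; apply/eqP; rewrite -subr_eq0 -normc_eq0 eq_le normc_ge0 andbT.
have K0 : 0 < r / (r - normc y) by rewrite divr_gt0 // subr_gt0.
apply: (@le_eps_le0 _ (2 * (r / (r - normc y)) + 1)) => e e0.
have [p pe] := H e e0.
have cp := ccirc_horner p; have ck := ccirc_cauchy yr; have cphi := holo_ccirc H.
have mp : cmean (fun z => z / (z - y) * p.[z]) = p.[y].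
  have /factor_theorem[q pq] : root (p - p.[y]%:P) y.
    by rewrite /root hornerD hornerN hornerC subrr.
  have {}pq z : p.[z] = p.[y] + q.[z] * (z - y).
    have := congr1 (horner^~ z) pq; rewrite hornerD hornerN hornerC hornerM hornerXsubC.
    by move=> <-; rewrite addrC subrK.
  rewrite (@eq_cmean _ (fun z => p.[y] * (z / (z - y)) + z * q.[z])); last first.
    move=> z zr; have zy := circ_sub_neq0 yr zr; rewrite pq.
    by field.
  rewrite cmeanD ?cmeanZ ?cmean_cauchy_kernel ?cmean_mul_horner ?mulr1 ?addr0 //.
    by apply: ccircM => //; exact: ccirc_cst.
  by apply: ccircM; [exact: ccirc_id|exact: ccirc_horner].
rewrite (_ : _ - phi y = cmean (fun z => z / (z - y) * (phi z - p.[z]))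
   + (p.[y] - phi y)); last first.
  rewrite (@eq_cmean (fun z => z / (z - y) * (phi z - p.[z]))
    (fun z => z / (z - y) * phi z - z / (z - y) * p.[z])).
    by rewrite cmeanB ?mp; [ring|exact: ccircM|exact: ccircM].
  by move=> z _; rewrite mulrBr.
apply: le_trans (normcD _ _) _; rewrite mulrDl mul1r; apply: lerD; last first.
  by rewrite normc_distC; apply: pe; exact: ltW.
rewrite -mulrA; apply: cmean_le; first by apply: ccircM => //; exact: ccircB.
move=> z zr; rewrite !normcM normcV zr; apply: ler_pM.
- by rewrite mulr_ge0 ?invr_ge0 ?normc_ge0 // ltW.
- exact: normc_ge0.
- rewrite ler_pM2l // lef_pV2 ?posrE ?subr_gt0 ?normc_gt0 ?circ_sub_neq0 //.
  by rewrite -zr; exact: normc_ge_sub.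
- by apply: pe; rewrite zr.
Qed.

Lemma horner_bounded (p : {poly C}) : exists2 B : R, 0 < B &
  forall z, normc z <= r -> normc p.[z] <= B.
Proof.
exists (1 + \sum_(i < size p) normc p`_i * r ^+ i).
  by rewrite ltr_pwDl // sumr_ge0 // => i _; rewrite mulr_ge0 ?normc_ge0 ?exprn_ge0 // ltW.
move=> z zr; rewrite horner_coef; apply: le_trans (normc_sum _ _ _) _.
rewrite ler_wpDl //; apply: ler_sum => i _; rewrite normcM normcX.
by rewrite ler_wpM2l ?normc_ge0 // lerXn2r // nnegrE ?normc_ge0 // ltW.
Qed.

Lemma holo_poly (p : {poly C}) : holo (horner p).
Proof. by move=> e e0; exists p => z _; rewrite subrr -[0]/(0%:C) normcR normr0 ltW. Qed.

Lemma eq_holo f g : (forall z, normc z <= r -> f z = g z) -> holo f -> holo g.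
Proof. by move=> fg H e /H[p pe]; exists p => z zr; rewrite -fg // pe. Qed.

Lemma holo_cst (c : C) : holo (fun=> c).
Proof. by apply: eq_holo (holo_poly c%:P) => z _; rewrite hornerC. Qed.

Lemma holo_affine (a b : C) : holo (fun z => a + b * z).
Proof.
by apply: eq_holo (holo_poly (a%:P + b *: 'X)) => z _; rewrite hornerD hornerC hornerZ hornerX.
Qed.

Lemma holoM f g : holo f -> holo g -> holo (fun z => f z * g z).
Proof.
move=> Hf Hg e e0.
have [p1 p1P] := Hg _ ltr01; have [B B0 p1B] := horner_bounded p1.
have e2 : 0 < e / 2 / (B + 1) by rewrite !divr_gt0 // addr_gt0.
have [p pP] := Hf _ e2; have [A A0 pA] := horner_bounded p.
have e3 : 0 < e / 2 / A by rewrite !divr_gt0.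
have [q qP] := Hg _ e3.
exists (p * q) => z zr; rewrite hornerM.
rewrite (_ : f z * g z - _ = (f z - p.[z]) * g z + p.[z] * (g z - q.[z])); last by ring.
rewrite (_ : e = e / 2 / (B + 1) * (B + 1) + A * (e / 2 / A)); last first.
  by field; rewrite !gt_eqF // addr_gt0.
apply: le_trans (normcD _ _) _; rewrite !normcM; apply: lerD.
  apply: ler_pM; rewrite ?normc_ge0 ?pP //.
  rewrite -[g z](subrK p1.[z]) addrC; apply: le_trans (normcD _ _) _.
  by apply: lerD; [exact: p1B|exact: p1P].
by apply: ler_pM; rewrite ?normc_ge0 ?qP ?pA.
Qed.

Lemma holo_prod (I : Type) (s : seq I) (P : pred I) (F : I -> C -> C) :
  (forall i, P i -> holo (F i)) -> holo (fun z => \prod_(i <- s | P i) F i z).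
Proof.
move=> cF; elim: s => [|i s IH].
  by under eq_fun do rewrite big_nil; exact: holo_cst.
under eq_fun do rewrite big_cons.
by case Pi: (P i) => //; apply: holoM => //; exact: cF.
Qed.

(** The partial sums of the geometric series in b z / a are the polynomials
    that approximate. *)
Lemma holo_inv_affine (a b : C) : normc b * r < normc a -> holo (fun z => (a + b * z)^-1).
Proof.
move=> ab; have a0 : 0 < normc a by apply: le_lt_trans ab; rewrite mulr_ge0 ?normc_ge0 // ltW.
have an0 : a != 0 by rewrite -normc_gt0.
pose q := normc b * r / normc a.
have q01 : 0 <= q < 1.
  by rewrite divr_ge0 ?mulr_ge0 ?normc_ge0 ?(ltW r0) //= ltr_pdivrMr // mul1r.
have [q0 q1] := andP q01.
have d0 : 0 < normc a - normc b * r by rewrite subr_gt0.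
move=> e e0; have B0 : 0 < 1 / (normc a - normc b * r) by rewrite divr_gt0.
have [n qn] : exists n, 1 / (normc a - normc b * r) * q ^+ n <= e.
  apply: contrapT => /forallNP H.
  have : e <= 0.
    apply: (geometric_le0 q01 (B := 1 / (normc a - normc b * r))) => n.
    by have /negP := H n; rewrite -ltNge => /ltW.
  by rewrite leNgt e0.
exists (\sum_(j < n) (a^-1 * (- b / a) ^+ j) *: 'X^j) => z zr.
have bz : normc (b * z) <= normc b * r by rewrite normcM ler_wpM2l ?normc_ge0.
have abz : normc a - normc b * r <= normc (a + b * z).
  rewrite -[b * z]opprK; apply: le_trans (normc_ge_sub _ _).
  by rewrite lerB // normcN.
have abn0 : a + b * z != 0 by rewrite -normc_gt0 (lt_le_trans d0).
have geo m : (a + b * z)^-1 =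
    \sum_(j < m) a^-1 * (- b / a) ^+ j * z ^+ j + (- b * z / a) ^+ m * (a + b * z)^-1.
  elim: m => [|m IH]; first by rewrite big_ord0 add0r expr0 mul1r.
  rewrite {1}IH big_ord_recr /= -addrA; congr (_ + _).
  rewrite exprS -mulrA [- b * (z / a)]mulrCA [(z * _) ^+ m]exprMn.
  rewrite [z * (- b / a)]mulrA.
  move: ((- b / a) ^+ m) (z ^+ m) => A Z.
  by field; rewrite an0 abn0.
rewrite horner_sum; under eq_bigr do rewrite hornerZ hornerXn.
rewrite {1}(geo n) addrC addKr; apply: le_trans qn.
rewrite normcM normcX !normcM normcN !normcV mulrC; apply: ler_pM.
- by rewrite invr_ge0 normc_ge0.
- by rewrite exprn_ge0 // !mulr_ge0 ?invr_ge0 ?normc_ge0.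
- by rewrite mul1r lef_pV2 ?posrE // (lt_le_trans d0).
- rewrite lerXn2r // ?nnegrE // ?mulr_ge0 ?invr_ge0 ?normc_ge0 //.
  by rewrite ler_pM2r ?invr_gt0 // -normcM.
Qed.

End CircleFunctional.

(** * Contour formulas for one- and two-point functions *)

Section Residues.
Variable R : realType.
Local Notation C := R[i].

(** Lagrange interpolation of the constant function 1 at the nodes y i. *)
Lemma lagrange_sum1 (A : fieldType) N (y : 'I_N -> A) (z : A) :
  (0 < N)%N -> injective y ->
  \sum_i \prod_(j | j != i) ((y j - z) / (y j - y i)) = 1.
Proof.
move=> N0 yinj.
pose p : {poly A} := \sum_i \prod_(j | j != i)
  ((y j - y i)^-1 *: ((y j)%:P - 'X)) - 1.
have pz u : p.[u] = \sum_i \prod_(j | j != i) ((y j - u) / (y j - y i)) - 1.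
  rewrite /p hornerD hornerN hornerC horner_sum; congr (_ - _).
  apply: eq_bigr => i _; rewrite horner_prod; apply: eq_bigr => j _.
  by rewrite hornerZ hornerD hornerN hornerC hornerX mulrC.
suff p0 : p = 0 by apply/eqP; rewrite -subr_eq0 -pz p0 horner0.
apply: (@roots_geq_poly_eq0 _ p (codom y)).
- apply/allP => _ /codomP[k ->]; rewrite /root pz (bigD1 k) //= [X in _ + X - 1]big1; last first.
    by move=> i ik; rewrite (bigD1 k) 1?eq_sym //= subrr !mul0r.
  rewrite addr0 big1 ?subrr // => j jk.
  by rewrite divff // subr_eq0 (inj_eq yinj).
- by rewrite map_inj_uniq ?enum_uniq.
- rewrite size_codom card_ord.
  apply: leq_trans (size_polyD _ _) _; rewrite geq_max size_polyN size_poly1 N0 andbT.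
  apply: leq_trans (size_sum _ _ _) _; apply/bigmax_leqP => i _.
  rewrite scaler_prod.
  apply: leq_trans (size_scale_leq _ _) _; apply: leq_trans (size_poly_prod_leq _ _) _.
  rewrite (eq_bigr (fun=> 2%N)); last first.
    by move=> j _; rewrite -opprB size_polyN size_XsubC.
  rewrite sum_nat_const cardC1 card_ord; lia.
Qed.

(** Interpolating 1 at the y i splits the integrand into simple fractions, to
    each of which Cauchy's formula applies. *)
Lemma cmean_residues (r : R) (r0 : 0 < r) N (y : 'I_N -> C) (phi : C -> C) :
  (0 < N)%N -> injective y -> (forall i, normc (y i) < r) -> holo r phi ->
  cmean r (fun z => z * phi z / \prod_j (y j - z)) =
  - \sum_i phi (y i) / \prod_(j | j != i) (y j - y i).
Proof.
move=> N0 yinj yr H.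
have yz i z : normc z = r -> y i - z != 0.
  by move=> zr; rewrite -oppr_eq0 opprB (circ_sub_neq0 (yr i)).
have yij i j : j != i -> y j - y i != 0 by move=> ji; rewrite subr_eq0 (inj_eq yinj).
rewrite (@eq_cmean _ _ r0 _ (fun z => \sum_i (- (\prod_(j | j != i) (y j - y i))^-1)
   * (z / (z - y i) * phi z))); last first.
  move=> z zr.
  have Pn0 : \prod_j (y j - z) != 0 by apply/prodf_neq0 => j _; exact: yz.
  rewrite -[LHS]mul1r -[X in X * _](lagrange_sum1 z N0 yinj) mulr_suml; apply: eq_bigr => i _.
  rewrite prodf_div [in X in _ * X](bigD1 i) //=.
  have Q1 : \prod_(j | j != i) (y j - z) != 0 by apply/prodf_neq0 => j _; exact: yz.
  have Q2 : \prod_(j | j != i) (y j - y i) != 0 by apply/prodf_neq0 => j; exact: yij.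
  have zy : z - y i != 0 by rewrite -oppr_eq0 opprB yz.
  move: Q1 Q2 (yz i z zr) zy; set P1 := \prod_(j | _) _; set P2 := \prod_(j | _) _.
  move=> P10 P20 yz0 zy0; field.
  by rewrite P10 P20 yz0 zy0.
have cz i : ccirc r (fun z => z / (z - y i) * phi z).
  apply: ccircM; first exact: ccirc_cauchy.
  exact: holo_ccirc.
rewrite cmean_sum; last first.
  by move=> i _; apply: ccircM => //; exact: ccirc_cst.
rewrite -sumrN; apply: eq_bigr => i _.
by rewrite cmeanZ // cmean_cauchy // mulNr mulrC.
Qed.

End Residues.

Section Tilting.
Variables (A : fieldType) (N : nat).
Implicit Types (x : 'I_N -> A) (q : A).

Definition tilt x (i : 'I_N) q : 'I_N -> A := fun j => if j == i then q * x j else x j.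

(** In the Leibniz formula each tilt multiplies a monomial by one of the
    factors q ^+ l j, and every j occurs once. *)
Lemma sum_altdet_tilt x (l : 'I_N -> nat) q :
  \sum_i altdet (tilt x i q) l = (\sum_j q ^+ l j) * altdet x l.
Proof.
rewrite /altdet /determinant mulr_sumr exchange_big /=; apply: eq_bigr => s _.
rewrite [X in X * _](reindex_inj (@perm_inj _ s)) mulr_suml; apply: eq_bigr => i _.
rewrite mulrCA; congr (_ * _).
rewrite (bigD1 i) //= [X in _ = _ * X](bigD1 i) //= !mxE /tilt eqxx exprMn -mulrA.
congr (_ * (_ * _)); apply: eq_bigr => j ji.
by rewrite !mxE (negPf ji).
Qed.

(** Sets apart the factors of the Vandermonde product that contain x i, the
    only ones that a tilt changes. *)
Lemma altdet_isolate x i :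
  altdet x (@staircase N) =
  (\prod_(a < N | a != i) \prod_(b < N | (a < b)%N && (b != i)) (x a - x b))
  * (\prod_(j < N | (j < i)%N) (-1)) * \prod_(j < N | j != i) (x i - x j).
Proof.
rewrite altdet_staircase (bigD1 i) //=.
have -> : \prod_(j < N | j != i) \prod_(b < N | (j < b)%N) (x j - x b) =
  (\prod_(a < N | a != i) \prod_(b < N | (a < b)%N && (b != i)) (x a - x b)) *
  \prod_(j < N | (j < i)%N) (x j - x i).
  have -> : \prod_(j < N | (j < i)%N) (x j - x i) =
      \prod_(j < N | j != i) (if (j < i)%N then x j - x i else 1).
    rewrite -big_mkcondr; apply: eq_bigl => j.
    by case: (ltngtP j i) => [| |/val_inj ->]; rewrite ?andbT ?andbF ?eqxx // ltn_neqAle => /andP[].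
  rewrite -big_split /=; apply: eq_bigr => a ai.
  case: ifP => lt_ai; first by rewrite (bigD1 i) //= mulrC.
  rewrite mulr1; apply: eq_bigl => b.
  by have [->|] := eqVneq b i; rewrite ?andbT // lt_ai.
rewrite mulrCA -mulrA; congr (_ * _).
rewrite [X in _ = _ * X](bigID (fun j : 'I_N => (j < i)%N)) /=.
have -> : \prod_(i0 < N | (i0 != i) && (i0 < i)%N) (x i - x i0) =
    \prod_(j < N | (j < i)%N) (x i - x j).
  apply: eq_bigl => j; case: ltnP => ji; rewrite ?andbF // andbT.
  by apply: contraTneq ji => ->; rewrite ltnn.
have -> : \prod_(i0 < N | (i0 != i) && ~~ (i0 < i)%N) (x i - x i0) =
    \prod_(j < N | (i < j)%N) (x i - x j).
  by apply: eq_bigl => j; rewrite -leqNgt ltn_neqAle eq_sym.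
rewrite mulrA [LHS]mulrC; congr (_ * _); rewrite -big_split /=.
by apply: eq_bigr => j _; rewrite mulN1r opprB.
Qed.

Lemma altdet_tilt x i q :
  altdet (tilt x i q) (@staircase N) * \prod_(j < N | j != i) (x i - x j) =
  altdet x (@staircase N) * \prod_(j < N | j != i) (q * x i - x j).
Proof.
rewrite !(altdet_isolate _ i) mulrAC; congr (_ * _); last first.
  by apply: eq_bigr => j ji; rewrite /tilt eqxx (negPf ji).
congr (_ * _ * _); apply: eq_bigr => a ai; apply: eq_bigr => c /andP[_ ci].
by rewrite /tilt (negPf ai) (negPf ci).
Qed.

Lemma altdet_noninj x (l : 'I_N -> nat) : ~ injective x -> altdet x l = 0.
Proof.
move=> xinj; have /injectivePn[i [j ij xij]] : ~~ injectiveb x.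
  by apply/injectiveP.
apply: (determinant_alternate ij) => c; by rewrite !mxE xij.
Qed.

Lemma altdet_staircase_neq0 x : injective x -> altdet x (@staircase N) != 0.
Proof.
move=> xinj; rewrite altdet_staircase; apply/prodf_neq0 => i _; apply/prodf_neq0 => j ij.
by rewrite subr_eq0 (inj_eq xinj); apply: contraTneq ij => ->; rewrite ltnn.
Qed.

End Tilting.

Section SchurExpectation.
Variable R : realType.
Local Notation C := R[i].
Variables (N K : nat) (b : 'I_K -> C) (u : {ffun 'I_N -> 'I_K.+1} -> C).
Hypothesis (N0 : (0 < N)%N) (b1 : forall k, normc (b k) <= 1).
Implicit Types (x : 'I_N -> C) (phi : {ffun 'I_N -> 'I_K.+1} -> C) (q h z : C) (r : R).

(** With w_k = b_k / (1 - b_k), a constant multiple of the product of the 1 +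
    w_k z, free of denominators. *)
Definition factor_poly z : C := \prod_k (1 - b k + b k * z).

Hypothesis uP : forall x,
  \sum_(lam | is_part lam) u lam * altdet x (particle (fun i => lam i)) =
  altdet x (@staircase N) * \prod_i factor_poly (x i).

(** The expectation of phi times the normalization [denom x]; unlike the
    expectation it is a polynomial in x. *)
Definition numer phi x : C :=
  \sum_(lam | is_part lam) u lam * phi lam * altdet x (particle (fun i => lam i)).

Definition qsum q (lam : {ffun 'I_N -> 'I_K.+1}) : C :=
  \sum_j q ^+ particle (fun i => lam i) j.

Lemma numer_qsum phi q x :
  numer (fun lam => phi lam * qsum q lam) x = \sum_i numer phi (tilt x i q).
Proof.
rewrite /numer exchange_big /=; apply: eq_bigr => lam _.
by rewrite -mulr_sumr sum_altdet_tilt !mulrA.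
Qed.

(** The factor by which a tilt in direction i changes [denom]. *)
Definition weight x q i : C :=
  \prod_(j < N | j != i) ((q * x i - x j) / (x i - x j))
  * (factor_poly (q * x i) / factor_poly (x i)).

Definition denom x : C := altdet x (@staircase N) * \prod_i factor_poly (x i).

Lemma numer1 x : numer (fun=> 1) x = denom x.
Proof. by rewrite /denom -uP; apply: eq_bigr => lam _; rewrite mulr1. Qed.

Lemma denom_tilt x q i : injective x -> (forall j, factor_poly (x j) != 0) ->
  denom (tilt x i q) = denom x * weight x q i.
Proof.
move=> xinj F0; rewrite /denom /weight prodf_div.
have P0 : \prod_(j < N | j != i) (x i - x j) != 0.
  by apply/prodf_neq0 => j ji; rewrite subr_eq0 (inj_eq xinj) eq_sym.
rewrite [X in _ * X = _](bigD1 i) //= [X in _ = _ * X * _](bigD1 i) //=.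
rewrite [in X in _ * (_ * X) = _](eq_bigr (fun j => factor_poly (x j))); last first.
  by move=> j ji; rewrite /tilt (negPf ji).
rewrite {2}/tilt eqxx; have := altdet_tilt x i q; move: (F0 i) P0.
move: (altdet _ _) (altdet _ _) (\prod_(j < N | j != i) _) (\prod_(j < N | j != i) _)
  (\prod_(j < N | j != i) _) (factor_poly _) (factor_poly _).
move=> V' V P1 P2 P3 F1 F2 F10 P30 E.
apply: (mulIf P30); rewrite (_ : _ * P3 = (V * P3) * (F1 * P1)); last by ring.
by rewrite E; field; rewrite P30 F10.
Qed.

(** Generating function in h of the elementary symmetric functions of [poles]. *)
Definition gfun x h z : C :=
  (\prod_j (1 + h * ((1 - z) / (1 - z - x j))))
  * (\prod_k (1 + h * (b k * (1 - z) / (1 - b k * z)))).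

Lemma sub_bz_neq0 k z : normc z < 1 -> 1 - b k * z != 0.
Proof.
move=> z1; rewrite -normc_gt0; apply: lt_le_trans (normc_ge_sub _ _).
rewrite normc1 subr_gt0 normcM; apply: le_lt_trans z1.
by rewrite ler_piMl ?normc_ge0.
Qed.

Lemma factor_poly_neq0 z : normc (1 - z) < 1 -> factor_poly z != 0.
Proof.
move=> z1; apply/prodf_neq0 => k _.
rewrite (_ : _ + _ = 1 - b k * (1 - z)); last by ring.
exact: sub_bz_neq0.
Qed.

Lemma sub_circ1_neq0 r z : r < 1 -> normc z = r -> 1 - z != 0.
Proof.
move=> r1 zr; rewrite -normc_gt0; apply: lt_le_trans (normc_ge_sub _ _).
by rewrite normc1 subr_gt0 zr.
Qed.

Lemma ccirc_id_sub1 r : 0 < r < 1 -> ccirc r (fun z => z / (z - 1)).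
Proof.
move=> /andP[r0 r1]; apply: ccircM; first exact: ccirc_id.
apply: ccircV => // [z zr|]; first by rewrite -oppr_eq0 opprB (sub_circ1_neq0 r1).
by apply: ccircB; [exact: ccirc_id|exact: ccirc_cst].
Qed.

Lemma ccirc_xterm r (a : C) : 0 < r -> normc (1 - a) < r ->
  ccirc r (fun z => (1 - z) / (1 - z - a)).
Proof.
move=> r0 ar; apply: ccircM; first by apply: ccircB; [exact: ccirc_cst|exact: ccirc_id].
apply: ccircV => // [z zr|].
  rewrite (_ : _ - a = 1 - a - z); last by ring.
  by rewrite -oppr_eq0 opprB (circ_sub_neq0 ar).
by apply: ccircB; [apply: ccircB; [exact: ccirc_cst|exact: ccirc_id]|exact: ccirc_cst].
Qed.

Lemma ccirc_bterm r k : 0 < r < 1 -> ccirc r (fun z => b k * (1 - z) / (1 - b k * z)).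
Proof.
move=> /andP[r0 r1]; apply: ccircM.
  apply: ccircM; first exact: ccirc_cst.
  by apply: ccircB; [exact: ccirc_cst|exact: ccirc_id].
apply: ccircV => // [z zr|]; first by apply: sub_bz_neq0; rewrite zr.
apply: ccircB; first exact: ccirc_cst.
by apply: ccircM; [exact: ccirc_cst|exact: ccirc_id].
Qed.

Lemma ccirc_gfun r x h : 0 < r < 1 -> (forall i, normc (1 - x i) < r) ->
  ccirc r (gfun x h).
Proof.
move=> r01 xr; have /andP[r0 r1] := r01.
apply: ccircM; apply: ccirc_prod => i _; apply: ccircD;
  [exact: ccirc_cst| |exact: ccirc_cst|].
  by apply: ccircM; [exact: ccirc_cst|exact: ccirc_xterm].
by apply: ccircM; [exact: ccirc_cst|exact: ccirc_bterm].
Qed.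

(** The weights are the residues, at the points 1 - x_i, of one rational function
    of z. *)
Lemma weight_residue r x h psi : 0 < r < 1 -> injective x ->
  (forall i, normc (1 - x i) < r) -> h != 0 -> holo r psi ->
  \sum_i weight x (1 + h) i * psi (1 - x i) =
  h^-1 * cmean r (fun z => z / (z - 1) * gfun x h z * psi z).
Proof.
move=> /andP[r0 r1] xinj xr h0 Hpsi.
(* The integrand without its poles 1 - x_j, up to sign and the factor z. *)
pose phi z := (\prod_j ((1 + h) * (1 - z) - x j)) *
  ((\prod_k ((1 + b k * h + (- b k * (1 + h)) * z) * (1 + (- b k) * z)^-1)) *
   (psi z * ((1 + (-1) * z)^-1 * h^-1))).
have Hphi : holo r phi.
  apply: holoM => //.
    apply: holo_prod => // j _.
    apply: eq_holo (holo_affine r (1 + h - x j) (- (1 + h))) => z _; ring.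
  apply: holoM => //.
    apply: holo_prod => // k _; apply: holoM => //; first exact: holo_affine.
    apply: holo_inv_affine => //; rewrite normcN normc1.
    by apply: le_lt_trans r1; rewrite ler_piMl // ltW.
  apply: holoM => //; apply: holoM => //; last exact: holo_cst.
  apply: holo_inv_affine => //; rewrite normcN normc1.
  by rewrite mul1r.
have yinj : injective (fun i => 1 - x i).
  by move=> i j /(congr1 (fun t => 1 - t)); rewrite !subKr => /xinj.
have := cmean_residues r0 N0 yinj xr Hphi => E.
have x0 i : x i != 0.
  apply: contraTneq (xr i) => ->; rewrite subr0 normc1 -leNgt.
  exact: ltW.
have F0 i : factor_poly (x i) != 0.
  by apply: factor_poly_neq0; exact: lt_trans r1.
transitivity (\sum_i phi (1 - x i) / \prod_(j < N | j != i) ((1 - x j) - (1 - x i))).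
  apply: eq_bigr => i _; rewrite /weight /phi prodf_div.
  rewrite [in X in _ = X / _](bigD1 i) //=.
  have -> : \prod_(j < N | j != i) (1 - x j - (1 - x i)) = \prod_(j < N | j != i) (x i - x j).
    by apply: eq_bigr => j _; ring.
  have -> : factor_poly ((1 + h) * x i) / factor_poly (x i) =
     \prod_k ((1 + b k * h + (- b k * (1 + h)) * (1 - x i)) * (1 + (- b k) * (1 - x i))^-1).
    rewrite prodf_div; congr (_ / _); apply: eq_bigr => k _; ring.
  have P0 : \prod_(j < N | j != i) (x i - x j) != 0.
    by apply/prodf_neq0 => j ji; rewrite subr_eq0 (inj_eq xinj) eq_sym.
  have -> : \prod_(i0 < N | i0 != i) ((1 + h) * (1 - (1 - x i)) - x i0) =
     \prod_(j < N | j != i) ((1 + h) * x i - x j).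
    by apply: eq_bigr => j _; ring.
  move: P0 (x0 i); move: (\prod_(j < N | _) _) (\prod_(j < N | _) _) (\prod_k _) (psi _).
  move=> P1 P2 P3 ps P20 xi0.
  rewrite (_ : 1 + -1 * (1 - x i) = x i); last by ring.
  by field; rewrite xi0 h0 P20.
rewrite -[LHS]opprK -E (@eq_cmean _ _ r0 _ (fun z => (- h^-1) *
    (z / (z - 1) * gfun x h z * psi z))); last first.
  move=> z zr; rewrite /phi /gfun.
  have z1 : z - 1 != 0.
    by rewrite -oppr_eq0 opprB; have := sub_circ1_neq0 r1 zr.
  have -> : \prod_j (1 + h * ((1 - z) / (1 - z - x j))) =
     (\prod_j ((1 + h) * (1 - z) - x j)) / \prod_j (1 - x j - z).
    rewrite -prodf_div; apply: eq_bigr => j _.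
    have yz : 1 - x j - z != 0 by rewrite -oppr_eq0 opprB (circ_sub_neq0 (xr j)).
    by rewrite (_ : 1 - z - x j = 1 - x j - z); [field|ring].
  have -> : \prod_k (1 + h * (b k * (1 - z) / (1 - b k * z))) =
     \prod_k ((1 + b k * h + (- b k * (1 + h)) * z) * (1 + (- b k) * z)^-1).
    apply: eq_bigr => k _.
    have bz : 1 - b k * z != 0 by apply: sub_bz_neq0; rewrite zr.
    by rewrite (_ : 1 + - b k * z = 1 - b k * z); [field|ring].
  have P0 : \prod_j (1 - x j - z) != 0.
    by apply/prodf_neq0 => j _; rewrite -oppr_eq0 opprB (circ_sub_neq0 (xr j)).
  rewrite (_ : 1 + (-1) * z = - (z - 1)); last by ring.
  move: P0; move: (\prod_j _) (\prod_j _) (\prod_k _) => P1 P2 P3 P20.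
  by rewrite invrN; field; rewrite P20 z1 h0.
rewrite cmeanZ ?mulNr ?opprK //; apply: ccircM; last exact: holo_ccirc.
have r01 : 0 < r < 1 by rewrite r0.
by apply: ccircM; [exact: ccirc_id_sub1|exact: ccirc_gfun].
Qed.

(** Tilting acts on the alternants by the sum of the q ^+ l j and on the
    normalization by [weight], and [weight_residue] sums the weights. If two of
    the x i coincide, both sides vanish. *)
Lemma numer_qsum_cmean r x h : 0 < r < 1 -> (forall i, normc (1 - x i) < r) -> h != 0 ->
  numer (qsum (1 + h)) x =
  denom x * (h^-1 * cmean r (fun z => z / (z - 1) * gfun x h z)).
Proof.
move=> r01 xr h0; have /andP[r0 r1] := r01.
have [xinj|xinj] := pselect (injective x); last first.
  rewrite /denom altdet_noninj // mul0r mul0r /numer big1 // => lam _.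
  by rewrite altdet_noninj // mulr0.
have F0 i : factor_poly (x i) != 0.
  by apply: factor_poly_neq0; exact: lt_trans r1.
have -> : numer (qsum (1 + h)) x = numer (fun lam => 1 * qsum (1 + h) lam) x.
  by apply: eq_bigr => lam _; rewrite mul1r.
rewrite numer_qsum; under eq_bigr do rewrite numer1 denom_tilt //.
rewrite -mulr_sumr; congr (_ * _).
have := weight_residue r01 xinj xr h0 (holo_cst r 1).
under eq_bigr do rewrite mulr1.
by move=> ->; congr (_ * _); apply: eq_cmean => // z _; rewrite mulr1.
Qed.

(** What a tilt of x_i = v contributes to the integrand at z, beyond the factor
    1; it couples the two contours. *)
Definition cross h1 h2 z v : C := z * v / ((z - (1 + h1) * v) * ((1 + h2) * z - v)).

Section Cross.
Variables (r r' : R) (h1 h2 : C).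
Hypotheses (r'0 : 0 < r') (r1 : r < 1).
Hypothesis (h1r : (1 + normc h1) * r' < r - normc h1).
Hypothesis (h2r : r' < r - 2 * normc h2).

(** The circles |z| = r and |v| <= r' are far enough apart for small h1 and h2
    that the denominators of [cross] stay away from 0. *)
Lemma cross_den1 z v : normc z = r -> normc v <= r' ->
  r - normc h1 - (1 + normc h1) * r' <= normc ((1 - z) - (1 + h1) * (1 - v)).
Proof.
move=> zr vr; rewrite (_ : _ - _ = - (z + h1 - (1 + h1) * v)); last by ring.
rewrite normcN; apply: le_trans (normc_ge_sub _ _); apply: lerB.
  by rewrite -zr; exact: normc_ge_subD.
rewrite normcM; apply: ler_pM; rewrite ?normc_ge0 //.
by apply: le_trans (normcD _ _) _; rewrite normc1.
Qed.

Lemma normc1_sub_le z : normc z = r -> normc (1 - z) <= 2.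
Proof.
move=> zr; apply: le_trans (normcD _ _) _; rewrite normcN zr normc1.
by rewrite (_ : 2 = 1 + 1) // lerD2l ltW.
Qed.

Lemma cross_den2 z v : normc z = r -> normc v <= r' ->
  r - 2 * normc h2 - r' <= normc ((1 + h2) * (1 - z) - (1 - v)).
Proof.
move=> zr vr; rewrite (_ : _ - _ = v - (z - h2 * (1 - z))); last by ring.
rewrite normc_distC; apply: le_trans (normc_ge_sub _ _); apply: lerB => //.
apply: le_trans (normc_ge_sub _ _); rewrite zr lerB // normcM mulrC.
by rewrite ler_wpM2r ?normc_ge0 ?normc1_sub_le.
Qed.

Lemma cross_den_neq0 z v : normc z = r -> normc v <= r' ->
  (1 - z) - (1 + h1) * (1 - v) != 0 /\ (1 + h2) * (1 - z) - (1 - v) != 0.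
Proof.
move=> zr vr; split; rewrite -normc_gt0.
  by apply: lt_le_trans (cross_den1 zr vr); rewrite subr_gt0.
by apply: lt_le_trans (cross_den2 zr vr); rewrite subr_gt0.
Qed.

Lemma holo_cross z : normc z = r -> holo r' (fun v => cross h1 h2 (1 - z) (1 - v)).
Proof.
move=> zr.
apply: (@eq_holo _ _ (fun v => ((1 - z) + (- (1 - z)) * v)
  * ((((1 - z) - (1 + h1)) + (1 + h1) * v)^-1 * (((1 + h2) * (1 - z) - 1) + 1 * v)^-1))).
  move=> v vr; have [d1 d2] := cross_den_neq0 zr vr; rewrite /cross invfM.
  by congr (_ * (_^-1 * _^-1)); ring.
apply: holoM => //; first exact: holo_affine.
apply: holoM => //; apply: holo_inv_affine => //.
  rewrite (_ : _ - _ = - (z + h1)); last by ring.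
  rewrite normcN; apply: (@le_lt_trans _ _ ((1 + normc h1) * r')).
    rewrite ler_pM2r //; apply: le_trans (normcD _ _) _.
    by rewrite normc1.
  by apply: lt_le_trans h1r _; rewrite -zr; exact: normc_ge_subD.
rewrite normc1 mul1r.
rewrite (_ : _ - 1 = - (z - h2 * (1 - z))); last by ring.
rewrite normcN; apply: lt_le_trans h2r _; apply: le_trans (normc_ge_sub _ _).
by rewrite zr lerB // normcM mulrC ler_wpM2r ?normc_ge0 ?normc1_sub_le.
Qed.

Lemma ccirc_cross v : 0 < r -> normc v <= r' ->
  ccirc r (fun z => cross h1 h2 (1 - z) (1 - v)).
Proof.
move=> r0 vr; have c1 : ccirc r (fun z => 1 - z).
  by apply: ccircB; [exact: ccirc_cst|exact: ccirc_id].
apply: ccircM; first by apply: ccircM => //; exact: ccirc_cst.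
apply: ccircV => // [z zr|].
  by have [d1 d2] := cross_den_neq0 zr vr; rewrite mulf_neq0.
apply: ccircM; apply: ccircB; [exact: c1|exact: ccirc_cst| |exact: ccirc_cst].
by apply: ccircM => //; exact: ccirc_cst.
Qed.

(** A tilt changes one factor of the first product only, and the ratio is 1 up
    to the order h1 h2. *)
Lemma gfun_tilt x i z : normc (1 - x i) < r' -> normc z = r ->
  gfun (tilt x i (1 + h1)) h2 z =
  gfun x h2 z * (1 + h1 * h2 * cross h1 h2 (1 - z) (x i)).
Proof.
move=> xr zr; have rr : r' < r by have := normc_ge0 h2; move: h2r; lra.
have [d1 d2] := cross_den_neq0 zr (ltW xr); rewrite subKr in d1 d2.
rewrite /gfun mulrAC; congr (_ * _).
rewrite (bigD1 i) //= [in RHS](bigD1 i) //= {1}/tilt eqxx.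
rewrite [in LHS](eq_bigr (fun j => 1 + h2 * ((1 - z) / (1 - z - x j)))); last first.
  by move=> j ji; rewrite /tilt (negPf ji).
rewrite mulrAC; congr (_ * _).
have d3 : 1 - z - x i != 0.
  rewrite (_ : _ - x i = 1 - x i - z); last by ring.
  by rewrite -oppr_eq0 opprB (circ_sub_neq0 (lt_trans xr rr)).
rewrite /cross; field; by rewrite d1 d3 d2.
Qed.

(** A second tilt is applied to the one-point formula. The 1 in [gfun_tilt]
    produces the product of the one-point functions, and the other term, summed
    over i by [weight_residue], the double integral. *)
Lemma numer_qsum_pair_cmean x : injective x -> (forall i, normc (1 - x i) < r') ->
  (forall i, normc (1 - (1 + h1) * x i) < r) -> h1 != 0 -> h2 != 0 ->
  numer (fun lam => qsum (1 + h2) lam * qsum (1 + h1) lam) x =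
  denom x * (cmean r (fun z => z / (z - 1) * gfun x h2 z *
    cmean r' (fun v => v / (v - 1) * gfun x h1 v * cross h1 h2 (1 - z) (1 - v))))
  + numer (qsum (1 + h1)) x * numer (qsum (1 + h2)) x / denom x.
Proof.
move=> xinj xr' xr h10 h20.
have rr : r' < r by have := normc_ge0 h2; move: h2r; lra.
have r0 : 0 < r by exact: lt_trans rr.
have r01 : 0 < r < 1 by rewrite r0.
have r'01 : 0 < r' < 1 by rewrite r'0 (lt_trans rr).
have xr2 i : normc (1 - x i) < r by exact: lt_trans rr.
have F0 i : factor_poly (x i) != 0.
  by apply: factor_poly_neq0; exact: lt_trans r1.
have D0 : denom x != 0.
  by rewrite mulf_neq0 ?altdet_staircase_neq0 //; apply/prodf_neq0 => i _.
set G := fun z => z / (z - 1) * gfun x h2 z.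
have cG : ccirc r G by apply: ccircM; [exact: ccirc_id_sub1|exact: ccirc_gfun].
have cGx i : ccirc r (fun z => G z * cross h1 h2 (1 - z) (x i)).
  apply: ccircM => //; have := @ccirc_cross (1 - x i) r0 (ltW (xr' i)).
  by rewrite subKr.
have tiltr i j : normc (1 - tilt x i (1 + h1) j) < r.
  by rewrite /tilt; case: ifP => [/eqP ->|_].
have E i : numer (qsum (1 + h2)) (tilt x i (1 + h1)) =
    denom x * (weight x (1 + h1) i * (h2^-1 * cmean r G)
     + h1 * (weight x (1 + h1) i * cmean r (fun z => G z * cross h1 h2 (1 - z) (x i)))).
  rewrite (numer_qsum_cmean r01) // denom_tilt // -mulrA; congr (_ * _).
  rewrite (@eq_cmean _ _ r0 _ (fun z => G z + h1 * h2 * (G z * cross h1 h2 (1 - z) (x i)))).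
    rewrite cmeanD ?cmeanZ //; first by field; rewrite h20.
    by apply: ccircM => //; exact: ccirc_cst.
  by move=> z zr; rewrite gfun_tilt // /G; ring.
rewrite numer_qsum; under eq_bigr do rewrite E.
rewrite -mulr_sumr big_split /= -mulr_suml -mulr_sumr.
have W1 : \sum_i weight x (1 + h1) i = numer (qsum (1 + h1)) x / denom x.
  have -> : numer (qsum (1 + h1)) x = numer (fun lam => 1 * qsum (1 + h1) lam) x.
    by apply: eq_bigr => lam _; rewrite mul1r.
  rewrite numer_qsum; under [in RHS]eq_bigr do rewrite numer1 denom_tilt //.
  by rewrite -mulr_sumr mulrC mulKf.
(* For fixed z, [weight_residue] with the cross factor as test function. *)
have -> : h1 * (\sum_i weight x (1 + h1) i * cmean r (fun z => G z * cross h1 h2 (1 - z) (x i)))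
   = cmean r (fun z => G z * cmean r'
       (fun v => v / (v - 1) * gfun x h1 v * cross h1 h2 (1 - z) (1 - v))).
  rewrite mulr_sumr (eq_bigr (fun i => cmean r (fun z =>
    h1 * weight x (1 + h1) i * (G z * cross h1 h2 (1 - z) (x i))))); last first.
    by move=> i _; rewrite cmeanZ // mulrA.
  rewrite -cmean_sum; last by move=> i _; apply: ccircM => //; exact: ccirc_cst.
  apply: eq_cmean => // z zr.
  have := weight_residue r'01 xinj xr' h10 (holo_cross zr).
  under eq_bigr do rewrite subKr.
  move=> /(congr1 (fun a => h1 * a)); rewrite mulVKf // => <-.
  by rewrite !mulr_sumr; apply: eq_bigr => i _; ring.
rewrite W1 -(mulKf D0 (h2^-1 * _)) -(numer_qsum_cmean r01) //.
by field.
Qed.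

End Cross.

End SchurExpectation.

(** * Estimates for means and covariances *)

Lemma ffact_leq_expn n m : (n ^_ m <= n ^ m)%N.
Proof.
by elim: m => // m IH; rewrite expnSr ffactnSr leq_mul // leq_subr.
Qed.

(** The error is of lower order in n, with the crude constant m ^ 2. *)
Lemma expn_le_ffact n m : (n ^ m <= n ^_ m + m ^ 2 * n ^ m.-1)%N.
Proof.
elim: m => [|m IH] //=.
rewrite expnS ffactnSr.
have h1 : (n * n ^_ m <= n ^_ m * (n - m) + m * n ^ m)%N.
  have fm := ffact_leq_expn n m.
  have [nm|nm] := leqP n m.
    by apply: leq_trans (leq_addl _ _); apply: leq_mul.
  by rewrite -{1}(subnK (ltnW nm)) mulnDl mulnC leq_add2l leq_mul.
have h2 : (n * (m ^ 2 * n ^ m.-1) <= m ^ 2 * n ^ m)%N.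
  case: m {IH h1} => [|m]; first by rewrite exp0n // !mul0n muln0.
  by rewrite mulnCA /= [(n ^ m.+1)%N]expnS.
apply: leq_trans (leq_mul (leqnn n) IH) _; rewrite mulnDr.
apply: leq_trans (leq_add h1 h2) _; rewrite -addnA leq_add2l -mulnDl leq_mul2r.
by apply/orP; right; rewrite -!mulnn mulSn mulnS; lia.
Qed.

Section ElementarySymmetric.
Variable R : realType.
Local Notation C := R[i].
Implicit Types (s : seq C) (a S : C) (A T : R).

Definition elem_sym s m : C := (\prod_(a <- s) (1 + a *: 'X))`_m.

Lemma elem_sym_nil m : elem_sym [::] m = (m == 0)%:R.
Proof. by rewrite /elem_sym big_nil coef1. Qed.

Lemma elem_sym_cons a s m :
  elem_sym (a :: s) m = elem_sym s m + (if m is m'.+1 then a * elem_sym s m' else 0).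
Proof.
rewrite /elem_sym big_cons mulrDl mul1r coefD -scalerAl coefZ coefXM.
by case: m => [|m] /=; rewrite ?mulr0.
Qed.

Lemma elem_sym0 s : elem_sym s 0 = 1.
Proof. by elim: s => [|a s IH]; rewrite ?elem_sym_nil ?elem_sym_cons ?addr0. Qed.

Lemma size_elem_sym s : (size (\prod_(a <- s) (1 + a *: 'X : {poly C}))%R <= (size s).+1)%N.
Proof.
elim: s => [|a s IH]; first by rewrite big_nil size_poly1.
rewrite big_cons; apply: leq_trans (size_polyMleq _ _) _.
have : (size (1 + a *: 'X : {poly C})%R <= 2)%N.
  apply: leq_trans (size_polyD _ _) _; rewrite geq_max size_poly1 /=.
  by apply: leq_trans (size_scale_leq _ _) _; rewrite size_polyX.
by move: IH => /=; lia.
Qed.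

Lemma normc_nat n : normc (n%:R : C) = n%:R.
Proof. by rewrite -(rmorph_nat (real_complex R)) normcR normr_nat. Qed.

(** Expanding the left side leaves monomials with at least two factors a, with
    nonnegative coefficients, so it is dominated by its value at the bounds. *)
Lemma second_order_le a S A T m : normc a <= A -> normc S <= T ->
  normc ((a + S) ^+ m.+1 - S ^+ m.+1 - a * S ^+ m *+ m.+1)
  <= (A + T) ^+ m.+1 - T ^+ m.+1 - A * T ^+ m *+ m.+1.
Proof.
move=> aA ST; have A0 := le_trans (normc_ge0 _) aA; have T0 := le_trans (normc_ge0 _) ST.
have E (L : comNzRingType) (p q : L) k : (p + q) ^+ k.+2 - q ^+ k.+2 - p * q ^+ k.+1 *+ k.+2 =
    (p + q) * ((p + q) ^+ k.+1 - q ^+ k.+1 - p * q ^+ k *+ k.+1)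
    + p ^+ 2 * q ^+ k *+ k.+1.
  rewrite mulrS -[_ *+ k.+1]mulr_natr -[p * q ^+ k *+ _]mulr_natr -[p ^+ 2 * _ *+ _]mulr_natr.
  rewrite !exprS; move: ((p + q) ^+ k) (q ^+ k) (k.+1%:R) => u v w; ring.
have apS : normc (a + S) <= A + T by apply: le_trans (normcD _ _) _; exact: lerD.
elim: m => [|m IH].
  by rewrite !expr1 !expr0 !mulr1 !mulr1n !addrK !subrr normc0.
rewrite !E; apply: le_trans (normcD _ _) _; apply: lerD.
  by rewrite normcM ler_pM ?normc_ge0.
rewrite -[X in normc X]mulr_natr -[leRHS]mulr_natr normcM normc_nat.
rewrite ler_wpM2r // normcM !normcX ler_pM ?exprn_ge0 ?normc_ge0 //.
  by rewrite lerXn2r ?nnegrE ?normc_ge0.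
by rewrite lerXn2r ?nnegrE ?normc_ge0.
Qed.

Lemma normc_sum_le s A : (forall a, a \in s -> normc a <= A) ->
  normc (\sum_(a <- s) a) <= (size s)%:R * A.
Proof.
elim: s => [|a s IH] sA; first by rewrite big_nil normc0 mul0r.
rewrite big_cons -natr1 mulrDl mul1r addrC; apply: le_trans (normcD _ _) _.
apply: lerD; last by apply: sA; rewrite mem_head.
by apply: IH => c cs; apply: sA; rewrite in_cons cs orbT.
Qed.

(** The majorant on the right is what the left side becomes when all entries are
    equal to A. *)
Lemma elem_sym_power_sum s A m : 0 <= A -> (forall a, a \in s -> normc a <= A) ->
  normc ((\sum_(a <- s) a) ^+ m - m`!%:R * elem_sym s m)
  <= A ^+ m * ((size s)%:R ^+ m - (size s ^_ m)%:R).
Proof.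
move=> A0; elim: s m => [|a s IH] m sA.
  rewrite big_nil elem_sym_nil /=; case: m => [|m].
    by rewrite !expr0 mulr1 subrr normc0 ffactn0 subrr mulr0.
  by rewrite !expr0n /= mulr0 subrr normc0 mulr_ge0 ?exprn_ge0 // subr_ge0 ler_nat.
case: m => [|m].
  by rewrite !expr0 elem_sym0 mulr1 subrr normc0 ffactn0 subrr mulr0.
have sA' c : c \in s -> normc c <= A by move=> cs; apply: sA; rewrite in_cons cs orbT.
have aA : normc a <= A by apply: sA; rewrite mem_head.
rewrite big_cons elem_sym_cons; set S := \sum_(a <- s) a; set n := size s.
have ST : normc S <= n%:R * A by exact: normc_sum_le.
have := IH m.+1 sA'; have := IH m sA'; have := second_order_le m aA ST.
rewrite -/S -/n; set Q := (a + S) ^+ m.+1 - _ - _ => H2 H1 H0.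
(* Q collects the terms that are at least quadratic in the first entry a. *)
rewrite (_ : _ - _ = (S ^+ m.+1 - (m.+1)`!%:R * elem_sym s m.+1)
   + (a * (S ^+ m - m`!%:R * elem_sym s m) *+ m.+1) + Q); last first.
  rewrite /Q factS natrM -[a * (_ - _) *+ _]mulr_natr -[a * _ *+ _]mulr_natr.
  by move: (_ ^+ _) (S ^+ m) (elem_sym _ _) (elem_sym _ _) => u v w1 w2; ring.
(* The same recursion when all entries are A. *)
rewrite [leRHS](_ : _ = A ^+ m.+1 * (n%:R ^+ m.+1 - (n ^_ m.+1)%:R)
   + A * (A ^+ m * (n%:R ^+ m - (n ^_ m)%:R)) *+ m.+1
   + ((A + n%:R * A) ^+ m.+1 - (n%:R * A) ^+ m.+1 - A * (n%:R * A) ^+ m *+ m.+1)); last first.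
  rewrite /= ffactSS -/n.
  have -> : (A + n%:R * A) ^+ m.+1 = A ^+ m.+1 * n.+1%:R ^+ m.+1.
    by rewrite -exprMn -natr1; congr (_ ^+ _); ring.
  have -> : ((n.+1 * n ^_ m)%N%:R : R) = (n ^_ m.+1)%:R + m.+1%:R * (n ^_ m)%:R.
    have [mn|nm] := leqP m n.
      rewrite ffactnSr [(n ^_ m * _)%N]mulnC -natrM -natrD -mulnDl.
      by rewrite (_ : (n - m + m.+1)%N = n.+1) //; lia.
    have nm1 : (n < m.+1)%N by exact: ltnW.
    by rewrite (ffact_small nm) (ffact_small nm1) muln0 mulr0 addr0.
  rewrite !exprMn -[A * _ *+ _]mulr_natr -[A * (_ * _) *+ _]mulr_natr exprS.
  by move: (n.+1%:R ^+ _) (n%:R ^+ _) (n%:R ^+ _) (A ^+ m) => ? ? ? ?; ring.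
apply: le_trans (normcD _ _) _; apply: lerD => //.
apply: le_trans (normcD _ _) _; apply: lerD => //.
rewrite -[X in normc X]mulr_natr -[leRHS]mulr_natr normcM normc_nat ler_wpM2r // normcM.
by rewrite ler_pM ?normc_ge0.
Qed.

End ElementarySymmetric.

Section CauchyEstimates.
Variable R : realType.
Local Notation C := R[i].

Lemma coef_cmean (rho : R) (p : {poly C}) k : 0 < rho ->
  p`_k = cmean rho (fun h => h ^- k * p.[h]).
Proof.
move=> rho0.
have cX m : ccirc rho (fun h => h ^+ m) by apply: ccircX; exact: ccirc_id.
have cV m : ccirc rho (fun h => h ^- m).
  by apply: ccircV => // z /circ_neq0 z0; apply: expf_neq0; exact: z0.
rewrite (@eq_cmean _ _ rho0 _ (fun h => \sum_(j < size p) p`_j * (h ^- k * h ^+ j))); last first.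
  by move=> h _; rewrite horner_coef mulr_sumr; apply: eq_bigr => j _; rewrite mulrCA.
rewrite cmean_sum; last first.
  by move=> j _; apply: ccircM; [exact: ccirc_cst|exact: ccircM].
have mean j : cmean rho (fun h => h ^- k * h ^+ j) = (j == k)%:R.
  case: (ltngtP j k) => jk.
  - rewrite (@eq_cmean _ _ rho0 _ (fun h => h ^- (k - j))) ?cmeanVX ?subn_gt0 //.
    move=> h /circ_neq0 h0; have {}h0 := h0 rho0.
    rewrite -{1}(subnK (ltnW jk)) exprD; move: (h ^+ j) (h ^+ (k - j)) (expf_neq0 j h0).
    move=> a b a0; have [->|b0] := eqVneq b 0; first by rewrite mul0r invr0 mul0r.
    by field; rewrite a0 b0.
  - rewrite (@eq_cmean _ _ rho0 _ (fun h => h ^+ (j - k))) ?cmeanX ?subn_gt0 //.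
    move=> h /circ_neq0 h0; have {}h0 := h0 rho0.
    by rewrite -{1}(subnK (ltnW jk)) exprD mulrC mulfK // expf_neq0.
  - rewrite jk (@eq_cmean _ _ rho0 _ (fun=> 1)) ?cmean_cst //.
    by move=> h /circ_neq0 h0; rewrite mulVf // expf_neq0 // h0.
under eq_bigr => j _.
  rewrite cmeanZ; last exact: ccircM.
  rewrite mean; over.
have [kp|kp] := ltnP k (size p).
  rewrite (bigD1 (Ordinal kp)) //= eqxx mulr1 big1 ?addr0 // => j.
  by rewrite -val_eqE /= => /negPf ->; rewrite mulr0.
rewrite nth_default // big1 // => j _.
by rewrite ltn_eqF ?mulr0 // (leq_trans (ltn_ord j)).
Qed.

Lemma cauchy_estimate (rho B : R) (p : {poly C}) k : 0 < rho ->
  (forall h, normc h = rho -> normc p.[h] <= B) -> normc p`_k <= 2 * (B / rho ^+ k).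
Proof.
move=> rho0 pB; rewrite (coef_cmean p k rho0); apply: cmean_le => //.
  apply: ccircM; last exact: ccirc_horner.
  apply: ccircV => //; last by apply: ccircX; exact: ccirc_id.
  by move=> z /circ_neq0 z0; apply: expf_neq0; exact: z0.
move=> h hr; rewrite normcM normcV normcX hr mulrC ler_wpM2r ?pB //.
by rewrite invr_ge0 exprn_ge0 // ltW.
Qed.

(** Cauchy's estimate in each variable in turn. *)
Lemma cauchy_estimate2 (rho B : R) n (c : nat -> nat -> C) k1 k2 : 0 < rho ->
  (k1 < n)%N -> (k2 < n)%N ->
  (forall h1 h2, normc h1 = rho -> normc h2 = rho ->
     normc (\sum_(i < n) \sum_(j < n) c i j * (h1 ^+ i * h2 ^+ j)) <= B) ->
  normc (c k1 k2) <= 2 * (2 * (B / rho ^+ k1) / rho ^+ k2).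
Proof.
move=> rho0 k1n k2n cB.
pose p h2 : {poly C} := \poly_(i < n) (\sum_(j < n) c i j * h2 ^+ j).
pose q : {poly C} := \poly_(j < n) c k1 j.
have -> : c k1 k2 = q`_k2 by rewrite coef_poly k2n.
apply: cauchy_estimate => // h2 h2r.
have -> : q.[h2] = (p h2)`_k1 by rewrite coef_poly k1n horner_poly.
apply: cauchy_estimate => // h1 h1r; rewrite horner_poly.
apply: le_trans (cB _ _ h1r h2r); rewrite le_eqVlt; apply/orP; left; apply/eqP.
congr normc; apply: eq_bigr => i _; rewrite mulr_suml; apply: eq_bigr => j _.
by rewrite -mulrA [h2 ^+ _ * _]mulrC.
Qed.

(** Removes the restriction h != 0 in the contour formulas before coefficients
    are compared. *)
Lemma poly_eq_off0 (K : numFieldType) (p q : {poly K}) :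
  (forall h, h != 0 -> p.[h] = q.[h]) -> p = q.
Proof.
move=> pq; apply/eqP; rewrite -subr_eq0; apply/eqP.
apply: (@roots_geq_poly_eq0 _ _ [seq i.+1%:R | i <- iota 0 (size (p - q))]).
- apply/allP => _ /mapP[i _ ->]; rewrite /root hornerD hornerN pq ?subrr // pnatr_eq0.
- by rewrite map_inj_uniq ?iota_uniq // => i j /eqP; rewrite eqr_nat => /eqP[].
- by rewrite size_map size_iota.
Qed.

End CauchyEstimates.

Section BinomialMoments.
Variable R : realType.
Local Notation C := R[i].
Variables (N K : nat) (b : 'I_K -> C) (u : {ffun 'I_N -> 'I_K.+1} -> C).
Hypothesis (N0 : (0 < N)%N) (b1 : forall k, normc (b k) <= 1).
Hypothesis uP : forall x : 'I_N -> C,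
  \sum_(lam | is_part lam) u lam * altdet x (particle (fun i => lam i)) =
  altdet x (@staircase N) * \prod_i factor_poly b (x i).
Implicit Types (x : 'I_N -> C) (z h : C) (r : R).

Definition binsum k (lam : {ffun 'I_N -> 'I_K.+1}) : C :=
  \sum_i 'C(particle (fun i => lam i) i, k)%:R.

(** The binomial theorem for (1 + h) ^+ l; the powers stop before N + K because
    the particles lie in [0, N + K). *)
Lemma qsum_binsum h lam : qsum (1 + h) lam = \sum_(k < N + K) binsum k lam * h ^+ k.
Proof.
rewrite /qsum /binsum; under [RHS]eq_bigr do rewrite mulr_suml.
rewrite exchange_big /=; apply: eq_bigr => i _.
set l := particle _ i; have lt_l : (l < N + K)%N by exact: particle_lt.
rewrite exprDn (eq_bigr (fun k : 'I_l.+1 => h ^+ k *+ 'C(l, k))); last first.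
  by move=> k _; rewrite expr1n mul1r.
rewrite -(subnKC lt_l) big_split_ord /= [X in _ = _ + X]big1 ?addr0; last first.
  by move=> k _; rewrite bin_small ?mul0r // ltn_addr.
by apply: eq_bigr => k _; rewrite mulr_natl.
Qed.

(** In the variable Z = 1 - z these are the numbers Z / (Z - x_i) and
    w_k Z / (1 + w_k Z) with w_k = b_k / (1 - b_k). *)
Definition poles x z : seq C :=
  [seq (1 - z) / (1 - z - x j) | j <- enum 'I_N]
  ++ [seq b k * (1 - z) / (1 - b k * z) | k <- enum 'I_K].

Lemma size_poles x z : size (poles x z) = (N + K)%N.
Proof. by rewrite /poles size_cat; congr (_ + _)%N; rewrite size_map size_enum_ord. Qed.

Lemma gfun_poles x h z : gfun b x h z = \prod_(a <- poles x z) (1 + h * a).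
Proof. by rewrite /poles big_cat /gfun; congr (_ * _); rewrite big_map big_enum. Qed.

Lemma gfun_elem_sym x h z : gfun b x h z = \sum_(m < (N + K).+1) elem_sym (poles x z) m * h ^+ m.
Proof.
rewrite gfun_poles -(size_poles x z) /elem_sym.
rewrite -(horner_coef_wide _ (size_elem_sym _)) horner_prod; apply: eq_bigr => a _.
by rewrite hornerD hornerC hornerZ hornerX mulrC.
Qed.

Lemma ccirc_elem_sym (I : Type) r m (F : I -> C -> C) (s : seq I) :
  (forall i, ccirc r (F i)) -> ccirc r (fun z => elem_sym [seq F i z | i <- s] m).
Proof.
move=> cF; elim: s m => [|i s IH] m; first exact: (ccirc_cst r (elem_sym [::] m)).
rewrite /=; under eq_fun do rewrite elem_sym_cons.
apply: ccircD; first exact: IH.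
case: m => [|m]; first exact: (ccirc_cst r 0).
by apply: ccircM.
Qed.

Definition pole x (i : 'I_N + 'I_K) z : C :=
  match i with
  | inl j => (1 - z) / (1 - z - x j)
  | inr k => b k * (1 - z) / (1 - b k * z)
  end.

Lemma polesE x z :
  poles x z = [seq pole x i z | i <- map inl (enum 'I_N) ++ map inr (enum 'I_K)].
Proof.
by rewrite map_cat /poles; congr (_ ++ _); elim: (enum _) => //= j s ->.
Qed.

Lemma ccirc_pole r x i : 0 < r < 1 -> (forall j, normc (1 - x j) < r) ->
  ccirc r (pole x i).
Proof.
by move=> /andP[r0 r1] xr; case: i => i;
  [apply: ccirc_xterm|apply: ccirc_bterm; rewrite ?r0].
Qed.

Lemma ccirc_elem_sym_poles r x m : 0 < r < 1 -> (forall i, normc (1 - x i) < r) ->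
  ccirc r (fun z => elem_sym (poles x z) m).
Proof.
move=> r01 xr; under eq_fun do rewrite polesE.
by apply: ccirc_elem_sym => i; exact: ccirc_pole.
Qed.

(** Comparing the coefficients of the powers of h in [numer_qsum_cmean]. *)
Lemma numer_binsum r x k : 0 < r < 1 -> (forall i, normc (1 - x i) < r) ->
  (k < N + K)%N ->
  numer u (binsum k) x =
  denom b x * cmean r (fun z => z / (z - 1) * elem_sym (poles x z) k.+1).
Proof.
move=> r01 xr kNK; have /andP[r0 r1] := r01.
pose p : {poly C} := \poly_(i < N + K) numer u (binsum i) x.
pose q : {poly C} := \poly_(i < (N + K).+1)
  (denom b x * cmean r (fun z => z / (z - 1) * elem_sym (poles x z) i)).
suff E : 'X * p = q.
  have := congr1 (fun p : {poly C} => p`_k.+1) E.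
  by rewrite coefXM /= !coef_poly kNK ltnS kNK.
apply: poly_eq_off0 => h h0; rewrite hornerM hornerX !horner_poly.
have -> : \sum_(i < N + K) numer u (binsum i) x * h ^+ i = numer u (qsum (1 + h)) x.
  rewrite /numer; under eq_bigr do rewrite mulr_suml.
  rewrite exchange_big /=; apply: eq_bigr => lam _.
  rewrite qsum_binsum [RHS]mulrAC [RHS]mulr_sumr; apply: eq_bigr => i _; ring.
rewrite (numer_qsum_cmean N0 b1 uP r01) // mulrCA mulVKf //.
have ce m : ccirc r (fun z => z / (z - 1) * elem_sym (poles x z) m).
  by apply: ccircM; [exact: ccirc_id_sub1|exact: ccirc_elem_sym_poles].
rewrite (@eq_cmean _ _ r0 _ (fun z => \sum_(m < (N + K).+1)
   h ^+ m * (z / (z - 1) * elem_sym (poles x z) m))); last first.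
  by move=> z zr; rewrite gfun_elem_sym mulr_sumr; apply: eq_bigr => m _; ring.
rewrite cmean_sum; last by move=> m _; apply: ccircM => //; exact: ccirc_cst.
by rewrite mulr_sumr; apply: eq_bigr => m _; rewrite cmeanZ //; ring.
Qed.

Variables (rho0 r : R).
Hypotheses (rho00 : 0 <= rho0) (rho0r : rho0 < r) (r1 : r < 1).

Let gap : R := (r - rho0) / 2.
Let r' : R := (rho0 + r) / 2.

(** Bounds all the factors on the circles of radius between r' and r. Since r'
    lies half-way between rho0 and r, the distance of these circles to the
    points 1 - x_i is at least gap, and their distance to 1 at least 1 - r. *)
Definition pole_bound : R := 2 / gap + 2 / (1 - r).

Let gap0 : 0 < gap. Proof. by rewrite divr_gt0 // subr_gt0. Qed.
Let r0 : 0 < r. Proof. exact: le_lt_trans rho0r. Qed.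
Let r'0 : 0 < r'. Proof. by rewrite divr_gt0 // ltr_wpDl. Qed.
Let r'r : r' < r. Proof. by rewrite /r'; move: rho0r; lra. Qed.
Let rho0r' : rho0 < r'. Proof. by rewrite /r'; move: rho0r; lra. Qed.
Let sub1r : 0 < 1 - r. Proof. by rewrite subr_gt0. Qed.

Lemma pole_bound_ge0 : 0 <= pole_bound.
Proof. by rewrite addr_ge0 // divr_ge0 // ltW. Qed.

Lemma normc_pole_le (s : R) x z a : gap <= s - rho0 -> s <= r ->
  (forall i, normc (1 - x i) <= rho0) -> normc z = s -> a \in poles x z ->
  normc a <= pole_bound.
Proof.
move=> gs sr xr zs.
have z2 : normc (1 - z) <= 2.
  apply: le_trans (normcD _ _) _; rewrite normcN zs normc1 (_ : 2 = 1 + 1) // lerD2l.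
  exact: le_trans (ltW r1).
rewrite mem_cat => /orP[] /mapP[j _ ->].
  have d : gap <= normc (1 - z - x j).
    rewrite (_ : _ - x j = 1 - x j - z); last by ring.
    rewrite normc_distC; apply: le_trans gs _; apply: le_trans (normc_ge_sub _ _).
    by rewrite zs lerB // xr.
  apply: (@le_trans _ _ (2 / gap)); last by rewrite lerDl divr_ge0 // ltW.
  rewrite normcM normcV ler_pM ?normc_ge0 ?invr_ge0 ?normc_ge0 //.
  by rewrite lef_pV2 ?posrE // (lt_le_trans gap0).
have d : 1 - r <= normc (1 - b j * z).
  apply: le_trans (normc_ge_sub _ _); rewrite normc1 lerB // normcM zs.
  by apply: le_trans sr; rewrite ler_piMl // -zs normc_ge0.
apply: (@le_trans _ _ (2 / (1 - r))); last by rewrite lerDr divr_ge0 // ltW.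
rewrite normcM normcV ler_pM ?normc_ge0 ?invr_ge0 ?normc_ge0 //.
  by rewrite normcM -[leRHS]mul1r ler_pM ?normc_ge0.
by rewrite lef_pV2 ?posrE // (lt_le_trans sub1r).
Qed.

Lemma normc_id_sub1 (s : R) z : 0 < s -> s <= r -> normc z = s ->
  normc (z / (z - 1)) <= (1 - r)^-1.
Proof.
move=> s0 sr zs; rewrite normcM normcV zs -[leRHS]mul1r.
have d : 1 - r <= normc (z - 1).
  rewrite normc_distC; apply: le_trans (normc_ge_sub _ _); by rewrite normc1 zs lerB.
rewrite ler_pM ?invr_ge0 ?normc_ge0 ?(ltW s0) ?(le_trans sr (ltW r1)) //.
by rewrite lef_pV2 ?posrE // (lt_le_trans sub1r).
Qed.

Section FixedPoint.
Variable x : 'I_N -> C.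
Hypotheses (xinj : injective x) (xr : forall i, normc (1 - x i) <= rho0).

Let r01 : 0 < r < 1. Proof. by rewrite r0 r1. Qed.
Let xltr i : normc (1 - x i) < r. Proof. exact: le_lt_trans rho0r. Qed.
Let xltr' i : normc (1 - x i) < r'. Proof. exact: le_lt_trans rho0r'. Qed.

Lemma denom_neq0 : denom b x != 0.
Proof.
rewrite mulf_neq0 ?altdet_staircase_neq0 //; apply/prodf_neq0 => i _.
by apply: factor_poly_neq0 => //; exact: lt_trans r1.
Qed.

Definition expect (phi : {ffun 'I_N -> 'I_K.+1} -> C) : C := numer u phi x / denom b x.

Lemma expect_lincomb n (c : 'I_n -> C) (F : 'I_n -> {ffun 'I_N -> 'I_K.+1} -> C) :
  expect (fun lam => \sum_i c i * F i lam) = \sum_i c i * expect (F i).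
Proof.
rewrite /expect /numer; under [RHS]eq_bigr do rewrite mulrA.
rewrite -mulr_suml; congr (_ / _); under [RHS]eq_bigr do rewrite mulr_sumr.
rewrite exchange_big /=; apply: eq_bigr => lam _.
by rewrite [LHS]mulrAC [LHS]mulr_sumr; apply: eq_bigr => i _; ring.
Qed.

Lemma eq_expect phi psi : (forall lam, phi lam = psi lam) -> expect phi = expect psi.
Proof. by move=> E; congr (_ / _); apply: eq_bigr => lam _; rewrite E. Qed.

(** There are N + K factors, all of size at most [pole_bound], so
    [elem_sym_power_sum] replaces the elementary symmetric function in
    [numer_binsum] by a power of their sum. *)
Lemma expect_binsum k : (k < N + K)%N ->
  normc (k.+1`!%:R * expect (binsum k)
     - cmean r (fun z => z / (z - 1) * (\sum_(a <- poles x z) a) ^+ k.+1))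
  <= 2 * ((1 - r)^-1 * (pole_bound ^+ k.+1 * (k.+1 ^ 2 * (N + K) ^ k)%N%:R)).
Proof.
move=> kNK; rewrite /expect (numer_binsum r01) // mulrAC mulfV ?denom_neq0 // mul1r.
have cpow : ccirc r (fun z => (\sum_(a <- poles x z) a) ^+ k.+1).
  apply: ccircX; under eq_fun do rewrite polesE big_map.
  by apply: ccirc_sum => i _; apply: ccirc_pole.
have cid : ccirc r (fun z => z / (z - 1)) by apply: ccirc_id_sub1; rewrite r0 r1.
have ce : ccirc r (fun z => elem_sym (poles x z) k.+1).
  by apply: ccirc_elem_sym_poles => //; rewrite r0 r1.
have c1 : ccirc r (fun z => z / (z - 1) * elem_sym (poles x z) k.+1) by exact: ccircM.
have c2 : ccirc r (fun z => k.+1`!%:R * (z / (z - 1) * elem_sym (poles x z) k.+1)).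
  by apply: ccircM => //; exact: ccirc_cst.
have c3 : ccirc r (fun z => z / (z - 1) * (\sum_(a <- poles x z) a) ^+ k.+1) by exact: ccircM.
rewrite -cmeanZ // -cmeanB //.
rewrite (@eq_cmean _ _ r0 _ (fun z => z / (z - 1) *
   - ((\sum_(a <- poles x z) a) ^+ k.+1 - k.+1`!%:R * elem_sym (poles x z) k.+1))); last first.
  by move=> z _; ring.
apply: cmean_le => //.
  apply: ccircM => //; apply: ccircN; apply: ccircB => //.
  by apply: ccircM => //; exact: ccirc_cst.
move=> z zr; rewrite normcM normcN ler_pM ?normc_ge0 ?(normc_id_sub1 _ (lexx r)) //.
apply: le_trans (elem_sym_power_sum (A := pole_bound) k.+1 pole_bound_ge0 _) _.
  move=> a; apply: (@normc_pole_le r) => //; rewrite /gap; move: rho0r; lra.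
rewrite ler_wpM2l ?exprn_ge0 ?pole_bound_ge0 // size_poles lerBlDl -natrX -natrD ler_nat.
exact: expn_le_ffact.
Qed.

Let Eg : R := expR (pole_bound * (gap / 4)).

(** At |h| of order 1 / (N + K) the product of N + K factors 1 + h a stays
    bounded by an exponential. *)
Lemma gfun_le (s : R) h z : gap <= s - rho0 -> s <= r -> normc z = s ->
  normc h = gap / 4 / (N + K)%:R -> normc (gfun b x h z) <= Eg.
Proof.
move=> gs sr zs hh; rewrite gfun_poles normc_prod.
have NK0 : 0 < (N + K)%:R :> R by rewrite ltr0n addn_gt0 N0.
have -> : Eg = \prod_(a <- poles x z) expR (pole_bound * normc h).
  rewrite big_const_seq count_predT size_poles iter_mulr mulr1 -expRM_natl.
  rewrite hh (_ : _ * (_ * _) = pole_bound * (gap / 4) * ((N + K)%:R / (N + K)%:R)).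
    by rewrite divff ?mulr1 // gt_eqF.
  by ring.
rewrite big_seq [leRHS]big_seq; apply: ler_prod => a az; rewrite normc_ge0 /=.
apply: le_trans (expR_ge1Dx _); apply: le_trans (normcD _ _) _.
rewrite normc1 lerD2l normcM mulrC ler_wpM2r ?normc_ge0 //.
exact: (normc_pole_le gs sr xr zs az).
Qed.

Let cross_bound : R := 4 / (gap / 2) ^+ 2.

Definition two_point_bound : R :=
  2 * ((1 - r)^-1 * Eg * (2 * ((1 - r)^-1 * Eg * cross_bound))).

(** The coefficients of h1 ^+ k1 * h2 ^+ k2 of the connected two-point function
    are extracted by Cauchy's estimates on circles of radius of order 1 / (N +
    K), where its integrand is bounded independently of N and K. *)
Lemma expect_cov k1 k2 : (k1 < N + K)%N -> (k2 < N + K)%N ->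
  normc (expect (fun lam => binsum k2 lam * binsum k1 lam)
     - expect (binsum k1) * expect (binsum k2))
  <= 2 * (2 * (two_point_bound / (gap / 4 / (N + K)%:R) ^+ k1)
          / (gap / 4 / (N + K)%:R) ^+ k2).
Proof.
move=> k1n k2n; set rho := gap / 4 / _.
have NK1 : 1 <= (N + K)%:R :> R by rewrite ler1n addn_gt0 N0.
have NK0 : 0 < (N + K)%:R :> R by rewrite (lt_le_trans ltr01).
have rho_gt0 : 0 < rho by rewrite divr_gt0 // divr_gt0.
have rho_le : rho <= gap / 4.
  by rewrite /rho ler_pdivrMr // ler_peMr // divr_ge0 // ltW.
have gapE : gap = r - r' by rewrite /gap /r'; field.
have r'1 : r' < 1 by exact: lt_trans r1.
pose c i j := expect (fun lam => binsum j lam * binsum i lam)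
     - expect (binsum i) * expect (binsum j).
apply: (@cauchy_estimate2 _ rho _ (N + K) c) => // h1 h2 h1r h2r.
have h1r' : (1 + normc h1) * r' < r - normc h1.
  rewrite h1r; apply: (@le_lt_trans _ _ (r' + rho)).
    by rewrite mulrDl mul1r lerD2l ler_piMr // ltW.
  by move: rho_le gap0; rewrite gapE; lra.
have h2r' : r' < r - 2 * normc h2.
  by rewrite h2r; move: rho_le gap0; rewrite gapE; lra.
have h0 h : normc h = rho -> h != 0 by move=> E; rewrite -normc_gt0 E.
have xh i : normc (1 - (1 + h1) * x i) < r.
  rewrite (_ : _ - _ = (1 - x i) - h1 * x i); last by ring.
  apply: le_lt_trans (normcD _ _) _; rewrite normcN normcM h1r.
  have x2 : normc (x i) <= 2.
    rewrite -[x i](subKr 1); apply: le_trans (normcD _ _) _.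
    rewrite normcN normc1 (_ : 2 = 1 + 1) // lerD2l ltW // (lt_trans (xltr i)) //.
  have : rho * normc (x i) <= gap / 4 * 2 by rewrite ler_pM ?normc_ge0 // ltW.
  by have := xr i; move: gap0; rewrite /gap; lra.
have D0 := denom_neq0.
have := numer_qsum_pair_cmean N0 b1 uP r'0 r1 h1r' h2r' xinj xltr' xh (h0 _ h1r) (h0 _ h2r).
set M := cmean r _ => E2.
have sumE h : expect (qsum (1 + h)) = \sum_(i < N + K) h ^+ i * expect (binsum i).
  rewrite -expect_lincomb; apply: eq_expect => lam.
  by rewrite qsum_binsum; apply: eq_bigr => i _; rewrite mulrC.
have sumE2 : expect (fun lam => qsum (1 + h2) lam * qsum (1 + h1) lam) =
    \sum_(i < N + K) h1 ^+ i * \sum_(j < N + K) h2 ^+ j *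
       expect (fun lam => binsum j lam * binsum i lam).
  under [RHS]eq_bigr do rewrite -expect_lincomb.
  rewrite -expect_lincomb; apply: eq_expect => lam.
  rewrite !qsum_binsum [LHS]mulrC [LHS]mulr_suml; apply: eq_bigr => i _.
  rewrite mulrAC [RHS]mulrC; congr (_ * _); rewrite [LHS]mulr_sumr.
  by apply: eq_bigr => j _; ring.
have -> : \sum_(i < N + K) \sum_(j < N + K) c i j * (h1 ^+ i * h2 ^+ j) = M.
  transitivity (expect (fun lam => qsum (1 + h2) lam * qsum (1 + h1) lam)
     - expect (qsum (1 + h1)) * expect (qsum (1 + h2))).
    rewrite sumE2 !sumE mulr_suml -sumrB; apply: eq_bigr => i _.
    rewrite [X in _ - X]mulr_sumr mulr_sumr -sumrB; apply: eq_bigr => j _.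
    by rewrite /c; ring.
  rewrite /expect E2; move: (M) (denom b x) D0 (numer u _ x) (numer u _ x).
  by move=> M' D D0' n1 n2; field.
have gap2 : 0 < gap / 2 by rewrite divr_gt0.
have cb z v : normc z = r -> normc v = r' -> normc (cross h1 h2 (1 - z) (1 - v)) <= cross_bound.
  move=> zr vr.
  have vr' : normc v <= r' by rewrite vr.
  have d1 : gap / 2 <= normc (1 - z - (1 + h1) * (1 - v)).
    apply: le_trans (cross_den1 h1 zr vr'); rewrite h1r mulrDl mul1r.
    have : rho * r' <= rho by rewrite ler_piMr // ltW.
    by move: rho_le gap0; rewrite gapE; lra.
  have d2 : gap / 2 <= normc ((1 + h2) * (1 - z) - (1 - v)).
    apply: le_trans (cross_den2 h2 r1 zr vr'); rewrite h2r.
    by move: rho_le gap0; rewrite gapE; lra.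
  rewrite /cross /cross_bound normcM normcV !normcM (_ : 4 = 2 * 2); last by ring.
  have n2 y (q : R) : q <= 1 -> normc y = q -> normc (1 - y) <= 2.
    move=> q1 yq; apply: le_trans (normcD _ _) _.
    by rewrite normcN normc1 yq (_ : 2 = 1 + 1) // lerD2l.
  apply: ler_pM.
  - by rewrite mulr_ge0 ?normc_ge0.
  - by rewrite invr_ge0 mulr_ge0 ?normc_ge0.
  - by apply: ler_pM; rewrite ?normc_ge0 //; [apply: (n2 _ r)|apply: (n2 _ r')] => //; exact: ltW.
  - rewrite lef_pV2 ?posrE; last exact: exprn_gt0.
      by rewrite expr2; apply: ler_pM => //; exact: ltW.
    by rewrite mulr_gt0 // (lt_le_trans gap2).
have cgap' : gap <= r' - rho0 by rewrite /gap /r'; move: rho0r; lra.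
have cgap : gap <= r - rho0 by rewrite /gap; move: rho0r; lra.
have r'01 : 0 < r' < 1 by rewrite r'0.
have Eg0 : 0 <= Eg by exact: expR_ge0.
have V0 : 0 <= (1 - r)^-1 by rewrite invr_ge0 ltW.
have cG (s : R) h : 0 < s < 1 -> (forall i, normc (1 - x i) < s) ->
    ccirc s (fun z => z / (z - 1) * gfun b x h z).
  by move=> s01 xs; apply: ccircM; [exact: ccirc_id_sub1|exact: ccirc_gfun].
have ccr (v : C) : normc v <= r' -> ccirc r (fun z => cross h1 h2 (1 - z) (1 - v)).
  by move=> vr; exact: (ccirc_cross r1 h1r' h2r' r0 vr).
rewrite /two_point_bound /M; apply: cmean_le => //.
  apply: ccircM; first exact: cG.
  (* As a finite sum of residues the inner mean is continuous in z. *)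
  apply: (@eq_ccirc _ _ r0 (fun z => h1 * \sum_i weight b x (1 + h1) i *
     cross h1 h2 (1 - z) (1 - (1 - x i)))).
    move=> z zr; have := weight_residue N0 b1 r'01 xinj xltr' (h0 _ h1r) (holo_cross r'0 r1 h1r' h2r' zr).
    by move=> ->; rewrite mulVKf // h0.
  apply: ccircM; first exact: ccirc_cst.
  apply: ccirc_sum => i _; apply: ccircM; first exact: ccirc_cst.
  by apply: ccr; exact: ltW.
move=> z zr; rewrite normcM ler_pM ?normc_ge0 //.
  rewrite normcM ler_pM ?normc_ge0 ?(normc_id_sub1 r0) //.
  exact: (gfun_le cgap).
apply: cmean_le => //.
  apply: ccircM; first exact: cG.
  by apply: holo_ccirc => //; exact: (holo_cross r'0 r1 h1r' h2r' zr).
move=> v vr; rewrite normcM ler_pM ?normc_ge0 ?cb //.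
rewrite normcM ler_pM ?normc_ge0 ?(normc_id_sub1 r'0 (ltW r'r)) //.
by apply: (gfun_le cgap') => //; exact: ltW.
Qed.

End FixedPoint.

End BinomialMoments.

(** * The Schur measure with distinct weights *)

Section DistinctWeights.
Variable R : realType.
Local Notation C := R[i].
Variables (N K : nat) (x : 'I_N -> R) (beta : 'I_K -> R).
Hypotheses (x0 : forall i, 0 < x i) (xinj : injective x).
Hypotheses (beta01 : forall k, 0 < beta k < 1) (betainj : injective beta).
Local Notation part := {ffun 'I_N -> 'I_K.+1}.
Local Notation nparts lam := (fun i : 'I_N => nat_of_ord (fun_of_fin lam i)).
Implicit Types (lam : part).

Definition wt (beta : 'I_K -> R) k : R := beta k / (1 - beta k).

Definition schur_weight lam : R :=
  (\prod_i \prod_k (1 + wt beta k * x i)^-1)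
  * schur (nparts lam) x * schur (conj_part (nparts lam)) (wt beta).

Lemma wt_gt0 k : 0 < wt beta k.
Proof. by have /andP[b0 b1] := beta01 k; rewrite divr_gt0 // subr_gt0. Qed.

Lemma wt_inj : injective (wt beta).
Proof.
move=> k l E; apply: betainj.
have bn j : 1 - beta j != 0 by have /andP[_ b1] := beta01 j; rewrite gt_eqF // subr_gt0.
have : wt beta k * ((1 - beta k) * (1 - beta l)) = wt beta l * ((1 - beta k) * (1 - beta l)).
  by rewrite E.
rewrite /wt mulrA divfK // [(1 - beta k) * _]mulrC mulrA divfK // !mulrBr !mulr1 [beta l * _]mulrC.
by move/addIr.
Qed.

(** The two alternants in the bialternant formula have the same sign. *)
Lemma schur_ge0 n (lam : 'I_n -> nat) (a : 'I_n -> R) :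
  (forall i, 0 < a i) -> injective a ->
  (forall i j : 'I_n, (i <= j)%N -> (lam j <= lam i)%N) -> 0 <= schur lam a.
Proof.
move=> a0 ainj lamP; have V0 := altdet_staircase_neq0 ainj.
have : 0 <= schur lam a * altdet a (@staircase n) ^+ 2.
  rewrite expr2 mulrA schurM; apply: altdet_mul_staircase_ge0 => // i j ij.
  by have := lamP i j (ltnW ij); rewrite /particle /staircase; have := ltn_ord j; lia.
by rewrite pmulr_lge0 // lt_def sqr_ge0 sqrf_eq0 V0.
Qed.

Lemma schur_weight_ge0_distinct lam : is_part lam -> 0 <= schur_weight lam.
Proof.
move=> lamP; rewrite /schur_weight !mulr_ge0 //.
- apply: prodr_ge0 => i _; apply: prodr_ge0 => k _.
  by rewrite invr_ge0 addr_ge0 // mulr_ge0 // ltW // wt_gt0.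
- by apply: schur_ge0 => //; exact/is_partP.
- apply: schur_ge0 => [k||i j ij]; [exact: wt_gt0|exact: wt_inj|].
  exact: conj_part_mono.
Qed.

Let xC i : C := (x i)%:C.
Let bC k : C := (beta k)%:C.

(** The factor of the Schur weight that depends on beta only, normalized as in
    [factor_poly]. *)
Definition schur_coef lam : C :=
  (schur (conj_part (nparts lam)) (wt beta))%:C * \prod_(i < N) \prod_k (1 - bC k).

Lemma altdetC n (a : 'I_n -> R) l : altdet (fun i => (a i)%:C : C) l = (altdet a l)%:C.
Proof.
rewrite /altdet -det_map_mx; congr determinant; apply/matrixP => i j.
by rewrite !mxE rmorphXn.
Qed.

Lemma sub_bC_neq0 k : 1 - bC k != 0.
Proof.
have /andP[_ b1] := beta01 k.
by rewrite -[1]/(1%:C) -rmorphB /= -normc_gt0 normcR normr_gt0 subr_eq0 gt_eqF.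
Qed.

Lemma schur_coefP (z : 'I_N -> C) :
  \sum_(lam | is_part lam) schur_coef lam * altdet z (particle (nparts lam)) =
  altdet z (@staircase N) * \prod_i factor_poly bC (z i).
Proof.
have V0 : altdet (fun k => (wt beta k)%:C : C) (@staircase K) != 0.
  apply: altdet_staircase_neq0 => k l /(@complexI _); exact: wt_inj.
have w0 k : (wt beta k)%:C != 0 :> C by rewrite -normc_gt0 normcR normr_gt0 gt_eqF // wt_gt0.
apply: (mulfI V0).
have PQ : (\prod_(i < N) \prod_(k < K) (1 + (wt beta k)%:C * z i))
    * (\prod_(i < N) \prod_k (1 - bC k)) = \prod_i factor_poly bC (z i).
  rewrite -big_split /=; apply: eq_bigr => i _; rewrite -big_split /=.
  apply: eq_bigr => k _; rewrite /wt rmorphM /= fmorphV rmorphB rmorph1 -/(bC k).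
  by field; exact: sub_bC_neq0.
rewrite -PQ [RHS]mulrA [RHS]mulrA -(dual_cauchy z w0).
rewrite [LHS]mulr_sumr [RHS]mulr_suml; apply: eq_bigr => lam lamP.
have -> : altdet (fun k => (wt beta k)%:C : C) (fun j => (conj_part (nparts lam) j + staircase j)%N)
    = altdet (fun k => (wt beta k)%:C : C) (@staircase K)
      * (schur (conj_part (nparts lam)) (wt beta))%:C.
  by rewrite !altdetC -rmorphM mulrC schurM.
by rewrite /schur_coef; ring.
Qed.

Lemma schur_weight_expect (phi : part -> C) :
  expect bC schur_coef xC phi =
  \sum_(lam | is_part lam) (schur_weight lam)%:C * phi lam.
Proof.
have V0 : altdet xC (@staircase N) != 0.
  by apply: altdet_staircase_neq0 => i j /(@complexI _); exact: xinj.
have P0 : \prod_(i < N) \prod_k (1 - bC k) != 0.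
  by apply/prodf_neq0 => i _; apply/prodf_neq0 => k _; exact: sub_bC_neq0.
have D1 i k : 1 + (wt beta k)%:C * xC i != 0.
  rewrite -[1]/(1%:C) -rmorphM -rmorphD /= -normc_gt0 normcR normr_gt0 gt_eqF //.
  by rewrite addr_gt0 // mulr_gt0 // wt_gt0.
have Fx : \prod_i factor_poly bC (xC i) =
   (\prod_(i < N) \prod_k (1 - bC k)) * \prod_i \prod_k (1 + (wt beta k)%:C * xC i).
  rewrite -big_split /=; apply: eq_bigr => i _; rewrite -big_split /=.
  apply: eq_bigr => k _; rewrite /wt rmorphM /= fmorphV rmorphB rmorph1 -/(bC k).
  by field; exact: sub_bC_neq0.
have Q0 : \prod_i \prod_k (1 + (wt beta k)%:C * xC i) != 0.
  by apply/prodf_neq0 => i _; apply/prodf_neq0 => k _.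
rewrite /expect /numer mulr_suml; apply: eq_bigr => lam lamP.
rewrite /denom Fx altdetC -schurM rmorphM /= -altdetC /schur_weight !rmorphM /=.
rewrite rmorph_prod [in RHS](eq_bigr (fun i => (\prod_k (1 + (wt beta k)%:C * xC i))^-1)); last first.
  move=> i _; rewrite rmorph_prod -prodfV; apply: eq_bigr => k _.
  by rewrite fmorphV rmorphD rmorph1 rmorphM.
rewrite prodfV /schur_coef; move: V0 P0 Q0; rewrite -/xC.
move: (altdet _ _) (\prod_(i < N) \prod_k (1 - bC k)) (\prod_i _) (_%:C) (_%:C) (phi lam).
by move=> V P Q s1 s2 f V0 P0 Q0; field; rewrite V0 P0 Q0.
Qed.

(** The dual Cauchy identity divided by its right-hand side. *)
Lemma schur_weight_sum1_distinct : (forall i, x i < 2) -> \sum_(lam | is_part lam) schur_weight lam = 1.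
Proof.
move=> x2; apply: (@complexI R); rewrite rmorph_sum rmorph1.
transitivity (\sum_(lam | is_part lam) (schur_weight lam)%:C * 1 : C).
  by apply: eq_bigr => lam _; rewrite mulr1.
rewrite -(schur_weight_expect (fun=> 1)) /expect (numer1 schur_coefP).
rewrite divff // /denom mulf_neq0 //.
  by apply: altdet_staircase_neq0 => i j /(@complexI _); exact: xinj.
apply/prodf_neq0 => i _; apply: factor_poly_neq0 => [k|].
  by rewrite normcR; have /andP[b0 b1] := beta01 k; rewrite gtr0_norm // ltW.
rewrite -[1]/(1%:C) -rmorphB normcR ltr_norml.
by have := x0 i; have := x2 i; lra.
Qed.

End DistinctWeights.

(** * Concentration of the particle moments *)

Section Concentration.
Variable R : realType.
Local Notation C := R[i].

Lemma normc_subXX (a b : C) (B : R) m : normc a <= B -> normc b <= B ->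
  normc (a ^+ m.+1 - b ^+ m.+1) <= m.+1%:R * B ^+ m * normc (a - b).
Proof.
move=> aB bB; have B0 := le_trans (normc_ge0 _) aB.
elim: m => [|m IH]; first by rewrite !expr1 expr0 mulr1 mul1r.
rewrite (_ : _ - _ = a * (a ^+ m.+1 - b ^+ m.+1) + (a - b) * b ^+ m.+1); last first.
  by rewrite [a ^+ m.+2]exprS [b ^+ m.+2]exprS; ring.
apply: le_trans (normcD _ _) _; rewrite (_ : m.+2%:R = m.+1%:R + 1); last by rewrite natr1.
rewrite (_ : (m.+1%:R + 1) * _ * _ = m.+1%:R * B ^+ m.+1 * normc (a - b)
   + B ^+ m.+1 * normc (a - b)); last by ring.
rewrite !normcM normcX; apply: lerD; last first.
  by rewrite mulrC ler_wpM2r ?normc_ge0 // lerXn2r ?nnegrE ?normc_ge0.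
rewrite (_ : _ * _ * _ = B * (m.+1%:R * B ^+ m * normc (a - b))); last by rewrite exprS; ring.
by rewrite ler_pM ?normc_ge0.
Qed.

Lemma normc_sqr_add3 (a b c : C) :
  normc (a + b + c) ^+ 2 <= 3 * (normc a ^+ 2 + normc b ^+ 2 + normc c ^+ 2).
Proof.
have h : normc (a + b + c) <= normc a + normc b + normc c.
  by apply: le_trans (normcD _ _) _; rewrite lerD2r normcD.
apply: (@le_trans _ _ ((normc a + normc b + normc c) ^+ 2)).
  by rewrite lerXn2r ?nnegrE ?addr_ge0 ?normc_ge0.
move: (normc a) (normc b) (normc c) => p q s.
rewrite -subr_ge0 (_ : _ - _ = (p - q) ^+ 2 + (q - s) ^+ 2 + (p - s) ^+ 2); last by ring.
by rewrite !addr_ge0 ?sqr_ge0.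
Qed.

Section FiniteMean.
Variables (I : finType) (P : pred I) (rho : I -> R).
Hypotheses (rho0 : forall i, P i -> 0 <= rho i) (rho1 : \sum_(i | P i) rho i = 1).

Lemma wmean_variance (Y : I -> R) :
  \sum_(i | P i) rho i * (Y i - \sum_(j | P j) rho j * Y j) ^+ 2 =
  \sum_(i | P i) rho i * Y i ^+ 2 - (\sum_(j | P j) rho j * Y j) ^+ 2.
Proof.
set m := \sum_(j | P j) rho j * Y j.
transitivity (\sum_(i | P i) (rho i * Y i ^+ 2 + (- 2 * m) * (rho i * Y i) + m ^+ 2 * rho i)).
  by apply: eq_bigr => i _; ring.
rewrite !big_split /= -!mulr_sumr -/m rho1; ring.
Qed.

(** First moments are controlled by second moments without square roots. *)
Lemma wmean_abs_le (Z : I -> R) (t B : R) : 0 < t -> (forall i, P i -> 0 <= Z i) ->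
  \sum_(i | P i) rho i * Z i ^+ 2 <= B * t ^+ 2 ->
  \sum_(i | P i) rho i * Z i <= (1 + B) * t.
Proof.
move=> t0 Z0 HB.
apply: (@le_trans _ _ (\sum_(i | P i) (t * rho i + t^-1 * (rho i * Z i ^+ 2)))).
  apply: ler_sum => i Pi; rewrite -subr_ge0.
  rewrite (_ : _ - _ = rho i * (t^-1 * ((Z i - t / 2) ^+ 2 + 3 / 4 * t ^+ 2))); last first.
    by field; rewrite gt_eqF.
  apply: mulr_ge0; first exact: rho0.
  apply: mulr_ge0; first by rewrite invr_ge0 ltW.
  by rewrite addr_ge0 ?sqr_ge0 // mulr_ge0 ?sqr_ge0 // divr_ge0.
rewrite big_split /= -!mulr_sumr rho1 mulr1 mulrDl mul1r lerD2l.
by rewrite ler_pdivrMl // mulrCA mulrC [_ * t]mulrC -expr2 mulrC.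
Qed.

Lemma wmean_le (Z W : I -> R) : (forall i, P i -> Z i <= W i) ->
  \sum_(i | P i) rho i * Z i <= \sum_(i | P i) rho i * W i.
Proof. by move=> ZW; apply: ler_sum => i Pi; rewrite ler_wpM2l ?rho0 ?ZW. Qed.

Lemma wmean_cst (c : R) : \sum_(i | P i) rho i * c = c.
Proof. by rewrite -mulr_suml rho1 mul1r. Qed.

Lemma normc_wmean_sub (F : I -> R) (m : C) :
  normc ((\sum_(i | P i) rho i * F i)%:C - m) <=
  \sum_(i | P i) rho i * normc ((F i)%:C - m).
Proof.
have -> : (\sum_(i | P i) rho i * F i)%:C - m =
    \sum_(i | P i) (rho i)%:C * ((F i)%:C - m).
  under [RHS]eq_bigr do rewrite mulrBr.
  rewrite sumrB -mulr_suml -rmorph_sum rho1 rmorph1 mul1r rmorph_sum; congr (_ - _).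
  by apply: eq_bigr => i _; rewrite rmorphM.
apply: le_trans (normc_sum _ _ _) _; apply: ler_sum => i Pi.
by rewrite normcM normcR ger0_norm ?rho0.
Qed.

End FiniteMean.

(** Replaces the factors one at a time. *)
Lemma prod_sub_le n (f g : 'I_n -> C) (B : R) : 1 <= B ->
  (forall j, normc (f j) <= B) -> (forall j, normc (g j) <= B) ->
  normc (\prod_j f j - \prod_j g j) <= B ^+ n * \sum_j normc (f j - g j).
Proof.
move=> B1 fB gB; have B0 : 0 <= B by exact: le_trans B1.
elim: n f g fB gB => [|n IH] f g fB gB.
  by rewrite !big_ord0 subrr normc0 mulr0.
rewrite !big_ord_recl.
set F := \prod_(i < n) _; set G := \prod_(i < n) _; set S := \sum_(i < n) _.
have FG : normc (F - G) <= B ^+ n * S by apply: IH.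
have GB : normc G <= B ^+ n.
  rewrite /G normc_prod -[n in B ^+ n]card_ord -prodr_const.
  by apply: ler_prod => i _; rewrite normc_ge0 gB.
rewrite (_ : _ - _ = f ord0 * (F - G) + (f ord0 - g ord0) * G); last by ring.
apply: le_trans (normcD _ _) _; rewrite [leRHS]mulrDr [leRHS]addrC; apply: lerD.
  by rewrite normcM exprS -mulrA ler_pM ?normc_ge0.
rewrite normcM mulrC ler_wpM2r ?normc_ge0 //; apply: le_trans GB _.
by rewrite exprS ler_peMl // exprn_ge0.
Qed.

End Concentration.

Lemma pred_power_le (R : realType) (l D n : R) k : 0 <= l -> l <= D * n -> 1 <= D -> 0 < n ->
  k%:R ^+ 2 * l ^+ k.-1 <= k%:R ^+ 2 * D ^+ k / n * n ^+ k.
Proof.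
move=> l0 lD D1 n0; have D0 : 0 <= D by exact: le_trans D1.
case: k => [|k]; first by rewrite expr0n /= !mul0r.
move: (_ ^+ 2) (sqr_ge0 (k.+1%:R : R)) => c c0; rewrite -!mulrA ler_wpM2l //.
rewrite /= [n ^+ _]exprS mulKf ?gt_eqF //; apply: (@le_trans _ _ (D ^+ k * n ^+ k)).
  by rewrite -exprMn lerXn2r // nnegrE // mulr_ge0 // ltW.
by rewrite ler_wpM2r ?exprn_ge0 ?(ltW n0) // exprS ler_peMl // exprn_ge0.
Qed.

Section MomentConcentration.
Variables (R : realType) (rho0 r D B : R) (k : nat).
Hypotheses (rho00 : 0 <= rho0) (rho0r : rho0 < r) (r1 : r < 1) (D1 : 1 <= D) (B0 : 0 <= B).
Local Notation C := R[i].

Let A : R := pole_bound rho0 r.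

Definition power_bound : R := B + A * D.

(** The four constants bound, in this order: the passage from powers to falling
    factorials, the variance, the error in the mean, and its dependence on the
    limiting function. *)
Definition const_ffact : R := k%:R ^+ 2 * D ^+ k.
Definition const_var : R :=
  k`!%:R ^+ 2 * (2 * (2 * two_point_bound rho0 r)) * D ^+ (2 * k)
  / ((r - rho0) / 2 / 4) ^+ (2 * k).
Definition const_mean : R := 2 * (1 - r)^-1 * A ^+ k.+1 * k.+1%:R * D ^+ k.
Definition const_fun : R := 2 * (1 - r)^-1 * power_bound ^+ k.

Variables (N K : nat) (x : 'I_N -> R) (beta : 'I_K -> R).
Hypotheses (N0 : (0 < N)%N) (kN : (k < N + K)%N) (NKD : (N + K)%:R <= D * N%:R).
Hypotheses (xr : forall i, `|1 - x i| <= rho0) (xinj : injective x).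
Hypotheses (beta01 : forall j, 0 < beta j < 1) (betainj : injective beta).
Variables (G : C -> C) (s : R).
Hypotheses (Gc : ccirc r G) (GB : forall z, normc z = r -> normc (G z) <= B).

Let xC i : C := (x i)%:C.
Let bC j : C := (beta j)%:C.

Hypothesis (Gs : forall z, normc z = r ->
  normc (N%:R^-1 * (\sum_(a <- poles bC xC z) a) - G z) <= s).

Local Notation part := {ffun 'I_N -> 'I_K.+1}.
Local Notation nparts lam := (fun i : 'I_N => nat_of_ord (fun_of_fin lam i)).
Local Notation rho := (schur_weight x beta).

Let NR : 0 < N%:R :> R. Proof. by rewrite ltr0n. Qed.
Let A0 : 0 <= A. Proof. exact: pole_bound_ge0. Qed.
Let D0 : 0 <= D. Proof. exact: le_trans D1. Qed.
Let V0 : 0 <= (1 - r)^-1. Proof. by rewrite invr_ge0 subr_ge0 ltW. Qed.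
Let r0 : 0 < r. Proof. exact: le_lt_trans rho0r. Qed.

Let x0 i : 0 < x i.
Proof. by have := xr i; rewrite ler_norml; move: rho0r r1; lra. Qed.
Let x2 i : x i < 2.
Proof. by have := xr i; rewrite ler_norml; move: rho0r r1; lra. Qed.

Let rho_ge0 (lam : part) : is_part lam -> 0 <= rho lam.
Proof. by move=> lamP; apply: schur_weight_ge0_distinct. Qed.
Let rho_sum : \sum_(lam | is_part lam) rho lam = 1.
Proof. exact: schur_weight_sum1_distinct. Qed.

Let xCinj : injective xC. Proof. by move=> i j /(@complexI _); exact: xinj. Qed.
Let xCr i : normc (1 - xC i) <= rho0.
Proof. by rewrite -[1]/(1%:C) -rmorphB normcR. Qed.
Let bC1 j : normc (bC j) <= 1.
Proof. by rewrite normcR; have /andP[b0 b1] := beta01 j; rewrite gtr0_norm // ltW. Qed.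

Let Y (lam : part) : R := N%:R^-1 * \sum_i ((particle (nparts lam) i) ^_ k)%N%:R / N%:R ^+ k.
Let EY : R := \sum_(lam | is_part lam) rho lam * Y lam.

Let Yfactor : R := k`!%:R / N%:R ^+ k.+1.

Lemma Y_binsum (lam : part) : (Y lam)%:C = Yfactor%:C * binsum R k lam.
Proof.
rewrite /Y /binsum rmorphM rmorph_sum !mulr_sumr; apply: eq_bigr => i _.
rewrite -bin_ffact natrM /Yfactor -(rmorph_nat (real_complex R) 'C(_, _)) -!rmorphM.
by congr (_%:C); rewrite exprS invfM; ring.
Qed.

Lemma EY_expect : EY%:C = Yfactor%:C * expect bC (@schur_coef R N K beta) xC (binsum R k).
Proof.
rewrite /EY (schur_weight_expect x0) // mulr_sumr rmorph_sum; apply: eq_bigr => lam _.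
by rewrite [LHS]rmorphM /= Y_binsum; ring.
Qed.

(** Each particle is at most D N, so exchanging a power for a falling factorial
    costs an error of order 1 / N. *)
Lemma particle_moment_Y (lam : part) :
  `|particle_moment R k (nparts lam) - Y lam| <= const_ffact / N%:R.
Proof.
rewrite /particle_moment /Y -mulrBr -sumrB normrM gtr0_norm ?invr_gt0 //.
have term i : `|((particle (nparts lam) i)%:R / N%:R) ^+ k
     - ((particle (nparts lam) i) ^_ k)%N%:R / N%:R ^+ k| <= const_ffact / N%:R.
  set l := particle _ i; have lN : (l < N + K)%N by exact: particle_lt.
  have lD : l%:R <= D * N%:R :> R by apply: le_trans NKD; rewrite ler_nat ltnW.
  rewrite expr_div_n -mulrBl ger0_norm; last first.
    by rewrite divr_ge0 ?exprn_ge0 ?ler0n // subr_ge0 -natrX ler_nat ffact_leq_expn.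
  have := expn_le_ffact l k; rewrite -(ler_nat R) natrD natrM !natrX => H.
  rewrite /const_ffact ler_pdivrMr ?exprn_gt0 //.
  apply: (@le_trans _ _ (k%:R ^+ 2 * l%:R ^+ k.-1)); first by rewrite lerBlDl.
  exact: pred_power_le.
rewrite ler_pdivrMl //; apply: le_trans (ler_norm_sum _ _ _) _.
apply: (@le_trans _ _ (\sum_(i < N) const_ffact / N%:R)); first by apply: ler_sum => i _; exact: term.
by rewrite sumr_const card_ord mulr_natl.
Qed.

Lemma particle_moment_le (lam : part) : `|particle_moment R k (nparts lam)| <= D ^+ k.
Proof.
rewrite /particle_moment normrM gtr0_norm ?invr_gt0 //.
rewrite ler_pdivrMl //; apply: le_trans (ler_norm_sum _ _ _) _.
apply: (@le_trans _ _ (\sum_(i < N) D ^+ k)); last first.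
  by rewrite sumr_const card_ord mulr_natl.
apply: ler_sum => i _; rewrite normrX lerXn2r ?nnegrE ?normr_ge0 //.
rewrite ger0_norm ?divr_ge0 ?ler0n // ler_pdivrMr //; apply: le_trans NKD.
by rewrite ler_nat ltnW // particle_lt.
Qed.

Let limit_value : C := k.+1%:R^-1 * cmean r (fun z => z / (z - 1) * G z ^+ k.+1).

Let powersum_le z : normc z = r ->
  normc (N%:R^-1 * (\sum_(a <- poles bC xC z) a)) <= A * D.
Proof.
move=> zr; rewrite normcM normcV normc_nat ler_pdivrMl //.
apply: (@le_trans _ _ ((N + K)%:R * A)).
  rewrite -(size_poles bC xC z); apply: normc_sum_le => a az.
  apply: (normc_pole_le bC1 rho0r r1 _ (lexx r) xCr zr az).
  by move: rho0r; lra.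
by rewrite mulrC mulrCA ler_wpM2l // [leRHS]mulrC.
Qed.

Let cpow : ccirc r (fun z => (N%:R^-1 * \sum_(a <- poles bC xC z) a) ^+ k.+1).
Proof.
apply: ccircX; apply: ccircM; first exact: ccirc_cst.
under eq_fun do rewrite polesE big_map.
apply: ccirc_sum => i _; apply: ccirc_pole => //; first by rewrite r0 r1.
by move=> j; apply: le_lt_trans (xCr j) _.
Qed.

Let cid : ccirc r (fun z => z / (z - 1)).
Proof. by apply: ccirc_id_sub1; rewrite r0 r1. Qed.

(** The errors come from [expect_binsum] and, by the Lipschitz continuity of
    the (k+1)-st power, from the distance s between N^-1 times the sum of the
    factors and G. *)
Lemma EY_limit : normc (EY%:C - limit_value) <= const_mean / N%:R + const_fun * s.
Proof.
set mid : C := k.+1%:R^-1 *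
  cmean r (fun z => z / (z - 1) * (N%:R^-1 * \sum_(a <- poles bC xC z) a) ^+ k.+1).
rewrite (_ : _ - _ = (EY%:C - mid) + (mid - limit_value)); last by ring.
have NC : (N%:R : C) != 0 by rewrite pnatr_eq0 -lt0n.
have kC : (k.+1%:R : C) != 0 by rewrite pnatr_eq0.
apply: le_trans (normcD _ _) _; apply: lerD.
  have cs : ccirc r (fun z => z / (z - 1) * (\sum_(a <- poles bC xC z) a) ^+ k.+1).
    apply: ccircM; first exact: cid.
    apply: ccircX.
    under eq_fun do rewrite polesE big_map.
    apply: ccirc_sum => i _; apply: ccirc_pole => //; first by rewrite r0 r1.
    by move=> j; apply: le_lt_trans (xCr j) _.
  have -> : mid = k.+1%:R^-1 * (N%:R ^- k.+1 *
      cmean r (fun z => z / (z - 1) * (\sum_(a <- poles bC xC z) a) ^+ k.+1)).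
    rewrite /mid -(cmeanZ (N%:R ^- k.+1) cs); congr (_ * _).
    apply: (eq_cmean r0) => z _.
    by rewrite exprMn exprVn; ring.
  have YF : Yfactor%:C = k.+1%:R^-1 * N%:R ^- k.+1 * (k.+1`!)%:R :> C.
    rewrite /Yfactor rmorphM fmorphV rmorphXn /= !rmorph_nat factS natrM.
    move: (k.+1%:R : C) kC (N%:R ^+ k.+1 : C) (expf_neq0 k.+1 NC) (k`!%:R : C).
    by move=> a a0 c c0 f; field; rewrite a0 c0.
  rewrite EY_expect YF -!mulrA -!mulrBr !normcM !normcV normcX !normc_nat.
  have := expect_binsum N0 bC1 (schur_coefP beta01 betainj) rho00 rho0r r1 xCinj xCr kN.
  move=> H; apply: (@le_trans _ _ (k.+1%:R^-1 * (N%:R ^- k.+1 *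
     (2 * ((1 - r)^-1 * (A ^+ k.+1 * (k.+1 ^ 2 * (N + K) ^ k)%N%:R)))))).
    by rewrite ler_wpM2l ?invr_ge0 ?ler0n // ler_wpM2l // invr_ge0 exprn_ge0.
  have HD : (N + K)%:R ^+ k <= D ^+ k * N%:R ^+ k :> R.
    by rewrite -exprMn lerXn2r // nnegrE ?ler0n // mulr_ge0 // ler0n.
  rewrite natrM !natrX /const_mean.
  rewrite (_ : _ * (_ * _) = (2 * (1 - r)^-1 * A ^+ k.+1 * k.+1%:R / N%:R)
      * ((N + K)%:R ^+ k / N%:R ^+ k)); last first.
    have id (n e a v p q : R) : n != 0 -> e != 0 -> a != 0 ->
        a^-1 * ((n * e)^-1 * (2 * (v * (p * (a ^+ 2 * q))))) = 2 * v * p * a / n * (q / e).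
      by move=> n0 e0 a0; field; rewrite n0 e0 a0.
    by rewrite [N%:R ^+ k.+1]exprS; apply: id; rewrite ?expf_neq0 // gt_eqF ?ltr0n.
  rewrite [leRHS](_ : _ = (2 * (1 - r)^-1 * A ^+ k.+1 * k.+1%:R / N%:R) * D ^+ k); last by ring.
  rewrite ler_wpM2l ?ler_pdivrMr ?exprn_gt0 //.
  by apply: divr_ge0; rewrite ?ler0n // !mulr_ge0 ?exprn_ge0 ?ler0n.
have c1 : ccirc r (fun z => z / (z - 1) * (N%:R^-1 * \sum_(a <- poles bC xC z) a) ^+ k.+1).
  exact: ccircM cid cpow.
have cG : ccirc r (fun z => G z ^+ k.+1) by exact: ccircX Gc.
have c2 : ccirc r (fun z => z / (z - 1) * G z ^+ k.+1) by exact: ccircM cid cG.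
rewrite /mid /limit_value -mulrBr -(cmeanB r0 c1 c2).
rewrite normcM normcV normc_nat ler_pdivrMl ?ltr0n //.
have PB : 0 <= power_bound by rewrite addr_ge0 // mulr_ge0.
rewrite (_ : k.+1%:R * _ = 2 * ((1 - r)^-1 * (k.+1%:R * power_bound ^+ k * s))); last first.
  by rewrite /const_fun; ring.
rewrite (@eq_cmean _ _ r0 _ (fun z => z / (z - 1) *
  ((N%:R^-1 * \sum_(a <- poles bC xC z) a) ^+ k.+1 - G z ^+ k.+1))); last first.
  by move=> z _; rewrite mulrBr.
apply: (cmean_le r0); first exact: ccircM cid (ccircB cpow cG).
move=> z zr; rewrite normcM ler_pM ?normc_ge0 ?(normc_id_sub1 r1 r0 (lexx r) zr) //.
apply: le_trans (normc_subXX (B := power_bound) _ _ _) _.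
- by apply: le_trans (powersum_le zr) _; rewrite lerDr.
- by apply: le_trans (GB zr) _; rewrite lerDl mulr_ge0.
- by rewrite ler_wpM2l ?Gs // mulr_ge0 ?ler0n ?exprn_ge0.
Qed.

Let rho_bnd : R := (r - rho0) / 2 / 4.

(** The covariance of the binomial sums is of order N ^+ (2 k), while Y carries
    the factor N^-(k+1), squared. *)
Lemma Y_variance :
  \sum_(lam | is_part lam) rho lam * (Y lam - EY) ^+ 2 <= const_var / N%:R ^+ 2.
Proof.
rewrite /EY (wmean_variance rho_sum) -/EY; apply: le_trans (ler_norm _) _; rewrite -normcR.
have g0 : 0 < rho_bnd by rewrite !divr_gt0 // subr_gt0.
have n0 : 0 < (N + K)%:R :> R by rewrite ltr0n addn_gt0 N0.
have -> : (\sum_(lam | is_part lam) rho lam * Y lam ^+ 2 - EY ^+ 2)%:C =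
    Yfactor%:C ^+ 2 * (expect bC (@schur_coef R N K beta) xC
       (fun lam => binsum R k lam * binsum R k lam)
      - expect bC (@schur_coef R N K beta) xC (binsum R k)
        * expect bC (@schur_coef R N K beta) xC (binsum R k)).
  rewrite mulrBr -expr2 -exprMn -EY_expect rmorphB rmorphXn; congr (_ - _).
  rewrite (schur_weight_expect x0) // mulr_sumr rmorph_sum; apply: eq_bigr => lam _.
  by rewrite [LHS]rmorphM rmorphXn /= Y_binsum; ring.
have := expect_cov N0 bC1 (schur_coefP beta01 betainj) rho00 rho0r r1 xCinj xCr kN kN.
rewrite -/rho_bnd; set T := two_point_bound rho0 r => H.
rewrite normcM normcX normcR.
have Y0 : 0 <= Yfactor by rewrite divr_ge0 ?exprn_ge0 ?ler0n.
rewrite (ger0_norm Y0); apply: (le_trans (ler_wpM2l (sqr_ge0 _) H)).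
have HD : (N + K)%:R ^+ k <= D ^+ k * N%:R ^+ k :> R.
  by rewrite -exprMn lerXn2r // nnegrE ?ler0n // mulr_ge0 // ler0n.
have T0 : 0 <= T.
  rewrite /T /two_point_bound !mulr_ge0 ?expR_ge0 //.
  by rewrite invr_ge0 sqr_ge0.
have id (f n e c m t : R) : n != 0 -> e != 0 -> c != 0 -> m != 0 ->
   (f / (n * e)) ^+ 2 * (2 * (2 * (t / (c / m)) / (c / m))) =
   f ^+ 2 * (2 * (2 * t)) / c ^+ 2 / n ^+ 2 * (m / e) ^+ 2.
  by move=> n0' e0 c0 m0; field; rewrite n0' e0 c0 m0.
rewrite /Yfactor [N%:R ^+ k.+1]exprS [(rho_bnd / _) ^+ k]expr_div_n id; last 4 first.
- by rewrite gt_eqF.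
- by rewrite expf_neq0 // gt_eqF.
- by rewrite expf_neq0 // gt_eqF.
- by rewrite expf_neq0 // gt_eqF.
rewrite /const_var -/rho_bnd -/T mulnC !exprM.
rewrite [leRHS](_ : _ = k`!%:R ^+ 2 * (2 * (2 * T)) / (rho_bnd ^+ k) ^+ 2 / N%:R ^+ 2
    * (D ^+ k) ^+ 2); last by ring.
rewrite ler_wpM2l //.
  do 2 (apply: divr_ge0; last exact: sqr_ge0).
  apply: mulr_ge0; first exact: sqr_ge0.
  by apply: mulr_ge0 => //; exact: mulr_ge0.
rewrite lerXn2r ?nnegrE ?divr_ge0 ?exprn_ge0 ?ler0n //.
by rewrite ler_pdivrMr ?exprn_gt0.
Qed.

Definition const_second : R :=
  3 * (const_ffact ^+ 2 + const_var + (const_mean + const_fun) ^+ 2).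

Lemma const_mean_ge0 : 0 <= const_mean.
Proof. by rewrite !mulr_ge0 ?exprn_ge0. Qed.

Lemma const_fun_ge0 : 0 <= const_fun.
Proof. by rewrite !mulr_ge0 ?exprn_ge0 // addr_ge0 // mulr_ge0. Qed.

Lemma particle_moment_second : 0 <= s ->
  \sum_(lam | is_part lam) rho lam *
     normc ((particle_moment R k (nparts lam))%:C - limit_value) ^+ 2
  <= const_second * (N%:R^-1 + s) ^+ 2.
Proof.
move=> s0.
have iN : 0 <= N%:R^-1 :> R by rewrite invr_ge0 ler0n.
have cm0 := const_mean_ge0; have cf0 := const_fun_ge0.
have e0 : 0 <= const_mean / N%:R + const_fun * s.
  by apply: addr_ge0; [exact: divr_ge0|exact: mulr_ge0].
have iNs : N%:R^-1 ^+ 2 <= (N%:R^-1 + s) ^+ 2.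
  by rewrite lerXn2r ?nnegrE ?addr_ge0 // lerDl.
apply: (@le_trans _ _ (\sum_(lam | is_part lam) rho lam *
   (3 * ((const_ffact / N%:R) ^+ 2 + (Y lam - EY) ^+ 2
     + (const_mean / N%:R + const_fun * s) ^+ 2)))).
  apply: (wmean_le rho_ge0) => lam _.
  (* The falling factorials, the fluctuation and the error in the mean. *)
  rewrite (_ : _ - limit_value = (particle_moment R k (nparts lam) - Y lam)%:C
     + (Y lam - EY)%:C + (EY%:C - limit_value)); last by rewrite !rmorphB; ring.
  apply: le_trans (normc_sqr_add3 _ _ _) _; rewrite ler_wpM2l // !normcR.
  apply: lerD; first apply: lerD.
  - rewrite lerXn2r ?nnegrE ?normr_ge0 ?particle_moment_Y //.
    exact: le_trans (normr_ge0 _) (particle_moment_Y lam).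
  - by rewrite real_normK // num_real.
  - by rewrite lerXn2r ?nnegrE ?normc_ge0 ?EY_limit.
rewrite (eq_bigr (fun lam => 3 * (rho lam * (Y lam - EY) ^+ 2) + rho lam *
   (3 * ((const_ffact / N%:R) ^+ 2 + (const_mean / N%:R + const_fun * s) ^+ 2)))); last first.
  by move=> lam _; ring.
rewrite big_split /= -mulr_sumr (wmean_cst rho_sum) -mulrDr /const_second -mulrA ler_wpM2l //.
have V := Y_variance.
apply: (@le_trans _ _ (const_var / N%:R ^+ 2 + ((const_ffact / N%:R) ^+ 2
   + (const_mean / N%:R + const_fun * s) ^+ 2))); first by rewrite lerD2r.
rewrite !mulrDl addrA [const_var / _ + _]addrC; apply: lerD; first apply: lerD.
- by rewrite exprMn ler_wpM2l ?sqr_ge0.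
- rewrite -exprVn ler_wpM2l //; apply: divr_ge0; last first.
    by rewrite exprn_ge0 // !divr_ge0 // subr_ge0 ltW.
  rewrite !mulr_ge0 ?sqr_ge0 ?exprn_ge0 ?expR_ge0 //.
  by rewrite invr_ge0 sqr_ge0.
- rewrite -exprMn lerXn2r ?nnegrE //.
    by apply: mulr_ge0; apply: addr_ge0.
  rewrite mulrDl !mulrDr; apply: lerD.
    by rewrite lerDl; exact: mulr_ge0.
  by rewrite lerDr; exact: mulr_ge0.
Qed.

Lemma limit_value_le : normc limit_value <= 2 * (1 - r)^-1 * B ^+ k.+1.
Proof.
have cG : ccirc r (fun z => G z ^+ k.+1) by exact: ccircX Gc.
rewrite /limit_value normcM normcV normc_nat ler_pdivrMl ?ltr0n //.
have H : normc (cmean r (fun z => z / (z - 1) * G z ^+ k.+1)) <= 2 * ((1 - r)^-1 * B ^+ k.+1).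
  apply: (cmean_le r0); first exact: ccircM cid cG.
  move=> z zr; rewrite normcM ler_pM ?normc_ge0 ?(normc_id_sub1 r1 r0 (lexx r) zr) //.
  by rewrite normcX lerXn2r ?nnegrE ?normc_ge0 ?GB.
apply: (le_trans H); rewrite mulrA ler_peMl ?mulr_ge0 ?exprn_ge0 //.
by rewrite ler1n.
Qed.

End MomentConcentration.

(** The moments are bounded, so the difference of the products is controlled by
    the differences of the factors, whose second moments are known. The
    constant depends neither on N and K nor on the weights, which is what
    allows averaging over them. *)
Lemma product_moment_distinct (R : realType) (rho0 r D B : R) (nu : nat) (k : 'I_nu -> nat) :
  0 <= rho0 -> rho0 < r -> r < 1 -> 1 <= D -> 0 <= B ->
  exists2 Cst : R, 0 <= Cst &
  forall (N K : nat) (x : 'I_N -> R) (beta : 'I_K -> R) (G : R[i] -> R[i]) (s : R),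
    (0 < N)%N -> (forall j, (k j < N + K)%N) -> (N + K)%:R <= D * N%:R ->
    (forall i, `|1 - x i| <= rho0) -> injective x ->
    (forall j, 0 < beta j < 1) -> injective beta ->
    ccirc r G -> (forall z, normc z = r -> normc (G z) <= B) -> 0 <= s ->
    (forall z, normc z = r -> normc (N%:R^-1 * (\sum_(a <-
       poles (fun j => (beta j)%:C) (fun i => (x i)%:C) z) a) - G z) <= s) ->
    normc ((\sum_(lam | is_part lam) schur_weight x beta lam *
        \prod_(j < nu) particle_moment R (k j) (fun i => lam i))%:C
      - \prod_(j < nu) ((k j).+1%:R^-1 * cmean r (fun z => z / (z - 1) * G z ^+ (k j).+1)))
    <= Cst * (N%:R^-1 + s).
Proof.
move=> rho00 rho0r r1 D1 B0.
have D0 : 0 <= D by exact: le_trans D1.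
have V0 : 0 <= (1 - r)^-1 by rewrite invr_ge0 subr_ge0 ltW.
pose b j : R := D ^+ k j + 2 * (1 - r)^-1 * B ^+ (k j).+1.
have b0 j : 0 <= b j by rewrite addr_ge0 ?exprn_ge0 // mulr_ge0 ?exprn_ge0 // mulr_ge0.
pose Bm : R := 1 + \sum_j b j.
have Bm1 : 1 <= Bm by rewrite lerDl sumr_ge0.
have bBm j : b j <= Bm.
  by rewrite /Bm (bigD1 j) //= addrCA lerDl addr_ge0 // sumr_ge0.
exists (Bm ^+ nu * \sum_j (1 + `|const_second rho0 r D B (k j)|)).
  apply: mulr_ge0; first by rewrite exprn_ge0 // (le_trans ler01).
  by apply: sumr_ge0 => j _; rewrite addr_ge0.
move=> N K x beta G s N0 kN NKD xr xinj b01 binj Gc GB s0 Gs.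
have x0 i : 0 < x i by have := xr i; rewrite ler_norml; move: rho0r r1; lra.
have x2 i : x i < 2 by have := xr i; rewrite ler_norml; move: rho0r r1; lra.
have rho_ge0 (lam : {ffun 'I_N -> 'I_K.+1}) : is_part lam -> 0 <= schur_weight x beta lam.
  by move=> lamP; apply: schur_weight_ge0_distinct.
have rho_sum : \sum_(lam | is_part lam) schur_weight x beta lam = 1.
  exact: schur_weight_sum1_distinct.
pose m j : R[i] := (k j).+1%:R^-1 * cmean r (fun z => z / (z - 1) * G z ^+ (k j).+1).
rewrite -[X in _%:C - X]/(\prod_j m j).
have t0 : 0 < N%:R^-1 + s by rewrite ltr_pwDl // invr_gt0 ltr0n.
apply: (le_trans (normc_wmean_sub rho_ge0 rho_sum _ _)).
apply: (@le_trans _ _ (\sum_(lam | is_part lam) schur_weight x beta lam *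
   (Bm ^+ nu * \sum_j normc ((particle_moment R (k j) (fun i => lam i))%:C - m j)))).
  apply: (wmean_le rho_ge0) => lam _; rewrite rmorph_prod; apply: prod_sub_le => // j.
    rewrite normcR; apply: le_trans (bBm j).
    apply: le_trans (particle_moment_le (k j) D1 N0 NKD lam) _; rewrite lerDl.
    by rewrite mulr_ge0 ?exprn_ge0 // mulr_ge0.
  apply: le_trans (bBm j).
  apply: le_trans (limit_value_le (k j) rho00 rho0r r1 B0 Gc GB) _.
  by rewrite lerDr exprn_ge0.
under eq_bigr do rewrite mulrCA mulr_sumr.
rewrite -mulr_sumr -mulrA ler_wpM2l ?exprn_ge0 ?(le_trans ler01) //.
rewrite exchange_big mulr_suml; apply: ler_sum => j _.
apply: (wmean_abs_le rho_ge0 rho_sum t0) => [lam _|]; first exact: normc_ge0.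
have H := particle_moment_second rho00 rho0r r1 D1 B0 N0 (kN j) NKD xr xinj b01 binj Gc GB Gs s0.
by apply: (le_trans H); rewrite ler_wpM2r ?sqr_ge0 // ler_norm.
Qed.

(** * The limiting integrand *)

Section PowerSeries.
Variable R : realType.
Local Notation C := R[i].

Lemma geometric_partial_le (q : R) n m : 0 <= q < 1 ->
  \sum_(n <= j < m) q ^+ j <= q ^+ n / (1 - q).
Proof.
move=> /andP[q0 q1]; have d0 : 0 < 1 - q by rewrite subr_gt0.
rewrite ler_pdivlMr // mulr_suml.
under eq_bigr do rewrite mulrBr mulr1 -exprSr.
have [nm|/ltnW mn] := leqP n m; last by rewrite big_geq // exprn_ge0.
rewrite (eq_bigr (fun j => (- q ^+ j.+1) - (- q ^+ j))); last by move=> j _; ring.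
by rewrite telescope_sumr // opprK addrC lerBlDr lerDl exprn_ge0.
Qed.

Lemma real_series_geometric (u : nat -> R) (q : R) : 0 <= q < 1 ->
  (forall j, `|u j| <= q ^+ j) ->
  exists l, forall n, `|l - \sum_(0 <= j < n) u j| <= q ^+ n / (1 - q).
Proof.
move=> q01 uq; have /andP[q0 q1] := q01.
have cu : cvgn (series u).
  apply: normed_cvg; apply: (@series_le_cvg _ _ (geometric 1 q)) => [n|n|n|].
  - exact: normr_ge0.
  - by rewrite /geometric /= mul1r exprn_ge0.
  - by rewrite /geometric /= mul1r.
  - by apply: is_cvg_geometric_series; rewrite ger0_norm.
exists (limn (series u)) => n.
have H : `|series u m - \sum_(0 <= j < n) u j| @[m --> \oo]
    --> `|limn (series u) - \sum_(0 <= j < n) u j|.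
  by apply: cvg_norm; apply: cvgB; [exact: cu|exact: cvg_cst].
apply: (cvgr_to_le H); near=> m.
have nm : (n <= m)%N by near: m; exists n.
rewrite /series /= (@big_cat_nat _ _ _ n 0 m) //= addrAC subrr add0r.
apply: le_trans (ler_norm_sum _ _ _) _.
by apply: le_trans (geometric_partial_le n m q01); apply: ler_sum.
Unshelve. all: by end_near. Qed.

(** A positive element of the complex field is real, so the topology of the
    modulus reduces to real estimates. *)
Lemma complex_cvg_geometric (f : nat -> Cplx R) (l : Cplx R) (A q : R) :
  0 <= q < 1 -> 0 <= A -> (forall n, normc (l - f n) <= A * q ^+ n) ->
  f n @[n --> \oo] --> l.
Proof.
move=> /andP[q0 q1] A0 fl; apply/cvgrPdist_lt => e e0.
have [re ree] : exists2 re : R, 0 < re & e = re%:C.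
  move: e e0 => [a b]; rewrite ltcE /= => /andP[/eqP -> a0]; by exists a.
move=> ->.
have : A * q ^+ n @[n --> \oo] --> (A * 0 : R).
  by apply: cvgMl_tmp; apply: cvg_expr; rewrite ger0_norm.
rewrite mulr0 => /cvgrPdist_lt /(_ _ ree) [n0 _ H]; exists n0 => // n /H /=.
rewrite sub0r normrN ger0_norm ?mulr_ge0 ?exprn_ge0 // => h.
rewrite -[`|_|]/((normc (l - f n))%:C) ltcR.
exact: le_lt_trans (fl n) h.
Qed.

Lemma pseries_sum_tail (a : nat -> R) (z : Cplx R) (q : R) : 0 <= q < 1 ->
  (forall j, `|a j| * normc z ^+ j <= q ^+ j) ->
  forall n, normc (pseries_sum a z - pseries_part a n z) <= (2 / (1 - q)) * q ^+ n.
Proof.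
move=> q01 aq; have /andP[q0 q1] := q01.
have d0 : 0 < 1 - q by rewrite subr_gt0.
pose u j := complex.Re ((a j)%:C * z ^+ j : R[i]).
pose v j := complex.Im ((a j)%:C * z ^+ j : R[i]).
have nq j : normc ((a j)%:C * z ^+ j) <= q ^+ j by rewrite normcM normcX normcR.
have [lu Hu] : exists l, forall n, `|l - \sum_(0 <= j < n) u j| <= q ^+ n / (1 - q).
  by apply: real_series_geometric q01 _ => j; apply: le_trans (Re_le_normc _) (nq j).
have [lv Hv] : exists l, forall n, `|l - \sum_(0 <= j < n) v j| <= q ^+ n / (1 - q).
  by apply: real_series_geometric q01 _ => j; apply: le_trans (Im_le_normc _) (nq j).
pose l : R[i] := lu +i* lv.
have H n : normc (l - pseries_part a n z) <= (2 / (1 - q)) * q ^+ n.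
  apply: le_trans (normc_le_Re_Im _) _.
  have -> : complex.Re (l - pseries_part a n z : R[i]) = lu - \sum_(0 <= j < n) u j.
    by rewrite raddfB /= raddf_sum.
  have -> : complex.Im (l - pseries_part a n z : R[i]) = lv - \sum_(0 <= j < n) v j.
    by rewrite raddfB /= raddf_sum.
  have := Hu n; have := Hv n; rewrite mulrAC -mulrA; lra.
have A0 : 0 <= 2 / (1 - q) by rewrite divr_ge0 // ltW.
have -> : pseries_sum a z = l.
  apply: cvg_lim => //; exact: complex_cvg_geometric q01 A0 H.
exact: H.
Qed.

End PowerSeries.

Section LimitSymbol.
Variable R : realType.

Lemma pseries_partE (a : nat -> R) n (z : R[i]) :
  pseries_part a n z = \sum_(0 <= i < n) (a i)%:C * z ^+ i :> R[i].
Proof. by []. Qed.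

(** The function raised to the power k+1 in the contour integral, with A =
    1/gamma - 1 and a common factor taken out. *)
Definition limit_symbol (A : R) (c g : nat -> R) (z : R[i]) : R[i] :=
  (z - 1) / z * (pseries_sum c z^-1 - A%:C * (pseries_sum g z - 1)).

(** On z = r exp(it) the differential is i z dt; i cancels against (2 pi i)^-1
    and z turns (z - 1)^-1 into z / (z - 1). *)
Lemma limit_momentE (gamma : R) (c g : nat -> R) (r : R) k : 0 < r < 1 ->
  ccirc r (limit_symbol (gamma^-1 - 1) c g) ->
  limit_moment gamma c g r k = k.+1%:R^-1 *
    cmean r (fun z => z / (z - 1) * limit_symbol (gamma^-1 - 1) c g z ^+ k.+1) :> R[i].
Proof.
move=> r01 cG; have /andP[r0 r1] := r01.
rewrite /limit_moment /cmean.
pose h t : R[i] := 'i%C * ((cpt r t) / (cpt r t - 1) *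
  limit_symbol (gamma^-1 - 1) c g (cpt r t) ^+ k.+1).
have -> : circle_integral r (fun z =>
    (z - 1)^-1 *
    ((gamma^-1 - 1)%:C * ((1 - z) / z * pseries_sum g z - (1 - z) / z)
     + (z - 1) / z * pseries_sum c z^-1) ^+ k.+1) = cint h.
  rewrite -[LHS]/(cint (fun t => _ * ('i%C * cpt r t))); congr cint; apply/funext => t.
  have -> : (gamma^-1 - 1)%:C * ((1 - cpt r t) / cpt r t * pseries_sum g (cpt r t)
      - (1 - cpt r t) / cpt r t) + (cpt r t - 1) / cpt r t * pseries_sum c (cpt r t)^-1
    = limit_symbol (gamma^-1 - 1) c g (cpt r t) :> R[i].
    by rewrite /limit_symbol; set u := pseries_sum _ _; set v := pseries_sum _ _; ring.
  by rewrite /h; set G := limit_symbol _ _ _ _; ring.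
have ch : ccirc r (fun z => z / (z - 1) * limit_symbol (gamma^-1 - 1) c g z ^+ k.+1).
  exact: ccircM (ccirc_id_sub1 r01) (ccircX _ cG).
rewrite (cintZ 'i%C ch).
have i0 : 'i%C != 0 :> R[i] by rewrite eq_complex /= oner_eq0 andbF.
have p0 := pi2C_neq0 R.
set X := cint _; rewrite [in RHS]rmorphM /= in p0 *.
have -> : 2%:C = 2 :> R[i] by rewrite rmorph_nat.
set p := pi%:C; set n := k.+1%:R; set j := 'i%C in i0 *.
rewrite -[LHS]/((2 * p * j * n : R[i])^-1 * (j * X)) !invfM.
by transitivity (n^-1 * (2^-1 / p * X) * (j^-1 * j)); [ring|rewrite mulVf // mulr1].
Qed.

Lemma geometric_remainder (u : R[i]) (q : R) n : normc u <= q -> q < 1 ->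
  normc ((1 - u)^-1 - \sum_(0 <= i < n) u ^+ i) <= q ^+ n / (1 - q).
Proof.
move=> uq q1; have d0 : 0 < 1 - q by rewrite subr_gt0.
have q0 : 0 <= q by exact: le_trans (normc_ge0 u) uq.
have du : 1 - q <= normc (1 - u) by have := normc_ge_sub 1 u; rewrite normc1; lra.
have u1 : 1 - u != 0 by rewrite -normc_eq0 gt_eqF // (lt_le_trans d0).
have -> : (1 - u)^-1 - \sum_(0 <= i < n) u ^+ i = u ^+ n / (1 - u).
  apply: (mulIf u1); rewrite mulrBl mulVf // mulfVK //.
  have := subrX1 u n; rewrite big_mkord => H.
  by rewrite -[1 - u]opprB mulrN mulrC -H; ring.
rewrite normcM normcX normcV.
apply: ler_pM; rewrite ?exprn_ge0 ?invr_ge0 ?normc_ge0 //.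
  by rewrite lerXn2r // nnegrE normc_ge0.
by rewrite lef_pV2 // posrE // (lt_le_trans d0).
Qed.

(** Averages of (1 - v_j w)^-1 are power series in w with the power means of
    the v_j as coefficients. *)
Lemma mean_geometric_remainder (a q : R) m n (v : 'I_m -> R) (w : R[i]) :
  0 <= a -> (forall j, normc ((v j)%:C * w) <= q) -> q < 1 ->
  normc (a%:C * (\sum_j (1 - (v j)%:C * w)^-1)
    - \sum_(0 <= i < n) (a * \sum_j v j ^+ i)%:C * w ^+ i)
  <= a * m%:R * (q ^+ n / (1 - q)).
Proof.
move=> a0 vq q1.
have -> : \sum_(0 <= i < n) (a * \sum_j v j ^+ i)%:C * w ^+ i
    = a%:C * \sum_j \sum_(0 <= i < n) ((v j)%:C * w) ^+ i.
  rewrite exchange_big mulr_sumr; apply: eq_bigr => i _.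
  rewrite rmorphM /= -mulrA rmorph_sum /= mulr_suml; congr (_ * _).
  by apply: eq_bigr => j _; rewrite exprMn rmorphXn.
rewrite -mulrBr -sumrB normcM normcR ger0_norm // -mulrA ler_wpM2l //.
apply: le_trans (normc_sum _ _ _) _.
rewrite -[X in X%:R * _]card_ord mulr_natl -sumr_const.
by apply: ler_sum => j _; exact: geometric_remainder.
Qed.

(** Since |1 - x| < |z|, this factor expands in powers of (1 - x) / z, which is
    why the limit involves F_1 at 1/z. *)
Lemma pole_x_series (x z : R[i]) : z != 0 -> 1 - (1 - x) / z != 0 ->
  (1 - z) / (1 - z - x) = (z - 1) / z * (1 - (1 - x) / z)^-1.
Proof.
move=> z0; have -> : 1 - (1 - x) / z = (z - 1 + x) / z by field.
rewrite mulf_eq0 invr_eq0 negb_or => /andP[d _].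
have E : 1 - z - x = - (z - 1 + x) by ring.
by rewrite E; move: (z - 1 + x) d => u u0; field; rewrite ?oppr_eq0 z0 u0.
Qed.

(** Since |b z| < 1, this factor expands in powers of b z, which gives F_2 at
    z; subtracting 1 removes the constant term. *)
Lemma pole_b_series (b z : R[i]) : z != 0 -> 1 - b * z != 0 ->
  b * (1 - z) / (1 - b * z) = - ((z - 1) / z * ((1 - b * z)^-1 - 1)).
Proof. by move=> z0 d; field; rewrite z0 d. Qed.

Lemma sum_poles N K (b : 'I_K -> R[i]) (x : 'I_N -> R[i]) z :
  \sum_(a <- poles b x z) a = \sum_j ((1 - z) / (1 - z - x j))
    + \sum_k (b k * (1 - z) / (1 - b k * z)).
Proof. by rewrite /poles big_cat !big_map -!big_enum. Qed.

Variables (rho0 r A : R) (c g : nat -> R).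
Hypotheses (rho00 : 0 <= rho0) (rho0r : rho0 < r) (r1 : r < 1) (A0 : 0 <= A).
Hypotheses (c_le : forall i, `|c i| <= rho0 ^+ i) (g_le : forall i, `|g i| <= 1).

(** Ratio of the geometric series that dominate both power series on the circle. *)
Definition circle_ratio : R := Num.max (rho0 / r) r.
Local Notation q := circle_ratio.

Let r0 : 0 < r. Proof. exact: le_lt_trans rho0r. Qed.

Lemma circle_ratio01 : 0 <= q < 1.
Proof.
rewrite /q le_max (ltW r0) orbT /= gt_max r1 andbT ltr_pdivrMr // mul1r.
exact: rho0r.
Qed.

Let q0 : 0 <= q. Proof. by case/andP: circle_ratio01. Qed.
Let d0 : 0 < 1 - q. Proof. by rewrite subr_gt0; case/andP: circle_ratio01. Qed.

Let c_circ z : normc z = r -> forall i, `|c i| * normc z^-1 ^+ i <= q ^+ i.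
Proof.
move=> zr i; rewrite normcV zr.
apply: (@le_trans _ _ ((rho0 / r) ^+ i)).
  by rewrite exprMn ler_wpM2r // exprn_ge0 // invr_ge0 ltW.
by rewrite lerXn2r ?nnegrE ?divr_ge0 ?(ltW r0) // /q le_max lexx.
Qed.

Let g_circ z : normc z = r -> forall i, `|g i| * normc z ^+ i <= q ^+ i.
Proof.
move=> zr i; rewrite zr; apply: (@le_trans _ _ (r ^+ i)).
  by rewrite -[leRHS]mul1r ler_wpM2r // exprn_ge0 // ltW.
by rewrite lerXn2r ?nnegrE ?(ltW r0) // /q le_max lexx orbT.
Qed.

Let normc_factor z : normc z = r -> normc ((z - 1) / z) <= 2 / r.
Proof.
move=> zr; rewrite normcM normcV zr ler_wpM2r ?invr_ge0 ?(ltW r0) //.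
by have := normc_sub_le z 1; rewrite normc1 zr; move: r1; lra.
Qed.

Let circ_neq0 (z : R[i]) : normc z = r -> z != 0.
Proof. by move=> zr; rewrite -normc_gt0 zr. Qed.

Let tail1 z n : normc z = r ->
  normc (pseries_sum c z^-1 - pseries_part c n z^-1) <= 2 / (1 - q) * q ^+ n.
Proof. by move=> zr; apply: pseries_sum_tail circle_ratio01 (c_circ zr) n. Qed.

Let tail2 z n : normc z = r ->
  normc (pseries_sum g z - pseries_part g n z) <= 2 / (1 - q) * q ^+ n.
Proof. by move=> zr; apply: pseries_sum_tail circle_ratio01 (g_circ zr) n. Qed.

Let ccirc_part (a : nat -> R) (f : R[i] -> R[i]) n : ccirc r f ->
  ccirc r (fun z => pseries_part a n (f z)).
Proof.
move=> cf; apply: ccirc_sum => i _.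
exact: ccircM (ccirc_cst _ _) (ccircX _ cf).
Qed.

(** On the circle the two power series are uniform limits of their partial
    sums. *)
Lemma ccirc_limit_symbol : ccirc r (limit_symbol A c g).
Proof.
have cV : ccirc r (fun z => z^-1) by apply: (ccircV r0 (f := id)) => [z zr|]; [exact: circ_neq0 zr|exact: ccirc_id].
have cf : ccirc r (fun z => (z - 1) / z).
  apply: ccircM; last exact: cV.
  by apply: ccircB; [exact: ccirc_id|exact: ccirc_cst].
have unif (F : R[i] -> R[i]) (p : nat -> R[i] -> R[i]) : (forall n, ccirc r (p n)) ->
    (forall z n, normc z = r -> normc (F z - p n z) <= 2 / (1 - q) * q ^+ n) -> ccirc r F.
  move=> cp Fp; apply: (ccirc_uniform_limit r0) => e e0.
  have : 2 / (1 - q) * q ^+ n @[n --> \oo] --> (2 / (1 - q) * 0 : R).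
    by apply: cvgMl_tmp; apply: cvg_expr; rewrite ger0_norm //; case/andP: circle_ratio01.
  rewrite mulr0 => /cvgrPdist_lt /(_ _ e0) [n _ /(_ n (leqnn n)) /=].
  rewrite sub0r normrN => H; exists (p n); first exact: cp.
  by move=> z zr; apply: le_trans (Fp z n zr) _; apply: le_trans (ler_norm _) (ltW H).
have cF1 : ccirc r (fun z => pseries_sum c z^-1).
  by apply: (unif _ (fun n z => pseries_part c n z^-1)) => [n|z n zr];
    [exact: ccirc_part|exact: tail1].
have cF2 : ccirc r (fun z => pseries_sum g z).
  by apply: (unif _ (fun n z => pseries_part g n z)) => [n|z n zr];
    [apply: ccirc_part; exact: ccirc_id|exact: tail2].
apply: (ccircM cf); apply: (ccircB cF1).
apply: ccircM; first exact: ccirc_cst.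
by apply: (ccircB cF2); exact: ccirc_cst.
Qed.

Definition symbol_bound : R := 2 / r * (2 / (1 - q) + A * (2 / (1 - q) + 1)).

Lemma symbol_bound_ge0 : 0 <= symbol_bound.
Proof.
have h : 0 <= 2 / (1 - q) by rewrite divr_ge0 // ltW.
apply: mulr_ge0; first by rewrite divr_ge0 // ltW.
by rewrite addr_ge0 // mulr_ge0 // addr_ge0.
Qed.

Lemma limit_symbol_le z : normc z = r -> normc (limit_symbol A c g z) <= symbol_bound.
Proof.
move=> zr; rewrite /limit_symbol normcM.
apply: ler_pM; rewrite ?normc_ge0 //; first exact: normc_factor.
have := tail1 0 zr; have := tail2 0 zr; rewrite !pseries_partE !big_geq //.
move: (pseries_sum c z^-1) (pseries_sum g z) => S1 S2; rewrite !subr0 expr0 mulr1.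
move=> h2 h1; apply: le_trans (normc_sub_le _ _) _; apply: lerD; first exact: h1.
rewrite normcM normcR ger0_norm // ler_wpM2l //.
apply: le_trans (normc_sub_le _ _) _; rewrite normc1 lerD2r; exact: h2.
Qed.

(** The weights enter only through finitely many discrepancies between their
    power means and the limits of these. *)
Definition symbol_error (D : R) L (py pb : nat -> R) : R :=
  2 / r * (\sum_(0 <= i < L) (`|py i - c i| * r^-1 ^+ i + `|pb i - A * g i|)
    + `|pb 0%N - A| + (3 + D + 2 * A) / (1 - q) * q ^+ L).

(** Both sides are expanded in geometric series and compared term by term up to
    order L; the tails are geometric. The term of order 0 of the second family
    enters separately because of the 1 in [pole_b_series]. *)
Lemma poles_symbol_error N K (x : 'I_N -> R) (beta : 'I_K -> R) (D : R) L z :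
  (0 < N)%N -> (K)%:R <= D * N%:R -> (forall i, `|1 - x i| <= rho0) ->
  (forall j, 0 < beta j < 1) -> normc z = r ->
  normc (N%:R^-1 * (\sum_(a <- poles (fun j => (beta j)%:C) (fun i => (x i)%:C) z) a)
     - limit_symbol A c g z)
  <= symbol_error D L (fun i => N%:R^-1 * \sum_j (1 - x j) ^+ i)
       (fun i => N%:R^-1 * \sum_k beta k ^+ i).
Proof.
move=> N0 KD xr b01 zr; have z0 := circ_neq0 zr.
have n0 : 0 < N%:R :> R by rewrite ltr0n.
have qr : r <= q by rewrite /q le_max lexx orbT.
have qr' : rho0 / r <= q by rewrite /q le_max lexx.
have [_ q1] := andP circle_ratio01.
pose py i : R := N%:R^-1 * \sum_j (1 - x j) ^+ i.
pose pb i : R := N%:R^-1 * \sum_k beta k ^+ i.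
rewrite -[X in symbol_error _ _ X]/(py) -[X in symbol_error _ _ _ X]/(pb).
have a0 : 0 < N%:R^-1 :> R by rewrite invr_gt0.
pose E1 : R[i] := N%:R^-1%:C * \sum_j (1 - (1 - x j)%:C / z)^-1.
pose E2 : R[i] := N%:R^-1%:C * \sum_k (1 - (beta k)%:C * z)^-1.
have xz j : normc ((1 - x j)%:C / z) <= q.
  rewrite normcM normcV normcR zr; apply: le_trans qr'.
  by rewrite ler_wpM2r // invr_ge0 ltW.
have bz k : normc ((beta k)%:C * z) <= q.
  have /andP[b0 b1] := b01 k.
  rewrite normcM normcR zr ger0_norm ?(ltW b0) //; apply: le_trans qr.
  by rewrite -[leRHS]mul1r ler_wpM2r ?(ltW r0) ?(ltW b1).
have dom u : normc u <= q -> 1 - u != 0.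
  move=> uq; rewrite -normc_gt0; have := normc_ge_sub 1 u; rewrite normc1.
  by move: uq q1; lra.
have polesE' : N%:R^-1%:C * (\sum_(a <- poles (fun j => (beta j)%:C) (fun i => (x i)%:C) z) a)
    = (z - 1) / z * (E1 - (E2 - (pb 0%N)%:C)).
  rewrite sum_poles.
  under eq_bigr => j _ do rewrite (pole_x_series z0) -?rmorphB /= ?dom //.
  under [X in _ + X]eq_bigr => k _ do rewrite (pole_b_series z0) ?dom //.
  rewrite sumrN -!mulr_sumr sumrB -mulrBr mulrCA /E1 /E2 /pb; congr (_ * _).
  rewrite mulrBr mulrBr rmorphM /= rmorph_sum /=.
  by congr (_ - (_ - _ * _)); apply: eq_bigr => k _; rewrite expr0.
have F1 : normc (E1 - \sum_(0 <= i < L) (py i)%:C * z^-1 ^+ i) <= q ^+ L / (1 - q).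
  have := mean_geometric_remainder L (ltW a0) xz q1.
  by rewrite mulVf ?gt_eqF // mul1r.
have F2 : normc (E2 - \sum_(0 <= i < L) (pb i)%:C * z ^+ i) <= D * (q ^+ L / (1 - q)).
  apply: le_trans (mean_geometric_remainder L (ltW a0) bz q1) _.
  rewrite ler_wpM2r ?divr_ge0 ?exprn_ge0 ?(ltW d0) //.
  by rewrite mulrC ler_pdivrMr.
have -> : N%:R^-1 = (N%:R^-1)%:C :> R[i] by rewrite fmorphV /= rmorph_nat.
rewrite polesE' /limit_symbol -mulrBr normcM /symbol_error.
apply: ler_pM; rewrite ?normc_ge0 //; first exact: normc_factor.
have T1 := tail1 L zr; have T2 := tail2 L zr.
set P1 := \sum_(0 <= i < L) (py i)%:C * z^-1 ^+ i in F1.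
set P2 := \sum_(0 <= i < L) (pb i)%:C * z ^+ i in F2.
have -> : E1 - (E2 - (pb 0%N)%:C) - (pseries_sum c z^-1 - A%:C * (pseries_sum g z - 1))
  = (E1 - P1) - (pseries_sum c z^-1 - pseries_part c L z^-1)
    - (E2 - P2) + A%:C * (pseries_sum g z - pseries_part g L z)
    + (P1 - pseries_part c L z^-1) - (P2 - A%:C * pseries_part g L z)
    + (pb 0%N - A)%:C :> R[i].
  rewrite rmorphB /=; set a1 := pseries_sum c _; set a2 := pseries_part c _ _.
  by set a3 := pseries_sum g _; set a4 := pseries_part g _ _; ring.
have G1 : normc (P1 - pseries_part c L z^-1) <= \sum_(0 <= i < L) `|py i - c i| * r^-1 ^+ i.
  rewrite pseries_partE /P1 -sumrB; apply: le_trans (normc_sum _ _ _) _.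
  by apply: ler_sum => i _; rewrite -mulrBl -rmorphB normcM normcR normcX normcV zr.
have G2 : normc (P2 - A%:C * pseries_part g L z) <= \sum_(0 <= i < L) `|pb i - A * g i|.
  rewrite pseries_partE /P2 mulr_sumr -sumrB; apply: le_trans (normc_sum _ _ _) _.
  apply: ler_sum => i _; rewrite mulrA -rmorphM -mulrBl -rmorphB normcM normcR normcX zr.
  by rewrite -[leRHS]mulr1 ler_wpM2l // exprn_ile1 // ltW.
rewrite big_split /=.
have T2' : normc (A%:C * (pseries_sum g z - pseries_part g L z)) <= A * (2 / (1 - q) * q ^+ L).
  by rewrite normcM normcR ger0_norm // ler_wpM2l.
have T3 : normc (pb 0%N - A)%:C <= `|pb 0%N - A| by rewrite normcR.
have sum7 (e1 e2 e3 e4 e5 e6 e7 : R[i]) : normc (e1 - e2 - e3 + e4 + e5 - e6 + e7)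
    <= normc e1 + normc e2 + normc e3 + normc e4 + normc e5 + normc e6 + normc e7.
  apply: le_trans (normcD _ _) _; rewrite lerD2r.
  apply: le_trans (normc_sub_le _ _) _; rewrite lerD2r.
  apply: le_trans (normcD _ _) _; rewrite lerD2r.
  apply: le_trans (normcD _ _) _; rewrite lerD2r.
  apply: le_trans (normc_sub_le _ _) _; rewrite lerD2r.
  exact: normc_sub_le.
apply: le_trans (sum7 _ _ _ _ _ _ _) _.
move: F1 T1 F2 T2' G1 G2 T3.
have -> : 2 / (1 - q) * q ^+ L = 2 * (q ^+ L / (1 - q)) by ring.
have -> : (3 + D + 2 * A) / (1 - q) * q ^+ L = (3 + D + 2 * A) * (q ^+ L / (1 - q)) by ring.
move: (q ^+ L / (1 - q)) => Q.
set S1 := \sum_(0 <= i < L) _; set S2 := \sum_(0 <= i < L) _.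
move: (normc _) (normc _) (normc _) (normc _) (normc _) (normc _) (normc _).
move=> n1 n2 n3 n4 n5 n6 n7; lra.
Qed.

End LimitSymbol.

(** * Repeated weights *)

Section Perturbation.
Variable R : realType.

Lemma cvg_to_sum (I : Type) (s : seq I) (P : pred I) (T : Type) (F : set_system T)
    {FF : Filter F} (f : I -> T -> R) (l : I -> R) :
  (forall i, P i -> f i t @[t --> F] --> l i) ->
  \sum_(i <- s | P i) f i t @[t --> F] --> \sum_(i <- s | P i) l i.
Proof. by move=> fl; apply: cvg_big => // -[u v]; exact: (@add_continuous R). Qed.

Lemma cvg_to_prod (I : Type) (s : seq I) (P : pred I) (T : Type) (F : set_system T)
    {FF : Filter F} (f : I -> T -> R) (l : I -> R) :
  (forall i, P i -> f i t @[t --> F] --> l i) ->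
  \prod_(i <- s | P i) f i t @[t --> F] --> \prod_(i <- s | P i) l i.
Proof. by move=> fl; apply: cvg_big => // -[u v]; exact: (@mul_continuous R). Qed.

Lemma cvg_to_expr (T : Type) (F : set_system T) {FF : Filter F} (f : T -> R) (l : R) n :
  f t @[t --> F] --> l -> f t ^+ n @[t --> F] --> l ^+ n.
Proof.
move=> fl; elim: n => [|n IH]; first by under eq_fun do rewrite expr0; exact: cvg_cst.
by under eq_fun do rewrite exprS; rewrite exprS; exact: cvgM.
Qed.

Lemma cvg_meval n (p : mpoly.mpoly n R) (T : Type) (F : set_system T) {FF : Filter F}
    (f : T -> 'I_n -> R) (l : 'I_n -> R) :
  (forall i, f t i @[t --> F] --> l i) ->
  mpoly.meval (f t) p @[t --> F] --> mpoly.meval l p.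
Proof.
move=> fl; under eq_fun do rewrite mpoly.mevalE; rewrite mpoly.mevalE.
apply: cvg_to_sum => m _; apply: cvgM; first exact: cvg_cst.
by apply: cvg_to_prod => i _; exact: cvg_to_expr.
Qed.

Lemma cvg_wt K (beta : 'I_K -> R) (T : Type) (F : set_system T) {FF : Filter F}
    (f : T -> 'I_K -> R) k : beta k < 1 -> f t k @[t --> F] --> beta k ->
  wt (f t) k @[t --> F] --> wt beta k.
Proof.
move=> b1 fb; apply: cvgM => //; apply: cvgV; first by rewrite subr_eq0 gt_eqF.
by apply: cvgB => //; exact: cvg_cst.
Qed.

Lemma cvg_schur_weight N K (x : 'I_N -> R) (beta : 'I_K -> R) lam
    (T : Type) (F : set_system T) {FF : Filter F} (f : T -> 'I_N -> R) (g : T -> 'I_K -> R) :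
  (forall i, 0 < x i) -> (forall k, 0 < beta k < 1) ->
  (forall i, f t i @[t --> F] --> x i) -> (forall k, g t k @[t --> F] --> beta k) ->
  schur_weight (f t) (g t) lam @[t --> F] --> schur_weight x beta lam.
Proof.
move=> x0 b01 fx gb.
have wtb k : wt (g t) k @[t --> F] --> wt beta k.
  by apply: cvg_wt => //; case/andP: (b01 k).
have wt0 k : 0 < wt beta k by have /andP[b0 b1] := b01 k; rewrite divr_gt0 // subr_gt0.
apply: cvgM; last exact: cvg_meval.
apply: cvgM; last exact: cvg_meval.
apply: cvg_to_prod => i _; apply: cvg_to_prod => k _.
apply: cvgV; first by rewrite gt_eqF // ltr_pwDl // mulr_ge0 ?ltW.
by apply: cvgD; [exact: cvg_cst|exact: cvgM].
Qed.

(** A perturbation under which any two coordinates coincide for at most one value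
    of e; the coordinates become distinct for all small e > 0. *)
Definition spread n (u : 'I_n -> R) (e : R) (i : 'I_n) : R := u i + e * i%:R.

Lemma cvg_spread n (u : 'I_n -> R) i : spread u e i @[e --> 0^'+] --> u i.
Proof.
apply: cvg_at_right_filter; rewrite -[X in _ --> X]addr0 -[X in _ + X](mul0r i%:R).
by apply: cvgD; [exact: cvg_cst|apply: cvgMr_tmp; exact: cvg_id].
Qed.

Lemma spread_inj n (u : 'I_n -> R) : \forall e \near 0^'+, injective (spread u e).
Proof.
have : \forall e \near (0 : R)^'+, forall ij : 'I_n * 'I_n,
    ij.1 != ij.2 -> spread u e ij.1 != spread u e ij.2.
  apply: filter_forall => -[i j] /=.
  have [->|ij] := eqVneq i j; first by near=> e.
  have dij : j%:R - i%:R != 0 :> R by rewrite subr_eq0 eqr_nat eq_sym.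
  pose a := (u i - u j) / (j%:R - i%:R).
  suff : \forall e \near (0 : R)^'+, e != a.
    apply: filterS => e ea _; apply: contra_neq ea; rewrite /spread /a => h.
    by apply: (mulIf dij); rewrite mulfVK // mulrBr; move: h; lra.
  have [a0|a0] := ltP 0 a.
    by near=> e; rewrite lt_eqF //; near: e; exact: nbhs_right_lt.
  near=> e; rewrite gt_eqF //; apply: le_lt_trans a0 _; near: e; exact: nbhs_right_gt.
apply: filterS => e H i j h; apply/eqP; apply: contraT => ij.
by have := H (i, j) ij; rewrite h eqxx.
Unshelve. all: by end_near. Qed.

Lemma spread_between n (u : 'I_n -> R) a b : (forall i, a < u i < b) ->
  \forall e \near 0^'+, forall i, a < spread u e i < b.
Proof.
move=> uab; apply: filter_forall => i; have /andP[ua ub] := uab i.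
near=> e; apply/andP; split; near: e.
  exact: (cvgr_gt _ (@cvg_spread n u i)).
exact: (cvgr_lt _ (@cvg_spread n u i)).
Unshelve. all: by end_near. Qed.

Section Limit.
Variables (N K : nat) (delta : R) (x : 'I_N -> R) (beta : 'I_K -> R).
Hypotheses (delta0 : 0 <= delta) (x_in : forall i, delta < x i < 2 - delta).
Hypothesis beta_in : forall k, 0 < beta k < 1.

Let x0 i : 0 < x i.
Proof. by have /andP[h _] := x_in i; exact: le_lt_trans h. Qed.

Let admissible : \forall e \near (0 : R)^'+,
  [/\ injective (spread x e), injective (spread beta e),
      forall i, delta < spread x e i < 2 - delta
    & forall k, 0 < spread beta e k < 1].
Proof.
have := spread_inj x; have := spread_inj beta.
have := spread_between x_in; have := spread_between beta_in.
by move=> h1 h2 h3 h4; near=> e; split; near: e.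
Unshelve. all: by end_near. Qed.

Let cvg_weight lam :
  schur_weight (spread x e) (spread beta e) lam @[e --> 0^'+] --> schur_weight x beta lam.
Proof. by apply: cvg_schur_weight => //; exact: cvg_spread. Qed.

Lemma schur_weight_ge0 lam : is_part lam -> 0 <= schur_weight x beta lam.
Proof.
move=> lamP; apply: (cvgr_to_ge (@cvg_weight lam)).
apply: filterS admissible => e [xinj binj xe be]; apply: schur_weight_ge0_distinct => // i.
by have /andP[h _] := xe i; exact: le_lt_trans h.
Qed.

Lemma schur_weight_sum1 : \sum_(lam | is_part lam) schur_weight x beta lam = 1.
Proof.
have H : \sum_(lam | is_part lam) schur_weight (spread x e) (spread beta e) lam
    @[e --> 0^'+] --> \sum_(lam | is_part lam) schur_weight x beta lam.
  by apply: cvg_to_sum => lam _; exact: cvg_weight.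
apply: (cvg_unique _ H) => //; apply: cvg_near_cst.
apply: filterS admissible => e [xinj binj xe be]; apply: schur_weight_sum1_distinct => // i;
  have /andP[h1 h2] := xe i; first exact: le_lt_trans h1.
by apply: lt_le_trans h2 _; rewrite gerBl.
Qed.

End Limit.

(** Bounds, up to a constant factor, the distance of the moments from their
    limits for given weights. *)
Definition model_error (rho0 r A : R) (c g : nat -> R) (D : R) L N K
    (x : 'I_N -> R) (beta : 'I_K -> R) : R :=
  N%:R^-1 + symbol_error rho0 r A c g D L
    (fun i => N%:R^-1 * \sum_j (1 - x j) ^+ i) (fun i => N%:R^-1 * \sum_j beta j ^+ i).

Lemma cvg_model_error rho0 r A c g D L N K (x : 'I_N -> R) (beta : 'I_K -> R)
    (T : Type) (F : set_system T) {FF : Filter F} (f : T -> 'I_N -> R) (h : T -> 'I_K -> R) :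
  (forall i, f t i @[t --> F] --> x i) -> (forall k, h t k @[t --> F] --> beta k) ->
  model_error rho0 r A c g D L (f t) (h t) @[t --> F]
  --> model_error rho0 r A c g D L x beta.
Proof.
move=> fx hb.
have cy i : N%:R^-1 * \sum_j (1 - f t j) ^+ i @[t --> F] --> N%:R^-1 * \sum_j (1 - x j) ^+ i.
  apply: cvgMl_tmp; apply: cvg_to_sum => j _; apply: cvg_to_expr.
  by apply: cvgB; [exact: cvg_cst|exact: fx].
have cb i : N%:R^-1 * \sum_j h t j ^+ i @[t --> F] --> N%:R^-1 * \sum_j beta j ^+ i.
  by apply: cvgMl_tmp; apply: cvg_to_sum => j _; apply: cvg_to_expr; exact: hb.
apply: cvgD; first exact: cvg_cst.
apply: cvgMl_tmp; apply: cvgD; last exact: cvg_cst.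
apply: cvgD; last by apply: cvg_norm; apply: cvgB; [exact: (cb 0%N)|exact: cvg_cst].
apply: cvg_to_sum => i _; apply: cvgD.
  by apply: cvgMr_tmp; apply: cvg_norm; apply: cvgB; [exact: (cy i)|exact: cvg_cst].
by apply: cvg_norm; apply: cvgB; [exact: (cb i)|exact: cvg_cst].
Qed.

Definition product_moment_limit (A : R) (c g : nat -> R) r nu (k : 'I_nu -> nat) : R[i] :=
  \prod_(j < nu) ((k j).+1%:R^-1 *
    cmean r (fun z => z / (z - 1) * limit_symbol A c g z ^+ (k j).+1)).

(** Both sides of the estimate for distinct weights are continuous along the
    perturbation [spread], and the constant does not depend on the weights.  The
    limit is complex a priori; its two components are estimated separately. *)
Lemma product_moment_estimate (delta r D A : R) (c g : nat -> R) (nu : nat)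
    (k : 'I_nu -> nat) :
  0 < delta < 1 -> 1 - delta < r < 1 -> 1 <= D -> 0 <= A ->
  (forall i, `|c i| <= (1 - delta) ^+ i) -> (forall i, `|g i| <= 1) ->
  exists2 Cst : R, 0 <= Cst &
  forall (N K L : nat) (x : 'I_N -> R) (beta : 'I_K -> R),
    (0 < N)%N -> (forall j, (k j < N + K)%N) -> (N + K)%:R <= D * N%:R ->
    (forall i, delta < x i < 2 - delta) -> (forall j, 0 < beta j < 1) ->
    let Phi := \sum_(lam | is_part lam) schur_weight x beta lam *
        \prod_(j < nu) particle_moment R (k j) (fun i => lam i) in
    let m := product_moment_limit A c g r k in
    let bound := Cst * model_error (1 - delta) r A c g D L x beta in
    `|Phi - complex.Re m| <= bound /\ `|complex.Im m| <= bound.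
Proof.
move=> /andP[dl0 dl1] /andP[rhor r1] D1 A0 c_le g_le.
have rho0 : 0 <= 1 - delta by rewrite subr_ge0 ltW.
have G0 := symbol_bound_ge0 rho0 rhor r1 A0.
have [Cst Cst0 H] := product_moment_distinct k rho0 rhor r1 D1 G0.
exists Cst => // N K L x beta N0 kN NKD xin bin Phi m bound.
have KD : K%:R <= D * N%:R by apply: le_trans NKD; rewrite ler_nat leq_addl.
pose Phi' (x : 'I_N -> R) (beta : 'I_K -> R) :=
  \sum_(lam | is_part lam) schur_weight x beta lam *
    \prod_(j < nu) particle_moment R (k j) (fun i => lam i).
have dist (x' : 'I_N -> R) (beta' : 'I_K -> R) : injective x' -> injective beta' ->
    (forall i, delta < x' i < 2 - delta) -> (forall j, 0 < beta' j < 1) ->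
    normc ((Phi' x' beta')%:C - m) <= Cst * model_error (1 - delta) r A c g D L x' beta'.
  move=> xinj binj xi bi.
  have xr i : `|1 - x' i| <= 1 - delta.
    by have /andP[h1 h2] := xi i; rewrite ler_norml; apply/andP; split; lra.
  have E := poles_symbol_error rho0 rhor r1 A0 c_le g_le L N0 KD xr bi.
  apply: H => //.
  - exact: ccirc_limit_symbol rho0 rhor r1 c_le g_le.
  - by move=> z zr; apply: limit_symbol_le.
  - apply: le_trans (normc_ge0 _) (E r%:C _).
    by rewrite normcR ger0_norm // (le_trans rho0) // ltW.
have lim : \forall e \near (0 : R)^'+,
    normc ((Phi' (spread x e) (spread beta e))%:C - m)
    <= Cst * model_error (1 - delta) r A c g D L (spread x e) (spread beta e).
  have h1 := spread_inj x; have h2 := spread_inj beta.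
  have h3 := spread_between xin; have h4 := spread_between bin.
  by near=> e; apply: dist; near: e.
have x0 i : 0 < x i by have /andP[h _] := xin i; exact: lt_trans h.
have cPhi : Phi' (spread x e) (spread beta e) @[e --> 0^'+] --> Phi.
  apply: cvg_to_sum => lam _; apply: cvgMr_tmp.
  by apply: cvg_schur_weight => // i; exact: cvg_spread.
have cE : Cst * model_error (1 - delta) r A c g D L (spread x e) (spread beta e)
    @[e --> 0^'+] --> bound.
  by apply: cvgMl_tmp; apply: cvg_model_error => i; exact: cvg_spread.
split; rewrite -subr_le0.
  have cv : `|Phi' (spread x e) (spread beta e) - complex.Re m|
      - Cst * model_error (1 - delta) r A c g D L (spread x e) (spread beta e)
      @[e --> 0^'+] --> `|Phi - complex.Re m| - bound.
    by apply: cvgB => //; apply: cvg_norm; apply: cvgB => //; exact: cvg_cst.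
  apply: (cvgr_to_le cv); apply: filterS lim => e He; rewrite subr_le0.
  by apply: le_trans He; apply: le_trans (Re_le_normc _); rewrite raddfB.
have cv : `|complex.Im m|
    - Cst * model_error (1 - delta) r A c g D L (spread x e) (spread beta e)
    @[e --> 0^'+] --> `|complex.Im m| - bound.
  by apply: cvgB => //; exact: cvg_cst.
apply: (cvgr_to_le cv); apply: filterS lim => e He; rewrite subr_le0.
by apply: le_trans He; apply: le_trans (Im_le_normc _); rewrite raddfB /= sub0r normrN.
Unshelve. all: by end_near. Qed.

End Perturbation.

(** * Bounded random variables *)

Section BoundedRandomVariable.
Context d (T : measurableType d) (R : realType) (P : probability T R).
Implicit Types X Y : T -> R.

Definition mean X : R := fine 'E_P[X]%E.

(** Almost sure boundedness is what the supports of the weights provide, and it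
    makes all means below finite. *)
Definition bounded_rv X : Prop :=
  measurable_fun setT X /\ exists C : R, {ae P, forall t, `|X t| <= C}.

Lemma bounded_rv_integrable X : bounded_rv X -> P.-integrable setT (EFin \o X).
Proof.
move=> [mX [C XC]]; apply/integrableP; split; first exact/measurable_EFinP.
apply: (@le_lt_trans _ _ (\int[P]_(t in setT) (`|C|%:E))%E); last first.
  by rewrite integral_cst //= probability_setT mule1 ltry.
apply: ae_ge0_le_integral => //.
- by apply: measurableT_comp => //; exact/measurable_EFinP.
apply: filterS XC => t h _; rewrite /= lee_fin.
exact: le_trans h (ler_norm _).
Qed.

Lemma meanE X : bounded_rv X -> ('E_P[X])%E = (mean X)%:E.
Proof.
move=> bX; rewrite /mean fineK // unlock; apply: integrable_fin_num => //.
exact: bounded_rv_integrable.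
Qed.

Lemma mean_Rintegral X : mean X = \int[P]_t X t.
Proof. by rewrite /mean unlock. Qed.

Lemma bounded_rv_cst c : bounded_rv (fun=> c).
Proof. by split; [exact: measurable_cst|exists `|c|; apply: aeW]. Qed.

Lemma bounded_rvD X Y : bounded_rv X -> bounded_rv Y -> bounded_rv (fun t => X t + Y t).
Proof.
move=> [mX [C XC]] [mY [D YD]]; split; first exact: measurable_funD.
exists (C + D); apply: filterS2 XC YD => t h1 h2.
exact: le_trans (ler_normD _ _) (lerD h1 h2).
Qed.

Lemma bounded_rvM X Y : bounded_rv X -> bounded_rv Y -> bounded_rv (fun t => X t * Y t).
Proof.
move=> [mX [C XC]] [mY [D YD]]; split; first exact: measurable_funM.
exists (C * D); apply: filterS2 XC YD => t h1 h2.
by rewrite normrM; apply: ler_pM.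
Qed.

Lemma bounded_rvZ c X : bounded_rv X -> bounded_rv (fun t => c * X t).
Proof. by move=> bX; apply: bounded_rvM => //; exact: bounded_rv_cst. Qed.

Lemma bounded_rvB X Y : bounded_rv X -> bounded_rv Y -> bounded_rv (fun t => X t - Y t).
Proof.
move=> bX bY; have -> : (fun t => X t - Y t) = (fun t => X t + -1 * Y t).
  by apply/funext => t; rewrite mulN1r.
by apply: bounded_rvD => //; exact: bounded_rvZ.
Qed.

Lemma bounded_rv_norm X : bounded_rv X -> bounded_rv (fun t => `|X t|).
Proof.
move=> [mX [C XC]]; split; first exact: measurableT_comp.
by exists C; apply: filterS XC => t; rewrite normr_id.
Qed.

Lemma bounded_rvX X n : bounded_rv X -> bounded_rv (fun t => X t ^+ n).
Proof.
move=> bX; elim: n => [|n IH].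
  by under eq_fun do rewrite expr0; exact: bounded_rv_cst.
by under eq_fun do rewrite exprS; exact: bounded_rvM.
Qed.

Lemma bounded_rv_sum (I : Type) (s : seq I) (Q : pred I) (X : I -> T -> R) :
  (forall i, Q i -> bounded_rv (X i)) ->
  bounded_rv (fun t => \sum_(i <- s | Q i) X i t).
Proof.
move=> bX; elim: s => [|i s IH].
  by under eq_fun do rewrite big_nil; exact: bounded_rv_cst.
case Qi: (Q i); under eq_fun do rewrite big_cons Qi; last exact: IH.
by apply: bounded_rvD => //; exact: bX.
Qed.

Lemma mean_cst c : mean (fun=> c) = c.
Proof. by rewrite /mean expectation_cst. Qed.

Lemma eq_mean X Y : (forall t, X t = Y t) -> mean X = mean Y.
Proof. by move=> /funext ->. Qed.

Lemma meanD X Y : bounded_rv X -> bounded_rv Y ->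
  mean (fun t => X t + Y t) = mean X + mean Y.
Proof.
by move=> bX bY; rewrite !mean_Rintegral RintegralD //; exact: bounded_rv_integrable.
Qed.

Lemma meanZ c X : bounded_rv X -> mean (fun t => c * X t) = c * mean X.
Proof.
by move=> bX; rewrite !mean_Rintegral RintegralZl //; exact: bounded_rv_integrable.
Qed.

Lemma meanB X Y : bounded_rv X -> bounded_rv Y ->
  mean (fun t => X t - Y t) = mean X - mean Y.
Proof.
by move=> bX bY; rewrite !mean_Rintegral RintegralB //; exact: bounded_rv_integrable.
Qed.

Lemma mean_sum (I : Type) (s : seq I) (Q : pred I) (X : I -> T -> R) :
  (forall i, Q i -> bounded_rv (X i)) ->
  mean (fun t => \sum_(i <- s | Q i) X i t) = \sum_(i <- s | Q i) mean (X i).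
Proof.
move=> bX; elim: s => [|i s IH].
  by rewrite big_nil (eq_mean (fun t => big_nil _ _ _ _)) mean_cst.
rewrite big_cons (eq_mean (fun t => big_cons _ _ _ _ _ _)) -IH; case Qi: (Q i) => //.
by rewrite meanD //; [exact: bX|exact: bounded_rv_sum].
Qed.

Lemma ae_mean_le X Y : bounded_rv X -> bounded_rv Y ->
  {ae P, forall t, X t <= Y t} -> mean X <= mean Y.
Proof.
move=> bX bY XY; rewrite -subr_ge0 -meanB //.
have bZ := bounded_rvB bY bX; set Z := fun t => _ in bZ *.
have -> : mean Z = mean (fun t => `|Z t|).
  rewrite /mean unlock; congr fine; apply: ae_eq_integral => //.
  - by apply/measurable_EFinP; case: bZ.
  - by apply/measurable_EFinP; case: (bounded_rv_norm bZ).
  by apply: filterS XY => t h _; rewrite /= ger0_norm // subr_ge0.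
by rewrite mean_Rintegral; apply: Rintegral_ge0.
Qed.

Lemma ae_mean_ge0 X : bounded_rv X -> {ae P, forall t, 0 <= X t} -> 0 <= mean X.
Proof.
by move=> bX X0; rewrite -(mean_cst 0); apply: ae_mean_le => //; exact: bounded_rv_cst.
Qed.

Lemma mean_norm_le X : bounded_rv X -> `|mean X| <= mean (fun t => `|X t|).
Proof.
move=> bX; have bn := bounded_rv_norm bX; rewrite ler_norml -mulN1r -meanZ //.
apply/andP; split; apply: ae_mean_le => //; try exact: bounded_rvZ; apply: aeW => t.
  by rewrite mulN1r lerNl -normrN ler_norm.
exact: ler_norm.
Qed.

(** Passes from L^2 to L^1: |X| <= e + X^2 / e. *)
Lemma mean_norm_sqr_le X e : bounded_rv X -> 0 < e ->
  mean (fun t => `|X t|) <= e + mean (fun t => X t ^+ 2) / e.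
Proof.
move=> bX e0; have b2 := bounded_rvX 2 bX.
rewrite -[X in X + _](mean_cst e) [mean (fun t => X t ^+ 2) / e]mulrC -meanZ // -meanD;
  [|exact: bounded_rv_cst|exact: bounded_rvZ].
apply: ae_mean_le; [exact: bounded_rv_norm| |].
  by apply: bounded_rvD; [exact: bounded_rv_cst|exact: bounded_rvZ].
apply: aeW => t; rewrite mulrC -real_normK ?num_real //.
move: `|X t| (normr_ge0 (X t)) => u u0.
rewrite -(ler_pM2r e0) mulrDl mulfVK ?gt_eqF //.
have := sqr_ge0 (u - e); rewrite sqrrB; move: (u ^+ 2) (mulr_ge0 u0 (ltW e0)) => v.
by rewrite -!expr2; move: (sqr_ge0 e); lra.
Qed.

End BoundedRandomVariable.

(** * Averaging over the weights *)

Section RandomWeights.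
Context d (T : measurableType d) (R : realType).

Lemma measurable_meval n (p : mpoly.mpoly n R) (f : T -> 'I_n -> R) :
  (forall i, measurable_fun setT (f ^~ i)) ->
  measurable_fun setT (fun t => mpoly.meval (f t) p).
Proof.
move=> mf; under eq_fun do rewrite mpoly.mevalE.
apply: measurable_sum => m; apply: measurable_funM; first exact: measurable_cst.
by apply: measurable_prod => i _; exact: measurable_funX.
Qed.

(** Inversion is discontinuous at 0, but u^-1 is u times the power -1 of u ^+
    2. *)
Lemma measurable_inv_fun (f : T -> R) :
  measurable_fun setT f -> measurable_fun setT (fun t => (f t)^-1).
Proof.
move=> mf; have -> : (fun t => (f t)^-1) = (fun t => f t * (f t ^+ 2) `^ (-1)).
  apply/funext => t; rewrite powR_inv1 ?sqr_ge0 //.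
  have [->|f0] := eqVneq (f t) 0; first by rewrite invr0 mul0r.
  by rewrite expr2 invfM mulrA divff // mul1r.
apply: measurable_funM => //.
exact: (measurableT_comp (measurable_powR (-1)) (measurable_funX 2 mf)).
Qed.

Lemma measurable_schur_weight N K (f : T -> 'I_N -> R) (g : T -> 'I_K -> R) lam :
  (forall i, measurable_fun setT (f ^~ i)) -> (forall k, measurable_fun setT (g ^~ k)) ->
  measurable_fun setT (fun t => schur_weight (f t) (g t) lam).
Proof.
move=> mf mg.
have mw k : measurable_fun setT (fun t => wt (g t) k).
  apply: measurable_funM => //; apply: measurable_inv_fun.
  by apply: measurable_funB => //; exact: measurable_cst.
apply: measurable_funM; last exact: measurable_meval.
apply: measurable_funM; last exact: measurable_meval.
apply: measurable_prod => i _; apply: measurable_prod => k _.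
apply: measurable_inv_fun; apply: measurable_funD; first exact: measurable_cst.
exact: measurable_funM.
Qed.

Lemma schur_measureE N M (x beta : nat -> R) (lam : {ffun 'I_N -> 'I_(M - N).+1}) :
  (N <= M)%N -> schur_measure M x beta (fun i => lam i)
  = schur_weight (fun i : 'I_N => x i) (fun k : 'I_(M - N) => beta (N + k)%N) lam.
Proof.
move=> NM; rewrite /schur_measure /schur_weight; congr (_ * _ * _).
rewrite big_mkord; apply: eq_bigr => i _.
by rewrite -{1}[N]add0n big_addn big_mkord; apply: eq_bigr => k _; rewrite addnC.
Qed.

Variables (P : probability T R) (N M : nat) (delta : R) (x beta : nat -> T -> R).
Hypotheses (NM : (N <= M)%N) (delta0 : 0 <= delta).
Hypotheses (mx : forall i, measurable_fun setT (x i))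
  (mbeta : forall i, measurable_fun setT (beta i)).
Hypothesis x_in : forall i, (i < M)%N -> {ae P, forall t, delta < x i t < 2 - delta}.
Hypothesis beta_in : forall i, (i < M)%N -> {ae P, forall t, 0 < beta i t < 1}.

Let xw t (i : 'I_N) := x i t.
Let bw t (k : 'I_(M - N)) := beta (N + k)%N t.

Lemma ae_weights_in :
  {ae P, forall t, (forall i, delta < xw t i < 2 - delta) /\ forall k, 0 < bw t k < 1}.
Proof.
have hx : {ae P, forall t, forall i, delta < xw t i < 2 - delta}.
  apply: filter_forall => i; apply: x_in.
  exact: leq_trans (ltn_ord i) NM.
have hb : {ae P, forall t, forall k, 0 < bw t k < 1}.
  by apply: filter_forall => k; apply: beta_in; rewrite -ltn_subRL.
by apply: filterS2 hx hb.
Qed.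

(** The Schur weights are nonnegative and sum to 1. *)
Lemma bounded_schur_weight lam : is_part lam ->
  bounded_rv P (fun t => schur_weight (xw t) (bw t) lam).
Proof.
move=> lamP; split.
  by apply: measurable_schur_weight => i; [exact: mx|exact: mbeta].
exists 1; apply: filterS ae_weights_in => t [hx hb].
have ge0 mu := schur_weight_ge0 delta0 hx hb (lam := mu).
rewrite ger0_norm ?ge0 //.
rewrite -(schur_weight_sum1 delta0 hx hb) (bigD1 lam) //= lerDl sumr_ge0 //.
by move=> mu /andP[/ge0].
Qed.

Lemma avg_schur_expectationE (f : ('I_N -> nat) -> R) :
  avg_schur_expectation P M x beta f = mean P (fun t =>
    \sum_(lam : {ffun 'I_N -> 'I_(M - N).+1} | is_part lam)
      schur_weight (xw t) (bw t) lam * f (fun i => lam i)).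
Proof.
rewrite mean_sum => [|lam lamP]; last first.
  by apply: bounded_rvM; [exact: bounded_schur_weight|exact: bounded_rv_cst].
apply: eq_bigr => lam lamP; rewrite /avg_schur_measure.
have -> : mean P (fun t => schur_weight (xw t) (bw t) lam * f (fun i => lam i))
    = f (fun i => lam i) * mean P (fun t => schur_weight (xw t) (bw t) lam).
  rewrite -meanZ; last exact: bounded_schur_weight.
  by apply: eq_mean => t; rewrite mulrC.
rewrite mulrC; congr (_ * _); apply: (@eq_mean _ _ _ P) => t.
exact: schur_measureE.
Qed.

Lemma bounded_x i : (i < M)%N -> bounded_rv P (x i).
Proof.
move=> iM; split; first exact: mx.
exists 2; apply: filterS (x_in iM) => t /andP[h1 h2].
by rewrite ger0_norm ?(le_trans delta0 (ltW h1)) // (le_trans (ltW h2)) // gerBl.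
Qed.

Lemma bounded_beta i : (i < M)%N -> bounded_rv P (beta i).
Proof.
move=> iM; split; first exact: mbeta.
by exists 1; apply: filterS (beta_in iM) => t /andP[h1 h2]; rewrite ger0_norm ltW.
Qed.

Definition y_power_mean i t : R := N%:R^-1 * \sum_(j < N) (1 - x j t) ^+ i.
Definition b_power_mean i t : R := N%:R^-1 * \sum_(k < M - N) beta (N + k)%N t ^+ i.

Lemma bounded_y_power_mean i : bounded_rv P (y_power_mean i).
Proof.
apply: bounded_rvZ; apply: bounded_rv_sum => j _; apply: bounded_rvX.
apply: bounded_rvB; first exact: bounded_rv_cst.
by apply: bounded_x; exact: leq_trans (ltn_ord j) NM.
Qed.

Lemma bounded_b_power_mean i : bounded_rv P (b_power_mean i).
Proof.
apply: bounded_rvZ; apply: bounded_rv_sum => k _; apply: bounded_rvX.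
by apply: bounded_beta; rewrite -ltn_subRL.
Qed.

Variables (r A D : R) (c g : nat -> R) (L : nat).

Let bd X a : bounded_rv P X -> bounded_rv P (fun t => `|X t - a|).
Proof. by move=> bX; apply: bounded_rv_norm; apply: bounded_rvB => //; exact: bounded_rv_cst. Qed.

Let bterm i : bounded_rv P (fun t =>
  `|y_power_mean i t - c i| * r^-1 ^+ i + `|b_power_mean i t - A * g i|).
Proof.
apply: bounded_rvD; last by apply: bd; exact: bounded_b_power_mean.
apply: bounded_rvM; first by apply: bd; exact: bounded_y_power_mean.
exact: bounded_rv_cst.
Qed.

Let bsum : bounded_rv P (fun t => \sum_(0 <= i < L)
  (`|y_power_mean i t - c i| * r^-1 ^+ i + `|b_power_mean i t - A * g i|)).
Proof. by apply: bounded_rv_sum => i _; exact: bterm. Qed.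

Lemma bounded_model_error :
  bounded_rv P (fun t => model_error (1 - delta) r A c g D L (xw t) (bw t)).
Proof.
apply: bounded_rvD; first exact: bounded_rv_cst.
apply: bounded_rvZ; apply: bounded_rvD; last exact: bounded_rv_cst.
apply: bounded_rvD; first exact: bsum.
by apply: bd; exact: bounded_b_power_mean 0%N.
Qed.

Lemma mean_model_error :
  mean P (fun t => model_error (1 - delta) r A c g D L (xw t) (bw t))
  = N%:R^-1 + 2 / r * (\sum_(0 <= i < L)
      (mean P (fun t => `|y_power_mean i t - c i|) * r^-1 ^+ i
       + mean P (fun t => `|b_power_mean i t - A * g i|))
    + mean P (fun t => `|b_power_mean 0 t - A|)
    + (3 + D + 2 * A) / (1 - circle_ratio (1 - delta) r) * circle_ratio (1 - delta) r ^+ L).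
Proof.
have b0 : bounded_rv P (fun t => `|b_power_mean 0 t - A|) by apply: bd; exact: bounded_b_power_mean.
have cc a := bounded_rv_cst P a.
have b1 := bounded_rvD bsum b0.
rewrite meanD; [|exact: cc|exact: bounded_rvZ (bounded_rvD b1 (cc _))].
rewrite mean_cst; congr (_ + _).
rewrite meanZ; last exact: bounded_rvD b1 (cc _).
congr (_ * _); rewrite meanD; [|exact: b1|exact: cc].
rewrite mean_cst; congr (_ + _).
rewrite meanD; [|exact: bsum|exact: b0]; congr (_ + _).
rewrite mean_sum => [|i _]; last exact: bterm.
apply: eq_bigr => i _.
have by_ : bounded_rv P (fun t => `|y_power_mean i t - c i|) by apply: bd; exact: bounded_y_power_mean.
have bb : bounded_rv P (fun t => `|b_power_mean i t - A * g i|) by apply: bd; exact: bounded_b_power_mean.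
rewrite meanD; [|exact: bounded_rvM by_ (cc _)|exact: bb]; congr (_ + _).
by rewrite mulrC -meanZ //; apply: eq_mean => t; rewrite mulrC.
Qed.

Lemma avg_expectation_sub_le (f : ('I_N -> nat) -> R) (a Cst : R) :
  (forall t, (forall i, delta < xw t i < 2 - delta) -> (forall k, 0 < bw t k < 1) ->
    `|\sum_(lam | is_part lam) schur_weight (xw t) (bw t) lam * f (fun i => lam i) - a|
    <= Cst * model_error (1 - delta) r A c g D L (xw t) (bw t)) ->
  `|avg_schur_expectation P M x beta f - a|
  <= Cst * mean P (fun t => model_error (1 - delta) r A c g D L (xw t) (bw t)).
Proof.
move=> H; rewrite avg_schur_expectationE.
have bPhi : bounded_rv P (fun t => \sum_(lam : {ffun 'I_N -> 'I_(M - N).+1} | is_part lam)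
      schur_weight (xw t) (bw t) lam * f (fun i => lam i)).
  apply: bounded_rv_sum => lam lamP.
  by apply: bounded_rvM; [exact: bounded_schur_weight|exact: bounded_rv_cst].
have ca := bounded_rv_cst P a.
rewrite -{1}(mean_cst P a) -meanB // -meanZ; last exact: bounded_model_error.
apply: le_trans (mean_norm_le (bounded_rvB bPhi ca)) _.
apply: ae_mean_le; first exact: bounded_rv_norm (bounded_rvB bPhi ca).
  by apply: bounded_rvZ; exact: bounded_model_error.
by apply: filterS ae_weights_in => t [hx hb]; exact: H.
Qed.

Lemma le_mean_model_error (a Cst : R) :
  (forall t, (forall i, delta < xw t i < 2 - delta) -> (forall k, 0 < bw t k < 1) ->
    a <= Cst * model_error (1 - delta) r A c g D L (xw t) (bw t)) ->
  a <= Cst * mean P (fun t => model_error (1 - delta) r A c g D L (xw t) (bw t)).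
Proof.
move=> H; rewrite -meanZ; last exact: bounded_model_error.
rewrite -{1}(mean_cst P a); apply: ae_mean_le; first exact: bounded_rv_cst.
  by apply: bounded_rvZ; exact: bounded_model_error.
by apply: filterS ae_weights_in => t [hx hb]; exact: H.
Qed.

End RandomWeights.

(** * Convergence of the power means of the weights *)

Section PowerMeanLLN.
Variable R : realType.

(** Changing the number of terms affects the sum and the normalization, both by
    a relative amount |n - n'| / n. *)
Lemma power_mean_truncation_le (u : nat -> R) (C : R) n n' M : 0 <= C ->
  (0 < n <= M)%N -> (n' <= M)%N -> (forall j, (j < M)%N -> `|u j| <= C) ->
  `|n%:R^-1 * \sum_(0 <= j < n) u j - n'%:R^-1 * \sum_(0 <= j < n') u j|
  <= 2 * C * (`|n%:R - n'%:R| / n%:R).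
Proof.
move=> C0 /andP[n0 nM] n'M uC; have nR : 0 < n%:R :> R by rewrite ltr0n.
have part p q : (q <= M)%N -> `|\sum_(p <= j < q) u j| <= (q - p)%:R * C.
  move=> qM; apply: le_trans (ler_norm_sum _ _ _) _.
  rewrite mulr_natl -[X in (X - _)%N]addn0 -sumr_const_nat addn0 big_nat [leRHS]big_nat.
  by apply: ler_sum => j /andP[_ jq]; apply: uC; exact: leq_trans jq qM.
have diff : `|\sum_(0 <= j < n) u j - \sum_(0 <= j < n') u j| <= `|n%:R - n'%:R| * C.
  have [nn'|/ltnW n'n] := leqP n n'.
    rewrite distrC (@big_cat_nat _ _ _ n 0 n') //= addrAC subrr add0r.
    by rewrite distrC -natrB // normr_nat; exact: part.
  rewrite (@big_cat_nat _ _ _ n' 0 n) //= addrAC subrr add0r.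
  by rewrite -natrB // normr_nat; exact: part.
have Sn' := part 0%N n' n'M; rewrite subn0 in Sn'.
set S := \sum_(0 <= j < n) u j in diff *; set S' := \sum_(0 <= j < n') u j in diff Sn' *.
have [n'0|n'0] := posnP n'.
  rewrite n'0 invr0 mul0r subr0 normrM gtr0_norm ?invr_gt0 // subr0.
  have := part 0%N n nM; rewrite subn0 -/S => SC.
  rewrite [`|n%:R|]gtr0_norm // divff ?gt_eqF // mulr1.
  rewrite mulrC ler_pdivrMr //; apply: le_trans SC _.
  by rewrite mulrC ler_wpM2r ?ler0n // ler_peMl // ler1n.
have n'R : 0 < n'%:R :> R by rewrite ltr0n.
have -> : n%:R^-1 * S - n'%:R^-1 * S'
    = n%:R^-1 * (S - S') + n%:R^-1 * (n'%:R^-1 * S' * (n'%:R - n%:R)).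
  by field; rewrite !gt_eqF.
apply: le_trans (ler_normD _ _) _.
have iN : 0 <= n%:R^-1 :> R by rewrite invr_ge0 ltW.
have e1 : `|n%:R^-1 * (S - S')| <= n%:R^-1 * (`|n%:R - n'%:R| * C).
  by rewrite normrM (ger0_norm iN) ler_wpM2l.
have e2 : `|n%:R^-1 * (n'%:R^-1 * S' * (n'%:R - n%:R))| <= n%:R^-1 * (C * `|n%:R - n'%:R|).
  rewrite normrM (ger0_norm iN) ler_wpM2l // normrM distrC ler_wpM2r //.
  by rewrite normrM gtr0_norm ?invr_gt0 // mulrC ler_pdivrMr // mulrC.
by apply: le_trans (lerD e1 e2) _; rewrite le_eqVlt; apply/orP; left; apply/eqP; ring.
Qed.

End PowerMeanLLN.

Section TriangularArray.
Variables (R : realType) (d : nat -> measure_display) (T : forall M, measurableType (d M)).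
Variable P : forall M, probability (T M) R.
Variables (u : forall M, nat -> T M -> R) (B : R) (a : nat -> R).
Arguments u : clear implicits.
Hypotheses (mu : forall M i, measurable_fun setT (u M i)) (B0 : 0 <= B).
Hypothesis uB : forall M i, (i < M)%N -> {ae P M, forall t, `|u M i t| <= B}.

Lemma ae_array_le M : {ae P M, forall t, forall i, (i < M)%N -> `|u M i t| <= B}.
Proof.
have : {ae P M, forall t, forall i : 'I_M, `|u M i t| <= B}.
  by apply: filter_forall => i; exact: uB.
by apply: filterS => t H i iM; exact: (H (Ordinal iM)).
Qed.

Lemma bounded_array_power_mean N M k : (N <= M)%N ->
  bounded_rv (P M) (fun t => power_mean N k (fun j => u M j t)).
Proof.
move=> NM; rewrite /power_mean; under eq_fun do rewrite big_mkord.
apply: bounded_rvZ; apply: bounded_rv_sum => i _; apply: bounded_rvX.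
split; first exact: mu.
by exists B; apply: uB; exact: leq_trans (ltn_ord i) NM.
Qed.

Let trunc_le (gam : R) M : 0 < gam <= 1 -> (Num.truncn (gam * M%:R) <= M)%N.
Proof.
move=> /andP[g0 g1]; rewrite -[leqRHS](@natrK R M).
by apply: le_truncn; rewrite ler_piMl.
Qed.

(** Convergence of the first two moments, that is, convergence in L^2 to the
    constant a k. *)
Definition array_LLN := forall gam : R, 0 < gam <= 1 -> forall k,
  'E_(P M)[fun t => power_mean (Num.truncn (gam * M%:R)) k (fun j => u M j t)]%E
    @[M --> \oo] --> (a k)%:E /\
  'E_(P M)[fun t => (power_mean (Num.truncn (gam * M%:R)) k (fun j => u M j t) ^+ 2)%R]%E
    @[M --> \oo] --> (a k ^+ 2)%:E.

Hypothesis LLN : array_LLN.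

Lemma array_mean_cvg k :
  mean (P M) (fun t => power_mean M k (fun j => u M j t)) @[M --> \oo] --> a k.
Proof.
have [H _] := LLN (gam := 1) ltac:(by rewrite ltr01 lexx) k.
apply: fine_cvg; move: H; under eq_fun do rewrite mul1r natrK.
exact.
Qed.

(** Expanding the square shows L^2 convergence. *)
Lemma array_L1_trunc (gam : R) k : 0 < gam <= 1 ->
  mean (P M) (fun t => `|power_mean (Num.truncn (gam * M%:R)) k (fun j => u M j t) - a k|)
    @[M --> \oo] --> (0 : R).
Proof.
move=> g01; have [/fine_cvg H1 /fine_cvg H2] := LLN g01 k.
pose X M t := power_mean (Num.truncn (gam * M%:R)) k (fun j => u M j t).
have bX M : bounded_rv (P M) (X M) by apply: bounded_array_power_mean; exact: trunc_le.
have bXa M : bounded_rv (P M) (fun t => X M t - a k).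
  by apply: bounded_rvB => //; exact: bounded_rv_cst.
have L2 : mean (P M) (fun t => (X M t - a k) ^+ 2) @[M --> \oo] --> (0 : R).
  have -> : (fun M => mean (P M) (fun t => (X M t - a k) ^+ 2))
      = (fun M => mean (P M) (fun t => X M t ^+ 2) - 2 * a k * mean (P M) (X M) + a k ^+ 2).
    apply/funext => M; have b2 := bounded_rvX 2 (bX M).
    rewrite -meanZ // -meanB //; last exact: bounded_rvZ.
    rewrite -[X in _ + X](mean_cst (P M)) -meanD; last exact: bounded_rv_cst.
      by apply: eq_mean => t; ring.
    by apply: bounded_rvB => //; exact: bounded_rvZ.
  have -> : (0 : R) = a k ^+ 2 - 2 * a k * a k + a k ^+ 2 by ring.
  apply: cvgD; last exact: cvg_cst.
  by apply: cvgB; [exact: H2|apply: cvgMl_tmp; exact: H1].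
apply/cvgrPdist_le => e e0; have e2 : 0 < e / 2 by rewrite divr_gt0.
have e4 : 0 < (e / 2) ^+ 2 by rewrite exprn_gt0.
move/cvgrPdist_le: L2 => /(_ _ e4); apply: filterS => M.
have m2 : 0 <= mean (P M) (fun t => (X M t - a k) ^+ 2).
  by apply: ae_mean_ge0; [exact: bounded_rvX|apply: aeW => t; exact: sqr_ge0].
have m1 : 0 <= mean (P M) (fun t => `|X M t - a k|).
  by apply: ae_mean_ge0; [exact: bounded_rv_norm|apply: aeW].
rewrite !sub0r !normrN !ger0_norm // => H.
apply: le_trans (mean_norm_sqr_le (bXa M) e2) _.
rewrite [leRHS](splitr e) lerD2l ler_pdivrMr //.
Qed.

Variables (N M : nat -> nat) (gamma : R).
Hypotheses (gamma01 : 0 < gamma <= 1) (NM : forall n, (0 < N n <= M n)%N).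
Hypotheses (N_oo : N @ \oo --> \oo) (M_oo : M @ \oo --> \oo).
Hypothesis NM_gamma : ((N n)%:R / (M n)%:R : R) @[n --> \oo] --> gamma.

Lemma cvg_inv_ratio : ((M n)%:R / (N n)%:R : R) @[n --> \oo] --> gamma^-1.
Proof.
under eq_fun do rewrite -invf_div; apply: cvgV => //.
by rewrite gt_eqF //; case/andP: gamma01.
Qed.

Lemma cvg_inv_N : ((N n)%:R^-1 : R) @[n --> \oo] --> (0 : R).
Proof.
apply/cvgrPdist_lt => e e0.
have : \forall n \near \oo, (Num.truncn e^-1 < N n)%N := N_oo (nbhs_infty_gt _).
apply: filterS => n H; have n0 : 0 < (N n)%:R :> R by rewrite ltr0n; apply: leq_ltn_trans H.
rewrite sub0r normrN gtr0_norm ?invr_gt0 // invf_plt //.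
by apply: lt_le_trans (truncnS_gt _) _; rewrite ler_nat.
Qed.

(** N n and the integer part of gamma * M n differ by o(N n) and the entries
    are bounded. *)
Lemma array_L1 k :
  mean (P (M n)) (fun t => `|power_mean (N n) k (fun j => u (M n) j t) - a k|)
    @[n --> \oo] --> (0 : R).
Proof.
pose N' n := Num.truncn (gamma * (M n)%:R).
have N'M n : (N' n <= M n)%N by exact: trunc_le.
have C0 : 0 <= B ^+ k by exact: exprn_ge0.
pose s n : R := 2 * B ^+ k * (`|1 - gamma * ((M n)%:R / (N n)%:R)| + (N n)%:R^-1).
have cs : s n @[n --> \oo] --> (0 : R).
  have -> : (0 : R) = 2 * B ^+ k * (`|1 - gamma * gamma^-1| + 0).
    by rewrite divff ?subrr ?normr0 ?addr0 ?mulr0 // gt_eqF //; case/andP: gamma01.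
  apply: cvgMl_tmp; apply: cvgD; last exact: cvg_inv_N.
  apply: cvg_norm; apply: cvgB; first exact: cvg_cst.
  by apply: cvgMl_tmp; exact: cvg_inv_ratio.
have c1 : mean (P (M n)) (fun t => `|power_mean (N' n) k (fun j => u (M n) j t) - a k|)
    @[n --> \oo] --> (0 : R).
  exact: (cvg_comp M _ M_oo (array_L1_trunc k gamma01)).
have cu : s n + mean (P (M n)) (fun t => `|power_mean (N' n) k (fun j => u (M n) j t) - a k|)
    @[n --> \oo] --> (0 : R).
  by rewrite -[X in _ --> X]addr0; apply: cvgD.
apply: (squeeze_cvgr _ (cvg_cst (0 : R)) cu); apply: nearW => n.
have /andP[n0 nM] := NM n.
have bd p : (p <= M n)%N ->
    bounded_rv (P (M n)) (fun t => power_mean p k (fun j => u (M n) j t) - a k).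
  move=> pM; apply: bounded_rvB; first exact: bounded_array_power_mean.
  exact: bounded_rv_cst.
have b1 := bounded_rv_norm (bd _ nM); have b2 := bounded_rv_norm (bd _ (N'M n)).
rewrite ae_mean_ge0 //=; last exact: aeW.
rewrite -(mean_cst (P (M n)) (s n)) -meanD //; last exact: bounded_rv_cst.
apply: ae_mean_le => //; first by apply: bounded_rvD => //; exact: bounded_rv_cst.
apply: filterS (ae_array_le (M n)) => t H.
set X := power_mean (N n) _ _; set Y := power_mean (N' n) _ _.
have XY : `|X - Y| <= s n.
  apply: (@le_trans _ _ (2 * B ^+ k * (`|(N n)%:R - (N' n)%:R| / (N n)%:R))).
    apply: (@power_mean_truncation_le R (fun j => u (M n) j t ^+ k) _ _ _ _ C0 (NM n) (N'M n)).
    by move=> j jM; rewrite normrX lerXn2r ?nnegrE // H.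
  rewrite ler_wpM2l ?mulr_ge0 //.
  have nR : 0 < (N n)%:R :> R by rewrite ltr0n.
  rewrite ler_pdivrMr // mulrDl mulVf ?gt_eqF //.
  have -> : `|1 - gamma * ((M n)%:R / (N n)%:R)| * (N n)%:R = `|(N n)%:R - gamma * (M n)%:R|.
    rewrite -[X in _ * X](gtr0_norm nR) -normrM mulrBl mul1r -mulrA mulfVK //.
    by rewrite gt_eqF.
  apply: le_trans (ler_distD (gamma * (M n)%:R) _ _) _; rewrite lerD2l.
  have /truncn_itv/andP[h1 h2] : 0 <= gamma * (M n)%:R.
    by rewrite mulr_ge0 //; case/andP: gamma01 => /ltW.
  by rewrite ger0_norm ?subr_ge0 // lerBlDr -natr1 addrC in h2 *; exact: ltW.
have -> : X - a k = (X - Y) + (Y - a k) by rewrite addrA subrK.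
by apply: le_trans (ler_normD _ _) _; rewrite lerD2r.
Qed.

Lemma array_L1_full k :
  mean (P (M n)) (fun t => `|power_mean (M n) k (fun j => u (M n) j t) - a k|)
    @[n --> \oo] --> (0 : R).
Proof.
have := array_L1_trunc k (gam := 1) ltac:(by rewrite ltr01 lexx).
under eq_fun do rewrite mul1r natrK; move=> H.
exact: (cvg_comp M _ M_oo H).
Qed.

Let bdist p n k : (p <= M n)%N ->
  bounded_rv (P (M n)) (fun t => `|power_mean p k (fun j => u (M n) j t) - a k|).
Proof.
move=> pM; apply: bounded_rv_norm; apply: bounded_rvB; first exact: bounded_array_power_mean.
exact: bounded_rv_cst.
Qed.

Lemma power_mean_one_sub n i (v : nat -> R) : power_mean n i (fun j => 1 - v j)
  = \sum_(k < i.+1) (-1) ^+ k *+ 'C(i, k) * power_mean n k v.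
Proof.
rewrite /power_mean; under [RHS]eq_bigr do rewrite mulrCA mulr_sumr.
rewrite -mulr_sumr exchange_big; congr (_ * _); apply: eq_bigr => j _.
rewrite exprBn; apply: eq_bigr => k _.
by rewrite expr1n mulr1 mulrnAl.
Qed.

(** The binomial expansion of the limit of the i-th power mean of 1 - u. *)
Definition one_sub_moment i : R := \sum_(k < i.+1) (-1) ^+ k *+ 'C(i, k) * a k.

Lemma one_sub_mean_cvg i :
  mean (P M') (fun t => power_mean M' i (fun j => 1 - u M' j t)) @[M' --> \oo]
  --> one_sub_moment i.
Proof.
have -> : (fun M' => mean (P M') (fun t => power_mean M' i (fun j => 1 - u M' j t)))
    = (fun M' => \sum_(k < i.+1) (-1) ^+ k *+ 'C(i, k)
         * mean (P M') (fun t => power_mean M' k (fun j => u M' j t))).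
  apply/funext => M'; rewrite (eq_mean _ (fun t => power_mean_one_sub _ _ _)).
  rewrite mean_sum => [|k _]; last by apply: bounded_rvZ; exact: bounded_array_power_mean.
  by apply: eq_bigr => k _; rewrite meanZ //; exact: bounded_array_power_mean.
by apply: cvg_to_sum => k _; apply: cvgMl_tmp; exact: array_mean_cvg.
Qed.

Lemma one_sub_L1 i :
  mean (P (M n)) (fun t => `|power_mean (N n) i (fun j => 1 - u (M n) j t) - one_sub_moment i|)
    @[n --> \oo] --> (0 : R).
Proof.
pose w k : R := (-1) ^+ k *+ 'C(i, k).
have cu : \sum_(k < i.+1) `|w k| *
    mean (P (M n)) (fun t => `|power_mean (N n) k (fun j => u (M n) j t) - a k|)
    @[n --> \oo] --> (0 : R).
  rewrite [X in _ --> X](_ : _ = \sum_(k < i.+1) `|w k| * 0); last first.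
    by rewrite big1 // => k _; rewrite mulr0.
  by apply: cvg_to_sum => k _; apply: cvgMl_tmp; exact: array_L1.
apply: (squeeze_cvgr _ (cvg_cst (0 : R)) cu); apply: nearW => n.
have /andP[n0 nM] := NM n.
have bw : bounded_rv (P (M n)) (fun t => \sum_(k < i.+1) w k *
    power_mean (N n) k (fun j => u (M n) j t)).
  by apply: bounded_rv_sum => k _; apply: bounded_rvZ; exact: bounded_array_power_mean.
have bl : bounded_rv (P (M n))
    (fun t => `|power_mean (N n) i (fun j => 1 - u (M n) j t) - one_sub_moment i|).
  under eq_fun do rewrite power_mean_one_sub.
  by apply: bounded_rv_norm; apply: bounded_rvB => //; exact: bounded_rv_cst.
rewrite ae_mean_ge0 //=; last exact: aeW.
under eq_bigr => k _ do rewrite -(meanZ _ (bdist k nM)).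
rewrite -mean_sum => [|k _]; last by apply: bounded_rvZ; exact: bdist.
apply: ae_mean_le => //; first by apply: bounded_rv_sum => k _; apply: bounded_rvZ; exact: bdist.
apply: aeW => t; rewrite power_mean_one_sub -sumrB.
apply: le_trans (ler_norm_sum _ _ _) _; apply: ler_sum => k _.
by rewrite -mulrBr normrM.
Qed.

(** A sum over N <= j < M is the difference of two sums that start at 0. *)
Lemma b_power_meanE n i t : (N n)%:R^-1 * \sum_(j < M n - N n) u (M n) (N n + j)%N t ^+ i
  = (M n)%:R / (N n)%:R * power_mean (M n) i (fun j => u (M n) j t)
    - power_mean (N n) i (fun j => u (M n) j t).
Proof.
have /andP[n0 nM] := NM n.
have M0 : (M n)%:R != 0 :> R by rewrite pnatr_eq0 -lt0n (leq_trans n0).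
rewrite /power_mean mulrACA mulfV // mul1r -mulrBr; congr (_ * _).
rewrite (@big_cat_nat _ _ _ (N n) 0 (M n)) //= addrAC subrr add0r.
rewrite -[X in _ = \sum_(X <= _ < _) _]add0n big_addn big_mkord.
by apply: eq_bigr => j _; rewrite addnC.
Qed.

(** The normalization by N gives the sum up to M the limit a i / gamma and the
    sum up to N the limit a i. *)
Lemma tail_L1 i :
  mean (P (M n)) (fun t => `|b_power_mean (N n) (M n) (u (M n)) i t - (gamma^-1 - 1) * a i|)
    @[n --> \oo] --> (0 : R).
Proof.
pose rt n : R := (M n)%:R / (N n)%:R.
pose v p n := mean (P (M n)) (fun t => `|power_mean (p n) i (fun j => u (M n) j t) - a i|).
have cu : rt n * v M n + v N n + `|rt n - gamma^-1| * `|a i| @[n --> \oo] --> (0 : R).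
  have -> : (0 : R) = gamma^-1 * 0 + 0 + `|gamma^-1 - gamma^-1| * `|a i|.
    by rewrite subrr normr0 mulr0 mul0r !addr0.
  apply: cvgD.
    apply: cvgD; last exact: array_L1.
    by apply: cvgM; [exact: cvg_inv_ratio|exact: array_L1_full].
  apply: cvgMr_tmp; apply: cvg_norm; apply: cvgB; first exact: cvg_inv_ratio.
  exact: cvg_cst.
apply: (squeeze_cvgr _ (cvg_cst (0 : R)) cu); apply: nearW => n.
have /andP[n0 nM] := NM n.
have bM := bdist i (leqnn (M n)); have bN := bdist i nM.
have cc c := bounded_rv_cst (P (M n)) c.
have bl : bounded_rv (P (M n))
    (fun t => `|b_power_mean (N n) (M n) (u (M n)) i t - (gamma^-1 - 1) * a i|).
  rewrite /b_power_mean; under eq_fun do rewrite b_power_meanE.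
  apply: bounded_rv_norm; apply: bounded_rvB; last exact: cc.
  apply: bounded_rvB; last exact: bounded_array_power_mean.
  by apply: bounded_rvZ; exact: bounded_array_power_mean.
rewrite ae_mean_ge0 //=; last exact: aeW.
rewrite /v -(meanZ _ bM) -meanD //; last exact: bounded_rvZ.
rewrite -(mean_cst (P (M n)) (`|rt n - gamma^-1| * `|a i|)) -meanD //; last first.
  by apply: bounded_rvD => //; exact: bounded_rvZ.
apply: ae_mean_le => //.
  by apply: bounded_rvD => //; apply: bounded_rvD => //; exact: bounded_rvZ.
apply: aeW => t; rewrite /b_power_mean b_power_meanE -/(rt n).
set X := power_mean (M n) _ _; set Y := power_mean (N n) _ _.
have -> : rt n * X - Y - (gamma^-1 - 1) * a i
    = rt n * (X - a i) - (Y - a i) + (rt n - gamma^-1) * a i by ring.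
apply: le_trans (ler_normD _ _) _; rewrite normrM lerD2r.
apply: le_trans (ler_normB _ _) _; rewrite lerD2r normrM ger0_norm //.
by rewrite divr_ge0.
Qed.

End TriangularArray.

(** The law of large numbers for one and for two equal factors. *)
Lemma LLN_appropriate_arrays (R : realType) (d : nat -> measure_display)
    (T : forall M, measurableType (d M)) (P : forall M, probability (T M) R)
    (x beta : forall M, nat -> {RV (P M) >-> R}) :
  LLN_appropriate x beta -> exists a b : nat -> R,
    array_LLN P (fun M i t => x M i t) a /\ array_LLN P (fun M i t => beta M i t) b.
Proof.
move=> [a [b [_ _ H _ _]]]; exists a, b; split=> gam g01 k; split.
- have := H 1%N 0%N (fun=> gam) (fun=> gam) (fun=> k) (fun=> k) (fun=> g01) (fun=> g01).
  rewrite big_ord1 big_ord0 mulr1.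
  by under eq_fun => M do under eq_fun => t do rewrite big_ord1 big_ord0 mulr1.
- have := H 2%N 0%N (fun=> gam) (fun=> gam) (fun=> k) (fun=> k) (fun=> g01) (fun=> g01).
  rewrite !big_ord_recl !big_ord0 !mulr1 -expr2.
  by under eq_fun => M do under eq_fun => t do
    rewrite !big_ord_recl !big_ord0 !mulr1 -expr2.
- have := H 0%N 1%N (fun=> gam) (fun=> gam) (fun=> k) (fun=> k) (fun=> g01) (fun=> g01).
  rewrite big_ord1 big_ord0 mul1r.
  by under eq_fun => M do under eq_fun => t do rewrite big_ord1 big_ord0 mul1r.
- have := H 0%N 2%N (fun=> gam) (fun=> gam) (fun=> k) (fun=> k) (fun=> g01) (fun=> g01).
  rewrite !big_ord_recl !big_ord0 !mulr1 mul1r -expr2.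
  by under eq_fun => M do under eq_fun => t do
    rewrite !big_ord_recl !big_ord0 !mulr1 mul1r -expr2.
Qed.

Section Moments.
Variables (R : realType) (d : nat -> measure_display) (T : forall M, measurableType (d M)).
Variable P : forall M, probability (T M) R.
Variables (u : forall M, nat -> T M -> R) (B l : R) (k : nat).
Arguments u : clear implicits.
Hypotheses (mu : forall M i, measurable_fun setT (u M i)) (B0 : 0 <= B).
Hypothesis uB : forall M i, (i < M)%N -> {ae P M, forall t, `|u M i t| <= B}.
Hypothesis cvg_u :
  mean (P M) (fun t => power_mean M k (fun j => u M j t)) @[M --> \oo] --> l.

Let bu M : bounded_rv (P M) (fun t => power_mean M k (fun j => u M j t)).
Proof. exact: (bounded_array_power_mean mu uB). Qed.

Lemma moment_limE : moment_lim P u k = l.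
Proof.
rewrite /moment_lim (_ : moment P u k = fun M =>
  (mean (P M) (fun t => power_mean M k (fun j => u M j t)))%:E); last first.
  by apply/funext => M; rewrite /moment meanE.
set f := fun M => _%:E.
have /cvg_lim -> // : f M @[M --> \oo] --> l%:E.
by apply: cvg_EFin; [exact: nearW|exact: cvg_u].
Qed.

(** Applied to 1 - x and to beta, this bounds the coefficients of the two power
    series and makes them converge on the contour. *)
Lemma power_mean_limit_le : `|l| <= B ^+ k.
Proof.
apply: (cvgr_to_le (cvg_norm cvg_u)); apply: nearW => M.
apply: le_trans (mean_norm_le (bu M)) _.
rewrite -[leRHS](mean_cst (P M)); apply: ae_mean_le.
- exact: bounded_rv_norm.
- exact: bounded_rv_cst.
apply: filterS (ae_array_le uB M) => t H.
rewrite /power_mean normrM ger0_norm ?invr_ge0 //.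
have h : \sum_(0 <= j < M) `|u M j t ^+ k| <= M%:R * B ^+ k.
  rewrite mulr_natl -[X in _ *+ X]subn0 -sumr_const_nat big_nat [leRHS]big_nat.
  by apply: ler_sum => j /andP[_ jM]; rewrite normrX lerXn2r ?nnegrE // H.
apply: (@le_trans _ _ (M%:R^-1 * (M%:R * B ^+ k))).
  by rewrite ler_wpM2l ?invr_ge0 // (le_trans (ler_norm_sum _ _ _)).
rewrite mulrA -[leRHS]mul1r ler_wpM2r ?exprn_ge0 //.
by case: (M) => [|m]; [rewrite mulr0|rewrite mulVf // pnatr_eq0].
Qed.

End Moments.

(** * The limit of the averaged moments *)

Theorem theorem4 (R : realType) (delta : R)
    (d : nat -> measure_display) (T : forall M, measurableType (d M))
    (P : forall M, probability (T M) R)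
    (x beta : forall M, nat -> {RV (P M) >-> R})
    (delta01 : 0 < delta < 1)
    (x_supp : forall M i, (i < M)%N ->
       {ae P M, forall t, delta < x M i t < 2 - delta})
    (beta_supp : forall M i, (i < M)%N ->
       {ae P M, forall t, 0 < beta M i t < 1})
    (xbeta_LLN : LLN_appropriate x beta)
    (gamma : R) (gamma01 : 0 < gamma < 1)
    (r : R) (r_range : 1 - delta < r < 1)
    (N M : nat -> nat) (NM : forall n, (0 < N n < M n)%N)
    (N_oo : N @ \oo --> \oo) (M_oo : M @ \oo --> \oo)
    (NM_gamma : ((N n)%:R / (M n)%:R : R) @[n --> \oo] --> gamma)
    (nu : nat) (nu_gt0 : (0 < nu)%N) (k : 'I_nu -> nat) :
  let y M i t := 1 - x M i t in
  let c := moment_lim P y in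
  let g := moment_lim P (fun M i => beta M i) in
  ((avg_schur_expectation (P (M n)) (N := N n) (M n)
      (fun i => x (M n) i) (fun i => beta (M n) i)
      (fun lam => \prod_(j < nu) particle_moment R (k j) lam))%:C : Cplx R)
    @[n --> \oo]
  --> \prod_(j < nu) limit_moment gamma c g r (k j).
Proof.
move=> y c g; have /andP[dl0 dl1] := delta01; have /andP[rlo r1] := r_range.
have /andP[gm0 gm1] := gamma01.
have gm01 : 0 < gamma <= 1 by rewrite gm0 ltW.
have r0 : 0 < r by apply: le_lt_trans rlo; rewrite subr_ge0 ltW.
have rho0 : 0 <= 1 - delta by rewrite subr_ge0 ltW.
have NM' n : (N n <= M n)%N by case/andP: (NM n) => _ /ltnW.
have NM0 n : (0 < N n <= M n)%N by case/andP: (NM n) => -> /ltnW.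
have [a [b [xLLN bLLN]]] := LLN_appropriate_arrays xbeta_LLN.
have mx L i : measurable_fun setT (x L i) by exact: measurable_funPT.
have mb L i : measurable_fun setT (beta L i) by exact: measurable_funPT.
have my L i : measurable_fun setT (y L i).
  by apply: measurable_funB => //; exact: measurable_cst.
have xB L i : (i < L)%N -> {ae P L, forall t, `|x L i t| <= 2}.
  by move=> iL; apply: filterS (x_supp L i iL) => t /andP[h1 h2]; rewrite ler_norml; lra.
have yB L i : (i < L)%N -> {ae P L, forall t, `|y L i t| <= 1 - delta}.
  move=> iL; apply: filterS (x_supp L i iL) => t /andP[h1 h2].
  by rewrite /y ler_norml; apply/andP; split; lra.
have bB L i : (i < L)%N -> {ae P L, forall t, `|beta L i t| <= 1}.
  by move=> iL; apply: filterS (beta_supp L i iL) => t /andP[h1 h2]; rewrite ler_norml; lra.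
have cvy i := @one_sub_mean_cvg R d T P (fun L i => x L i) 2 a mx xB xLLN i.
have cvb i := @array_mean_cvg R d T P (fun L i => beta L i) b bLLN i.
have cE i : c i = one_sub_moment a i.
  exact: (@moment_limE R d T P y (1 - delta) _ i my yB (cvy i)).
have gE i : g i = b i.
  exact: (@moment_limE R d T P (fun L i => beta L i) 1 _ i mb bB (cvb i)).
have c_le i : `|c i| <= (1 - delta) ^+ i.
  by rewrite cE; exact: (@power_mean_limit_le R d T P y _ _ i my rho0 yB (cvy i)).
have g_le i : `|g i| <= 1.
  rewrite gE; have := @power_mean_limit_le R d T P (fun L i => beta L i) _ _ i mb ler01 bB (cvb i).
  by rewrite expr1n.
have g0 : g 0%N = 1.
  rewrite gE; apply: (cvg_unique _ (cvb 0%N)) => //.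
  apply: cvg_near_cst; near=> L.
  have L0 : (0 < L)%N by near: L; exact: nbhs_infty_gt.
  rewrite -[RHS](mean_cst (P L)); apply: eq_mean => t; rewrite /power_mean.
  by under eq_bigr do rewrite expr0; rewrite sumr_const_nat subn0 mulVf // pnatr_eq0 -lt0n.
pose A := gamma^-1 - 1; have A0 : 0 <= A by rewrite subr_ge0 ltW // invf_gt1.
(* M / N tends to 1 / gamma, so M <= D * N from some n on. *)
pose D := 2 / gamma.
have D1 : 1 <= D by rewrite ler_pdivlMr // mul1r; lra.
have [Cst Cst0 H] := product_moment_estimate k delta01 r_range D1 A0 c_le g_le.
pose m := product_moment_limit A c g r k.
have mE : \prod_(j < nu) limit_moment gamma c g r (k j) = m :> R[i].
  apply: eq_bigr => j _; apply: limit_momentE; first by rewrite r0 r1.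
  exact: ccirc_limit_symbol rho0 rlo r1 c_le g_le.
rewrite mE.
pose err L n : R := mean (P (M n)) (fun t => model_error (1 - delta) r A c g D L
  (fun i : 'I_(N n) => x (M n) i t) (fun j : 'I_(M n - N n) => beta (M n) (N n + j)%N t)).
pose q := circle_ratio (1 - delta) r.
pose tail L : R := 2 / r * ((3 + D + 2 * A) / (1 - q) * q ^+ L).
have cvg_err L : err L n @[n --> \oo] --> tail L.
  have -> : err L = fun n => (N n)%:R^-1 + 2 / r * (\sum_(0 <= i < L)
      (mean (P (M n)) (fun t => `|y_power_mean (N n) (fun i => x (M n) i) i t - c i|) * r^-1 ^+ i
       + mean (P (M n)) (fun t => `|b_power_mean (N n) (M n) (fun i => beta (M n) i) i t - A * g i|))
    + mean (P (M n)) (fun t => `|b_power_mean (N n) (M n) (fun i => beta (M n) i) 0 t - A|)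
    + (3 + D + 2 * A) / (1 - q) * q ^+ L).
    apply/funext => n; apply: mean_model_error => //; first exact: ltW.
      exact: x_supp.
    exact: beta_supp.
  have cN : (N n)%:R^-1 @[n --> \oo] --> (0 : R) by exact: (cvg_inv_N N_oo).
  have cy i : mean (P (M n)) (fun t =>
      `|y_power_mean (N n) (fun i => x (M n) i) i t - c i|) @[n --> \oo] --> (0 : R).
    have := @one_sub_L1 R d T P (fun L i => x L i) 2 a mx (ler0n _ 2) xB xLLN
      N M gamma gm01 NM0 N_oo M_oo NM_gamma i.
    under eq_fun => n do under eq_fun => t do rewrite /power_mean big_mkord.
    by rewrite cE.
  have cb i : mean (P (M n)) (fun t =>
      `|b_power_mean (N n) (M n) (fun i => beta (M n) i) i t - A * g i|)
      @[n --> \oo] --> (0 : R).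
    rewrite gE; exact: (@tail_L1 R d T P (fun L i => beta L i) 1 b mb ler01 bB bLLN
      N M gamma gm01 NM0 N_oo M_oo NM_gamma i).
  have cb0 : mean (P (M n)) (fun t =>
      `|b_power_mean (N n) (M n) (fun i => beta (M n) i) 0 t - A|) @[n --> \oo] --> (0 : R).
    by have := cb 0%N; rewrite g0 mulr1.
  rewrite [X in _ --> X](_ : tail L = 0 + 2 / r * (\sum_(0 <= i < L) (0 * r^-1 ^+ i + 0) + 0
      + (3 + D + 2 * A) / (1 - q) * q ^+ L)); last first.
    by rewrite big1 ?add0r // => i _; rewrite mul0r addr0.
  apply: cvgD; first exact: cN.
  apply: cvgMl_tmp; apply: cvgD; last exact: cvg_cst.
  apply: cvgD; last exact: cb0.
  by apply: cvg_to_sum => i _; apply: cvgD; [apply: cvgMr_tmp; exact: cy|exact: cb].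
have cvg_tail : Cst * tail L @[L --> \oo] --> (0 : R).
  rewrite [X in _ --> X](_ : _ = Cst * (2 / r * ((3 + D + 2 * A) / (1 - q) * 0))); last first.
    by rewrite !mulr0.
  do 3 apply: cvgMl_tmp; apply: cvg_expr.
  have /andP[q0 q1] : 0 <= q < 1 by exact: circle_ratio01 rlo r1.
  by rewrite ger0_norm.
have sizes : \forall n \near \oo, (forall j, (k j < M n)%N) /\ (M n)%:R <= D * (N n)%:R.
  have h1 : \forall n \near \oo, forall j, (k j < M n)%N.
    by apply: filter_forall => j; exact: M_oo (nbhs_infty_gt _).
  have h2 : \forall n \near \oo, (M n)%:R / (N n)%:R < D.
    apply: (cvgr_lt _ (cvg_inv_ratio gm01 NM_gamma)).
    by rewrite /D ltr_pMl ?invr_gt0 // ltr1n.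
  apply: filterS2 h1 h2 => n h1 h2; split=> //.
  by rewrite -ler_pdivrMr ?ltr0n; [exact: ltW|case/andP: (NM n)].
have small e : 0 < e -> \forall n \near \oo,
    `|avg_schur_expectation (P (M n)) (N := N n) (M n)
      (fun i => x (M n) i) (fun i => beta (M n) i)
      (fun lam => \prod_(j < nu) particle_moment R (k j) lam) - complex.Re m| < e /\
    `|complex.Im m| < e.
  move=> e0.
  (* The truncation order is fixed first; then n tends to infinity. *)
  have [L Le] : exists L, Cst * tail L < e.
    have := cvgr_lt _ cvg_tail _ e0.
    by move=> [L _ /(_ L (leqnn L)) h]; exists L.
  have h : \forall n \near \oo, Cst * err L n < e.
    by apply: (cvgr_lt _ _ _ Le); apply: cvgMl_tmp; exact: cvg_err.
  apply: filterS2 sizes h => n [kM MD] he.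
  have /andP[N0 _] := NM n.
  have NMn : (N n + (M n - N n) = M n)%N by rewrite subnKC.
  have E t (hx : forall i : 'I_(N n), delta < x (M n) i t < 2 - delta)
      (hb : forall j : 'I_(M n - N n), 0 < beta (M n) (N n + j)%N t < 1) :=
    H (N n) (M n - N n)%N L (fun i => x (M n) i t) (fun j => beta (M n) (N n + j)%N t) N0
      ltac:(by move=> j; rewrite NMn) ltac:(by rewrite NMn) hx hb.
  have xs i := x_supp (M n) i; have bs i := beta_supp (M n) i.
  split; apply: le_lt_trans he.
    by apply: (avg_expectation_sub_le (NM' n) (ltW dl0) (mx _) (mb _) xs bs) => t hx hb;
      have [] := E t hx hb.
  by apply: (le_mean_model_error (NM' n) (ltW dl0) (mx _) (mb _) xs bs) => t hx hb;
    have [] := E t hx hb.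
(* The moments are real, so the estimate forces the limit to be real. *)
have Im0 : complex.Im m = 0.
  apply/eqP; rewrite -normr_eq0; apply/eqP/le_anti; rewrite normr_ge0 andbT.
  apply/ler_addgt0Pl => e /small [n _ /(_ n (leqnn n)) [_ /ltW]].
  by rewrite addr0.
have -> : m = (complex.Re m)%:C by apply/eqP; rewrite eq_complex /= Im0 !eqxx.
apply/cvgrPdist_lt => e e0.
have [re re0 ->] : exists2 re : R, 0 < re & e = re%:C.
  move: e e0 => [a1 b1]; rewrite ltcE /= => /andP[/eqP -> a10]; by exists a1.
apply: filterS (small _ re0) => n [h _].
rewrite -[`|_|]/((normc _)%:C) ltcR -rmorphB normcR distrC.
exact: h.
Unshelve. all: by end_near. Qed.
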